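(* There exists a mass parameter $$\mu\in 0.004253863522+10^{-10}[-1,1]$$ such that the planar circular restricted three body problem with mass parameter $\mu$ possesses a homoclinic orbit to the libration point $L_1^\mu$, lying in both the one dimensional unstable manifold and the one dimensional stable manifold of $L_1^\mu$.
   Context: The planar circular restricted three body problem (in rotating coordinates) with mass parameter $\mu\in(0,1)$ is the Hamiltonian system on the phase space with coordinates $\mathbf{x}=(X,Y,P_X,P_Y)$ given by $$\dot{\mathbf{x}}=J\nabla H(\mathbf{x}),\qquad J=\begin{pmatrix}0&\mathrm{id}\\-\mathrm{id}&0\end{pmatrix},$$ where $\mathrm{id}$ is the $2\times2$ identity matrix and $$H=\tfrac12(P_X^2+P_Y^2)+YP_X-XP_Y-\frac{1-\mu}{r_1}-\frac{\mu}{r_2},$$ $$r_1^2=(X-\mu)^2+Y^2,\qquad r_2^2=(X-\mu+1)^2+Y^2.$$ The primaries are at $(\mu,0)$ (mass $1-\mu$) and $(\mu-1,0)$ (mass $\mu$). The libration point $L_1^\mu=(x_{L_1}^\mu,0,0,x_{L_1}^\mu)$ is the collinear equilibrium located between the primaries, i.e. $\mu-1<x_{L_1}^\mu<\mu$. The Jacobian of the vector field at $L_1^\mu$ has two real eigenvalues $\pm\lambda$ ($\lambda>0$) and two purely imaginary eigenvalues; the one dimensional unstable and stable manifolds are those associated with $\lambda$ and $-\lambda$. A homoclinic orbit to $L_1^\mu$ is a non-constant solution $\mathbf{x}(t)$, defined for all $t\in\mathbb{R}$, with $\mathbf{x}(t)\to L_1^\mu$ as $t\to+\infty$ and as $t\to-\infty$.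 *)

(* Defs.v *)
From Stdlib Require Import Reals.
From Coquelicot Require Import Coquelicot.
Open Scope R_scope.

(* Phase space coordinates (X, Y, P_X, P_Y); the norm is the Euclidean one. *)
Definition state : Type := (R * R * R * R)%type.

Definition gradient (H : state -> R) (p : state) : state :=
  let '(X, Y, PX, PY) := p in
  (Derive (fun s => H (s, Y, PX, PY)) X,
   Derive (fun s => H (X, s, PX, PY)) Y,
   Derive (fun s => H (X, Y, s, PY)) PX,
   Derive (fun s => H (X, Y, PX, s)) PY).

(* J = (0, id; -id, 0), with 2 x 2 blocks. *)
Definition J (v : state) : state :=
  let '(a, b, c, d) := v in (c, d, - a, - b).

Definition r1 (mu : R) (p : state) : R :=
  let '(X, Y, _, _) := p in sqrt ((X - mu) ^ 2 + Y ^ 2).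

Definition r2 (mu : R) (p : state) : R :=
  let '(X, Y, _, _) := p in sqrt ((X - mu + 1) ^ 2 + Y ^ 2).

Definition hamiltonian (mu : R) (p : state) : R :=
  let '(X, Y, PX, PY) := p in
  (PX ^ 2 + PY ^ 2) / 2 + Y * PX - X * PY
  - (1 - mu) / r1 mu p - mu / r2 mu p.

Definition vector_field (mu : R) (p : state) : state :=
  J (gradient (hamiltonian mu) p).

(* Division and [Derive] are total, so the exclusion of collisions with the
   primaries has to be required explicitly of solutions. *)
Definition collision_free (mu : R) (p : state) : Prop :=
  r1 mu p <> 0 /\ r2 mu p <> 0.

Definition solves_at (mu : R) (x : R -> state) (t : R) : Prop :=
  collision_free mu (x t) /\ is_derive x t (vector_field mu (x t)).

Definition is_L1 (mu : R) (p : state) : Prop :=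
  exists xL : R,
    p = (xL, 0, 0, xL) /\ mu - 1 < xL < mu /\ vector_field mu p = zero.

(* [D] is the Jacobian of [F] at [p], as a linear map. *)
Definition jacobian_eigenvalue (F : state -> state) (p : state) (lam : R)
  : Prop :=
  exists D : state -> state,
    filterdiff F (locally p) D /\
    exists v : state, v <> zero /\ D v = scal lam v.

(* At a saddle-center, mere convergence to [p] does not by definition exclude
   the center directions: the invariant manifold associated with the real
   eigenvalue [lam] consists of the points whose orbits approach [p] at the
   exponential rate [lam]. *)
Definition unstable_manifold (mu : R) (p : state) (lam : R) (q : state)
  : Prop :=
  exists y : R -> state,
    y 0 = q /\
    (forall t, t <= 0 -> solves_at mu y t) /\
    exists C : R, forall t, t <= 0 -> norm (minus (y t) p) <= C * exp (lam * t).

(* Here [lam] is the negative eigenvalue. *)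
Definition stable_manifold (mu : R) (p : state) (lam : R) (q : state)
  : Prop :=
  exists y : R -> state,
    y 0 = q /\
    (forall t, 0 <= t -> solves_at mu y t) /\
    exists C : R, forall t, 0 <= t -> norm (minus (y t) p) <= C * exp (lam * t).

Definition homoclinic_orbit (mu : R) (p : state) (x : R -> state) : Prop :=
  (forall t, solves_at mu x t) /\
  (exists s t, x s <> x t) /\
  filterlim x (Rbar_locally p_infty) (locally p) /\
  filterlim x (Rbar_locally m_infty) (locally p).

(* Main.v *)
Require Import Defs.
From Stdlib Require Import Reals Ranalysis5 Lra Psatz Lia ZArith List IndefiniteDescription.
From Coquelicot Require Import Coquelicot.
Open Scope R_scope.

(** The orbit is symmetric. The reflection (X, Y, P_X, P_Y) -> (X, -Y, -P_X, P_Y) turns solutions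
    into time-reversed solutions and fixes the libration point, so a solution that emerges from
    the libration point and meets the fixed plane Y = P_X = 0 of the reflection continues as its
    own mirror image and returns to the libration point. It remains to choose the mass so that
    the unstable manifold, at a suitable crossing of the axis Y = 0, has P_X = 0 there.

    The family is parametrised by the distance g between the libration point and the small
    primary, because the mass [mu_of g], the position [x_of g], the eigenvalue [lam_of g] and its
    eigenvector are then explicit. For every g between two numbers that differ by 6e-11, the
    unstable manifold exists long enough and crosses Y = 0 transversally within a time window
    of length 0.04 ([window_certificate]); at one end of the interval P_X is negative at the
    crossing, at the other it is positive ([crossing_minus_certificate],
    [crossing_plus_certificate]). As P_X at the crossing depends continuously on g, it vanishes
    for some g ([shooting]).

    The certificates are computations with Taylor models: polynomials with integer coefficients
    on [0, 1], representing reals scaled by 2^70, with an error bound. A recurrence proposes a polynomial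
    solution over one time step; only its residual is checked ([verify]), and a Picard iteration
    in a tube around it ([step_exists]) yields a true solution, whose distance from the polynomial
    is bounded by a Gronwall estimate with the logarithmic norm of the field ([shadow]).
    The beginning of the branch, on the time axis from minus infinity, is treated in the
    variable s = exp (lam t): a polynomial in s whose residual is of order s^2 is corrected by a
    contraction in the space of corrections of order s^2, because twice the eigenvalue
    exceeds the Lipschitz constant of the field near the libration point ([local_exists]).
    The same comparison of rates makes the branch unique and continuous in g ([branch_close]):
    two branches for the same g differ by at most a multiple of exp (2 lam t) in the far past, and
    separate at a smaller rate.

    At the end the orbit and its mirror image are glued ([sol_glue]), the exponential estimate of
    the branch gives the membership in both invariant manifolds ([branch_decay]), and the
    linearisation is computed ([jacobian_field]). *)

(** * The phase space and the vector field *)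

Lemma norm_state (a b c d : R) :
  norm ((a, b, c, d) : state) = sqrt (a ^ 2 + b ^ 2 + c ^ 2 + d ^ 2).
Proof.
  change (sqrt (sqrt (sqrt (Rabs a ^ 2 + Rabs b ^ 2) ^ 2 + Rabs c ^ 2) ^ 2
    + Rabs d ^ 2) = sqrt (a ^ 2 + b ^ 2 + c ^ 2 + d ^ 2)).
  rewrite !pow2_abs, !pow2_sqrt by (try rewrite pow2_sqrt; nra).
  reflexivity.
Qed.

Definition stretch (z : state) : state :=
  let '(x, y, u, v) := z in (3 * x, 3 * y, u, v).
Definition unstretch (z : state) : state :=
  let '(x, y, u, v) := z in (x / 3, y / 3, u, v).
(** Weight 3 on the positions. With weight w the logarithmic norm of the field is at most
    (w^2 + G) / (2 w), G being a bound of the tidal force; near the libration point G is about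
    ten, and w = 3 is near the optimum. *)
Definition wnorm (z : state) : R := norm (stretch z).
Definition wdot (z z' : state) : R :=
  let '(x, y, u, v) := z in let '(x', y', u', v') := z' in
  9 * (x * x') + 9 * (y * y') + u * u' + v * v'.

Lemma wnorm_eq x y u v :
  wnorm (x, y, u, v) = sqrt (9 * x ^ 2 + 9 * y ^ 2 + u ^ 2 + v ^ 2).
Proof. unfold wnorm, stretch. rewrite norm_state. f_equal. ring. Qed.

Lemma wnorm_ge0 z : 0 <= wnorm z.
Proof. apply norm_ge_0. Qed.

Lemma wnorm_sqr z : wnorm z ^ 2 = wdot z z.
Proof.
  destruct z as [[[x y] u] v]. rewrite wnorm_eq, pow2_sqrt by nra. simpl. ring.
Qed.

Lemma state_ext (a b c d a' b' c' d' : R) :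
  a = a' -> b = b' -> c = c' -> d = d' -> (a, b, c, d) = (a', b', c', d').
Proof. congruence. Qed.

Lemma minus_state a b c d a' b' c' d' :
  minus ((a, b, c, d) : state) (a', b', c', d') = (a - a', b - b', c - c', d - d').
Proof. reflexivity. Qed.
Lemma plus_state a b c d a' b' c' d' :
  plus ((a, b, c, d) : state) (a', b', c', d') = (a + a', b + b', c + c', d + d').
Proof. reflexivity. Qed.
Lemma scal_state k a b c d :
  scal k ((a, b, c, d) : state) = (k * a, k * b, k * c, k * d).
Proof. reflexivity. Qed.
Lemma opp_state a b c d :
  opp ((a, b, c, d) : state) = (- a, - b, - c, - d).
Proof. reflexivity. Qed.
Lemma zero_state : (zero : state) = (0, 0, 0, 0).
Proof. reflexivity. Qed.

Definition kepler (x y : R) : R * R :=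
  (x * / sqrt (x ^ 2 + y ^ 2) ^ 3, y * / sqrt (x ^ 2 + y ^ 2) ^ 3).

Definition force (mu : R) (x y : R) : R * R :=
  ((1 - mu) * fst (kepler (x - mu) y) + mu * fst (kepler (x - mu + 1) y),
   (1 - mu) * snd (kepler (x - mu) y) + mu * snd (kepler (x - mu + 1) y)).

Definition field (mu : R) (z : state) : state :=
  let '(x, y, u, v) := z in
  (u + y, v - x, v - fst (force mu x y), - u - snd (force mu x y)).

Lemma vector_field_eq mu z :
  collision_free mu z -> vector_field mu z = field mu z.
Proof.
  destruct z as [[[x y] u] v]. unfold collision_free, r1, r2. intros [H1 H2].
  assert (P1 : 0 < (x - mu) ^ 2 + y ^ 2).
  { destruct (Rle_lt_dec ((x - mu) ^ 2 + y ^ 2) 0); [|assumption].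
    exfalso; apply H1; apply sqrt_neg_0; assumption. }
  assert (P2 : 0 < (x - mu + 1) ^ 2 + y ^ 2).
  { destruct (Rle_lt_dec ((x - mu + 1) ^ 2 + y ^ 2) 0); [|assumption].
    exfalso; apply H2; apply sqrt_neg_0; assumption. }
  assert (Q1 : 0 < sqrt ((x - mu) ^ 2 + y ^ 2)) by (apply sqrt_lt_R0; assumption).
  assert (Q2 : 0 < sqrt ((x - mu + 1) ^ 2 + y ^ 2)) by (apply sqrt_lt_R0; assumption).
  unfold vector_field, J, gradient, hamiltonian, field, force, kepler, r1, r2.
  simpl fst; simpl snd.
  assert (D : forall (f : R -> R) (a l : R), is_derive f a l -> Derive f a = l)
    by (intros f a l H; apply is_derive_unique, H).
  f_equal; [f_equal; [f_equal|]|].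
  - apply D. auto_derive; [trivial|field].
  - apply D. auto_derive; [trivial|field].
  - match goal with |- _ = ?g => rewrite (D _ _ (- g)); [ring|] end.
    auto_derive.
    + repeat split; try assumption; try lra; simpl in P1, P2 |- *; lra.
    + simpl in *. change (x + - mu) with (x - mu). field. split; assumption.
  - match goal with |- _ = ?g => rewrite (D _ _ (- g)); [ring|] end.
    auto_derive.
    + repeat split; try assumption; try lra; simpl in P1, P2 |- *; lra.
    + simpl in *. change (x + - mu) with (x - mu). field. split; assumption.
Qed.

(** * Lipschitz constants of the vector field *)

(** With v = 1/r and w = 1/r' the square of the difference is
    (v - w)^2 (v^2 + v w + w^2) + v^3 w^3 D, where D is the squared distance of the two points, and
    |v - w| <= v w sqrt D. Altogether it is at most (v w (v + w))^2 D. Unlike the mean value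
    theorem this also works when the segment between the points meets the primary. *)
Lemma kepler_lipschitz rho x y x' y' :
  0 < rho -> rho <= sqrt (x ^ 2 + y ^ 2) -> rho <= sqrt (x' ^ 2 + y' ^ 2) ->
  (fst (kepler x y) - fst (kepler x' y')) ^ 2
  + (snd (kepler x y) - snd (kepler x' y')) ^ 2
  <= (2 / rho ^ 3) ^ 2 * ((x - x') ^ 2 + (y - y') ^ 2).
Proof.
  intros Hr H1 H2. cbn [kepler fst snd].
  assert (N1 : sqrt (x ^ 2 + y ^ 2) ^ 2 = x ^ 2 + y ^ 2) by (apply pow2_sqrt; nra).
  assert (N2 : sqrt (x' ^ 2 + y' ^ 2) ^ 2 = x' ^ 2 + y' ^ 2) by (apply pow2_sqrt; nra).
  set (r := sqrt (x ^ 2 + y ^ 2)) in *. set (r' := sqrt (x' ^ 2 + y' ^ 2)) in *.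
  rewrite <- !pow_inv.
  assert (B : forall s, rho <= s -> 0 < / s <= / rho).
  { intros s Hs. split; [apply Rinv_0_lt_compat; lra|apply Rinv_le_contravar; lra]. }
  pose proof (B r H1) as V. pose proof (B r' H2) as W.
  assert (E1 : r * / r = 1) by (field; lra).
  assert (E2 : r' * / r' = 1) by (field; lra).
  unfold Rdiv. rewrite <- !pow_inv.
  set (v := / r) in *. set (w := / r') in *. set (k := / rho) in *.
  clearbody r r' v w k.
  set (D := (x - x') ^ 2 + (y - y') ^ 2).
  assert (D0 : 0 <= D) by (apply Rplus_le_le_0_compat; apply pow2_ge_0).
  assert (C : (r - r') ^ 2 <= D).
  { assert (L : x * x' + y * y' <= r * r').
    { apply Rsqr_incr_0_var; [|apply Rmult_le_pos; lra].
      unfold Rsqr.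
      replace (r * r' * (r * r')) with ((x ^ 2 + y ^ 2) * (x' ^ 2 + y' ^ 2))
        by (rewrite <- N1, <- N2; ring).
      pose proof (pow2_ge_0 (x * y' - x' * y)). lra. }
    replace ((r - r') ^ 2) with (r ^ 2 + r' ^ 2 - 2 * (r * r')) by ring.
    rewrite N1, N2. unfold D. lra. }
  assert (I : (x * v ^ 3 - x' * w ^ 3) ^ 2 + (y * v ^ 3 - y' * w ^ 3) ^ 2
    = (v - w) ^ 2 * (v ^ 2 + v * w + w ^ 2) + v ^ 3 * w ^ 3 * D).
  { transitivity ((x ^ 2 + y ^ 2) * v ^ 6 + (x' ^ 2 + y' ^ 2) * w ^ 6
      + v ^ 3 * w ^ 3 * (D - (x ^ 2 + y ^ 2) - (x' ^ 2 + y' ^ 2))); [unfold D; ring|].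
    rewrite <- N1, <- N2.
    replace (r ^ 2 * v ^ 6) with ((r * v) ^ 2 * v ^ 4) by ring.
    replace (r' ^ 2 * w ^ 6) with ((r' * w) ^ 2 * w ^ 4) by ring.
    replace (v ^ 3 * w ^ 3 * (D - r ^ 2 - r' ^ 2)) with
      (v ^ 3 * w ^ 3 * D - (r * v) ^ 2 * v * w ^ 3 - (r' * w) ^ 2 * w * v ^ 3) by ring.
    rewrite E1, E2. ring. }
  rewrite I.
  assert (J : (v - w) ^ 2 <= v ^ 2 * w ^ 2 * D).
  { replace ((v - w) ^ 2) with (v ^ 2 * w ^ 2 * (r - r') ^ 2).
    - apply Rmult_le_compat_l; [nra|exact C].
    - replace (v ^ 2 * w ^ 2 * (r - r') ^ 2) with (((r * v) * w - (r' * w) * v) ^ 2) by ring.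
      rewrite E1, E2. ring. }
  apply Rle_trans with (v ^ 2 * w ^ 2 * D * (v ^ 2 + v * w + w ^ 2) + v ^ 3 * w ^ 3 * D).
  { apply Rplus_le_compat_r, Rmult_le_compat_r; [nra|exact J]. }
  replace (v ^ 2 * w ^ 2 * D * (v ^ 2 + v * w + w ^ 2) + v ^ 3 * w ^ 3 * D)
    with ((v * w * (v + w)) ^ 2 * D) by ring.
  apply Rmult_le_compat_r; [exact D0|].
  apply pow_incr; split; [apply Rmult_le_pos; nra|].
  replace (2 * k ^ 3) with (k * k * (k + k)) by ring.
  assert (0 <= v * w) by nra.
  assert (v * w <= k * k) by (apply Rmult_le_compat; lra).
  apply Rmult_le_compat; lra.
Qed.

Definition away (rho1 rho2 mu : R) (z : state) : Prop :=
  rho1 <= r1 mu z /\ rho2 <= r2 mu z.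

Lemma norm_state_triangle (z w : state) : norm (plus z w) <= norm z + norm w.
Proof. exact (norm_triangle z w). Qed.

Lemma norm_state_scal k (z : state) : norm (scal k z) = Rabs k * norm z.
Proof.
  destruct z as [[[a b] c] d]. rewrite scal_state, !norm_state.
  rewrite <- sqrt_Rsqr_abs, <- sqrt_mult_alt by apply Rle_0_sqr.
  f_equal. unfold Rsqr. ring.
Qed.

Lemma norm4_le x y u v k : 0 <= k -> x ^ 2 + y ^ 2 + u ^ 2 + v ^ 2 <= k ^ 2 ->
  norm ((x, y, u, v) : state) <= k.
Proof.
  intros Hk H. rewrite norm_state. rewrite <- (sqrt_pow2 k Hk). apply sqrt_le_1_alt, H.
Qed.

Lemma force_lipschitz rho1 rho2 mu G x y u v x' y' u' v' :
  0 < rho1 -> 0 < rho2 -> 0 <= mu <= 1 ->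
  away rho1 rho2 mu (x, y, u, v) -> away rho1 rho2 mu (x', y', u', v') ->
  2 * ((1 - mu) / rho1 ^ 3 + mu / rho2 ^ 3) <= G ->
  (fst (force mu x y) - fst (force mu x' y')) ^ 2
  + (snd (force mu x y) - snd (force mu x' y')) ^ 2
  <= G ^ 2 * ((x - x') ^ 2 + (y - y') ^ 2).
Proof.
  intros P1 P2 Hmu [A1 A2] [B1 B2] HG. unfold r1, r2 in *.
  pose proof (kepler_lipschitz rho1 _ _ _ _ P1 A1 B1) as K1.
  pose proof (kepler_lipschitz rho2 _ _ _ _ P2 A2 B2) as K2.
  replace (x - mu - (x' - mu)) with (x - x') in K1 by ring.
  replace (x - mu + 1 - (x' - mu + 1)) with (x - x') in K2 by ring.
  cbn [force fst snd].
  set (D := (x - x') ^ 2 + (y - y') ^ 2) in *.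
  assert (D0 : 0 <= D) by (apply Rplus_le_le_0_compat; apply pow2_ge_0).
  set (a1 := fst (kepler (x - mu) y)) in *. set (b1 := snd (kepler (x - mu) y)) in *.
  set (a2 := fst (kepler (x - mu + 1) y)) in *. set (b2 := snd (kepler (x - mu + 1) y)) in *.
  set (c1 := fst (kepler (x' - mu) y')) in *. set (d1 := snd (kepler (x' - mu) y')) in *.
  set (c2 := fst (kepler (x' - mu + 1) y')) in *. set (d2 := snd (kepler (x' - mu + 1) y')) in *.
  clearbody a1 b1 a2 b2 c1 d1 c2 d2.
  assert (S : forall k, 0 <= k -> k ^ 2 * D = (k * sqrt D) ^ 2).
  { intros k Hk. rewrite Rpow_mult_distr, pow2_sqrt; auto. }
  assert (Q1 : 0 < / rho1 ^ 3) by (apply Rinv_0_lt_compat, pow_lt; exact P1).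
  assert (Q2 : 0 < / rho2 ^ 3) by (apply Rinv_0_lt_compat, pow_lt; exact P2).
  unfold Rdiv in *. set (k1 := / rho1 ^ 3) in *. set (k2 := / rho2 ^ 3) in *.
  clearbody k1 k2.
  assert (SD := sqrt_pos D).
  rewrite S in K1, K2 by lra.
  assert (T : forall a b k, 0 <= k -> a ^ 2 + b ^ 2 <= k ^ 2 ->
    norm ((a, b, 0, 0) : state) <= k) by (intros; apply norm4_le; lra).
  assert (N : norm (plus (scal (1 - mu) ((a1 - c1, b1 - d1, 0, 0) : state))
     (scal mu ((a2 - c2, b2 - d2, 0, 0) : state))) <= G * sqrt D).
  { eapply Rle_trans; [apply norm_state_triangle|].
    rewrite !norm_state_scal.
    rewrite !Rabs_pos_eq by lra.
    eapply Rle_trans.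
    { apply Rplus_le_compat; apply Rmult_le_compat_l; try lra; apply T;
        [| exact K1 | | exact K2]; apply Rmult_le_pos; lra. }
    replace ((1 - mu) * (2 * k1 * sqrt D) + mu * (2 * k2 * sqrt D))
      with (2 * ((1 - mu) * k1 + mu * k2) * sqrt D) by ring.
    apply Rmult_le_compat_r; assumption. }
  rewrite !scal_state, plus_state, norm_state in N.
  assert (G0 : 0 <= G) by nra.
  rewrite (S G G0).
  pose proof (pow_incr _ _ 2 (conj (sqrt_pos _) N)) as N2.
  rewrite pow2_sqrt in N2 by (repeat apply Rplus_le_le_0_compat; apply pow2_ge_0).
  eapply Rle_trans; [|exact N2]. right. ring.
Qed.

Lemma tidal_ge0 rho1 rho2 mu G : 0 < rho1 -> 0 < rho2 -> 0 <= mu <= 1 ->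
  2 * ((1 - mu) / rho1 ^ 3 + mu / rho2 ^ 3) <= G -> 0 <= G.
Proof.
  intros P1 P2 Hmu HG. eapply Rle_trans; [|exact HG].
  assert (Q1 : 0 < / rho1 ^ 3) by (apply Rinv_0_lt_compat, pow_lt; exact P1).
  assert (Q2 : 0 < / rho2 ^ 3) by (apply Rinv_0_lt_compat, pow_lt; exact P2).
  unfold Rdiv. nra.
Qed.

Lemma field_lipschitz rho1 rho2 mu G K z z' :
  0 < rho1 -> 0 < rho2 -> 0 <= mu <= 1 ->
  away rho1 rho2 mu z -> away rho1 rho2 mu z' ->
  2 * ((1 - mu) / rho1 ^ 3 + mu / rho2 ^ 3) <= G ->
  4 <= K -> 1 + G / 3 <= K ->
  wnorm (minus (field mu z) (field mu z')) <= K * wnorm (minus z z').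
Proof.
  intros P1 P2 Hmu A B HG K1 K2.
  destruct z as [[[x y] u] v], z' as [[[x' y'] u'] v'].
  pose proof (force_lipschitz _ _ _ _ _ _ _ _ _ _ _ _ P1 P2 Hmu A B HG) as F.
  cbn [field]. rewrite !minus_state.
  set (f := fst (force mu x y) - fst (force mu x' y')) in *.
  set (g := snd (force mu x y) - snd (force mu x' y')) in *.
  replace (v - fst (force mu x y) - (v' - fst (force mu x' y'))) with (v - v' - f)
    by (unfold f; ring).
  replace (- u - snd (force mu x y) - (- u' - snd (force mu x' y'))) with (- (u - u') - g)
    by (unfold g; ring).
  replace (u + y - (u' + y')) with ((u - u') + (y - y')) by ring.
  replace (v - x - (v' - x')) with ((v - v') - (x - x')) by ring.
  clearbody f g.
  set (X := x - x') in *. set (Y := y - y') in *.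
  set (U := u - u') in *. set (V := v - v') in *. clearbody X Y U V.
  set (n := wnorm (X, Y, U, V)).
  assert (N2 : n ^ 2 = 9 * X ^ 2 + 9 * Y ^ 2 + U ^ 2 + V ^ 2)
    by (unfold n; rewrite wnorm_sqr; simpl; ring).
  assert (N0 : 0 <= n) by apply wnorm_ge0. clearbody n.
  assert (G0 : 0 <= G) by (exact (tidal_ge0 _ _ _ _ P1 P2 Hmu HG)).
  assert (K3 : G ^ 2 <= 9 * (K - 1) ^ 2) by nra.
  unfold wnorm, stretch.
  replace ((3 * (U + Y), 3 * (V - X), V - f, - U - g) : state) with
    (plus ((3 * Y, - (3 * X), V, - U) : state) ((3 * U, 3 * V, - f, - g) : state))
    by (rewrite plus_state; apply state_ext; ring).
  eapply Rle_trans; [apply norm_state_triangle|].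
  replace (K * n) with (n + (K - 1) * n) by ring.
  apply Rplus_le_compat; apply norm4_le; try nra.
  replace (((K - 1) * n) ^ 2) with ((K - 1) ^ 2 * n ^ 2) by ring. rewrite N2.
  assert (H1 : G ^ 2 * (X ^ 2 + Y ^ 2) <= 9 * (K - 1) ^ 2 * (X ^ 2 + Y ^ 2)).
  { apply Rmult_le_compat_r; [|exact K3].
    apply Rplus_le_le_0_compat; apply pow2_ge_0. }
  assert (H2 : 9 * (U ^ 2 + V ^ 2) <= (K - 1) ^ 2 * (U ^ 2 + V ^ 2)).
  { apply Rmult_le_compat_r; [|nra].
    apply Rplus_le_le_0_compat; apply pow2_ge_0. }
  lra.
Qed.

(** The part (y, -x, v, -u) of the field is a rotation and does not change the norm; what is left
    in the scalar product is the coupling x' = u, y' = v and the force. *)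
Lemma field_one_sided rho1 rho2 mu G z z' :
  0 < rho1 -> 0 < rho2 -> 0 <= mu <= 1 ->
  away rho1 rho2 mu z -> away rho1 rho2 mu z' ->
  2 * ((1 - mu) / rho1 ^ 3 + mu / rho2 ^ 3) <= G ->
  wdot (minus z z') (minus (field mu z) (field mu z'))
    <= (9 + G) / 6 * wnorm (minus z z') ^ 2.
Proof.
  intros P1 P2 Hmu A B HG.
  destruct z as [[[x y] u] v], z' as [[[x' y'] u'] v'].
  pose proof (force_lipschitz _ _ _ _ _ _ _ _ _ _ _ _ P1 P2 Hmu A B HG) as F.
  assert (G0 : 0 <= G) by (exact (tidal_ge0 _ _ _ _ P1 P2 Hmu HG)).
  rewrite wnorm_sqr. cbn [field]. rewrite !minus_state. unfold wdot.
  set (f := fst (force mu x y) - fst (force mu x' y')) in *.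
  set (g := snd (force mu x y) - snd (force mu x' y')) in *.
  replace (v - fst (force mu x y) - (v' - fst (force mu x' y'))) with (v - v' - f)
    by (unfold f; ring).
  replace (- u - snd (force mu x y) - (- u' - snd (force mu x' y'))) with (- (u - u') - g)
    by (unfold g; ring).
  replace (u + y - (u' + y')) with ((u - u') + (y - y')) by ring.
  replace (v - x - (v' - x')) with ((v - v') - (x - x')) by ring.
  clearbody f g.
  set (X := x - x') in *. set (Y := y - y') in *.
  set (U := u - u') in *. set (V := v - v') in *. clearbody X Y U V.
  match goal with |- ?a <= ?b =>
    replace a with (9 * (X * U + Y * V) - (U * f + V * g)) by ring end.
  set (p := sqrt (X ^ 2 + Y ^ 2)). set (q := sqrt (U ^ 2 + V ^ 2)).
  assert (p2 : p ^ 2 = X ^ 2 + Y ^ 2) by (apply pow2_sqrt; nra).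
  assert (q2 : q ^ 2 = U ^ 2 + V ^ 2) by (apply pow2_sqrt; nra).
  assert (p0 : 0 <= p) by apply sqrt_pos. assert (q0 : 0 <= q) by apply sqrt_pos.
  clearbody p q. rewrite <- p2 in F.
  assert (CS : forall a b c d P Q, 0 <= P -> 0 <= Q -> a ^ 2 + b ^ 2 <= P ^ 2 ->
    c ^ 2 + d ^ 2 <= Q ^ 2 -> a * c + b * d <= P * Q).
  { intros a b c d P Q P0 Q0 H1 H2. apply Rsqr_incr_0_var; [|apply Rmult_le_pos; lra].
    unfold Rsqr. replace (P * Q * (P * Q)) with (P ^ 2 * Q ^ 2) by ring.
    apply Rle_trans with ((a ^ 2 + b ^ 2) * (c ^ 2 + d ^ 2)).
    - pose proof (pow2_ge_0 (a * d - b * c)). lra.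
    - apply Rmult_le_compat; try assumption; apply Rplus_le_le_0_compat; apply pow2_ge_0. }
  pose proof (CS X Y U V p q p0 q0 (Req_le _ _ (eq_sym p2)) (Req_le _ _ (eq_sym q2))) as C1.
  assert (C2 : U * (- f) + V * (- g) <= q * (G * p)).
  { apply CS; try assumption; [apply Rmult_le_pos; lra | lra | lra]. }
  replace (9 * (X * X) + 9 * (Y * Y) + U * U + V * V) with (9 * p ^ 2 + q ^ 2) by lra.
  assert (D : 0 <= (3 * p - q) ^ 2) by apply pow2_ge_0.
  nra.
Qed.

(** * Picard iteration in a weighted tube *)

Section ProdComplete.
Context {U V : CompleteSpace}.

(** A Cauchy filter on a product converges coordinatewise. This makes the phase space a complete
    normed module. *)
Definition prod_lim (F : (U * V -> Prop) -> Prop) : U * V :=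
  (lim (fun P => F (fun p => P (fst p))), lim (fun P => F (fun p => P (snd p)))).

Lemma prod_lim_ax1 : forall F, ProperFilter F -> cauchy F ->
  forall eps : posreal, F (ball (prod_lim F) eps).
Proof.
  intros F PF CF eps.
  assert (P1 : ProperFilter (fun P : U -> Prop => F (fun p => P (fst p))))
    by exact (filtermap_proper_filter (U * V) U fst F PF).
  assert (P2 : ProperFilter (fun P : V -> Prop => F (fun p => P (snd p))))
    by exact (filtermap_proper_filter (U * V) V snd F PF).
  assert (C1 : cauchy (fun P : U -> Prop => F (fun p => P (fst p)))).
  { intros e. destruct (CF e) as [[x y] H]. exists x.
    eapply filter_imp; [|exact H]. intros p [A _]; exact A. }
  assert (C2 : cauchy (fun P : V -> Prop => F (fun p => P (snd p)))).
  { intros e. destruct (CF e) as [[x y] H]. exists y.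
    eapply filter_imp; [|exact H]. intros p [_ A]; exact A. }
  pose proof (complete_cauchy _ P1 C1 eps) as H1.
  pose proof (complete_cauchy _ P2 C2 eps) as H2.
  eapply filter_imp; [|apply filter_and; [exact H1|exact H2]].
  intros p [A B]. split; assumption.
Qed.

Lemma prod_lim_ax2 : forall F1 F2, filter_le F1 F2 -> filter_le F2 F1 ->
  close (prod_lim F1) (prod_lim F2).
Proof.
  intros F1 F2 L1 L2 eps. split;
  apply (close_lim) ; intros P; (apply L1 || apply L2).
Qed.

Definition prod_complete_mixin :=
  CompleteSpace.Mixin (prod_UniformSpace U V) prod_lim prod_lim_ax1 prod_lim_ax2.
Canonical prod_CompleteSpace :=
  CompleteSpace.Pack (U * V) (CompleteSpace.Class _ _ prod_complete_mixin) (U * V).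
End ProdComplete.

Canonical prod_CompleteNormedModule {K : AbsRing} (U V : CompleteNormedModule K) :=
  CompleteNormedModule.Pack K (U * V)
   (CompleteNormedModule.Class K (U * V)
     (NormedModule.class K (prod_NormedModule K U V)) prod_complete_mixin) (U * V).

(** Projection of the line onto [0, 1], to extend functions on the interval continuously. *)
Definition clamp (t : R) : R := Rmax 0 (Rmin 1 t).

Lemma clamp_bounds t : 0 <= clamp t <= 1.
Proof. unfold clamp, Rmax, Rmin. repeat destruct Rle_dec; lra. Qed.

Lemma clamp_id t : 0 <= t <= 1 -> clamp t = t.
Proof. unfold clamp, Rmax, Rmin. intros. repeat destruct Rle_dec; lra. Qed.

Lemma clamp_lipschitz s t : Rabs (clamp s - clamp t) <= Rabs (s - t).
Proof.
  unfold clamp, Rmax, Rmin.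
  repeat destruct Rle_dec; unfold Rabs; repeat destruct Rcase_abs; lra.
Qed.

Lemma clamp_continuous t : continuous clamp t.
Proof.
  intros P [eps HP]. exists eps. intros s Hs. apply HP.
  unfold ball in *; simpl in *; unfold AbsRing_ball, abs, minus, plus, opp in *; simpl in *.
  eapply Rle_lt_trans; [apply (clamp_lipschitz s t)|exact Hs].
Qed.

Section Picard.
Context {V : CompleteNormedModule R_AbsRing}.

Lemma norm_minus_sym (u v : V) : norm (minus u v) = norm (minus v u).
Proof. rewrite <- norm_opp, opp_minus. reflexivity. Qed.

Lemma norm_minus_triangle (u v w : V) :
  norm (minus u w) <= norm (minus u v) + norm (minus v w).
Proof.
  rewrite (minus_trans v u w). apply (norm_triangle (minus u v) (minus v w)).
Qed.

Lemma minus_zero_V (u : V) : minus u zero = u.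
Proof. exact (minus_zero_r u). Qed.

Lemma norm_zero_V : norm (zero : V) = 0.
Proof. exact (norm_zero (V := V)). Qed.

Lemma norm_minus_self (u : V) : norm (minus u u) = 0.
Proof.
  exact (eq_trans (f_equal norm (minus_eq_zero u)) (norm_zero (V := V))).
Qed.

Lemma plus_minus_V (u v : V) : plus v (minus u v) = u.
Proof.
  transitivity (minus u zero); [|exact (minus_zero_r u)].
  transitivity (plus (minus u v) (minus v zero)); [|exact (eq_sym (minus_trans v u zero))].
  transitivity (plus (minus u v) v); [exact (plus_comm v (minus u v))|].
  exact (f_equal (plus (minus u v)) (eq_sym (minus_zero_r v))).
Qed.

Lemma minus_zero_eq_V (u v : V) : minus u v = zero -> u = v.
Proof.
  intros H. rewrite <- (plus_minus_V u v).
  exact (eq_trans (f_equal (plus v) H) (plus_zero_r v)).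
Qed.

Lemma norm_le_minus (u v : V) : norm u <= norm v + norm (minus u v).
Proof.
  pose proof (norm_minus_triangle u v zero) as H. rewrite !minus_zero_V in H. lra.
Qed.

Lemma norm_minus_zero (u : V) : norm (minus u zero) = norm u.
Proof. now rewrite minus_zero_V. Qed.

(** The iterates stay in the tube |w t| <= r phi t and contract by the factor q in the norm
    weighted by phi, as the integral of k phi is at most q phi. Constant phi gives the usual
    theorem; phi t = t^2 allows the singular Lipschitz constant k t = K / (lam t). *)
Theorem picard (g : R -> V -> V) (k phi Psi : R -> R) (q r M : R) :
  0 <= q < 1 -> 0 <= r ->
  (forall t, 0 <= t <= 1 -> 0 <= phi t <= M) ->
  (forall t, 0 <= t <= 1 -> 0 <= k t) ->
  (forall e, (forall t, continuous e t) ->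
     (forall t, norm (e t) <= r * phi (clamp t)) ->
     forall s, continuous (fun s => g (clamp s) (e s)) s) ->
  (forall s u v, 0 <= s <= 1 -> norm u <= r * phi s -> norm v <= r * phi s ->
     norm (minus (g s u) (g s v)) <= k s * norm (minus u v)) ->
  (forall t, 0 <= t <= 1 ->
     is_RInt (fun s => k s * phi s) 0 t (Psi t) /\ Psi t <= q * phi t) ->
  (forall t, 0 <= t <= 1 ->
     norm (RInt (fun s => g (clamp s) zero) 0 t) <= (1 - q) * r * phi t) ->
  exists w : R -> V, w 0 = zero /\
    forall t, 0 <= t <= 1 -> norm (w t) <= r * phi t /\ is_derive w t (g t (w t)).
Proof.
  intros Hq Hr Hphi Hk Hcont Hlip Hint Hzero.
  set (adm := fun e : R -> V => (forall t, continuous e t) /\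
     (forall t, norm (e t) <= r * phi (clamp t))).
  (* the Picard operator, on functions on the whole line that are constant outside [0, 1] *)
  set (T := fun (e : R -> V) (t : R) => RInt (fun s => g (clamp s) (e s)) 0 (clamp t)).
  assert (Phi0 : forall t, 0 <= phi (clamp t) <= M) by (intros t; apply Hphi, clamp_bounds).
  assert (Exint : forall e a b, adm e -> ex_RInt (fun s => g (clamp s) (e s)) a b).
  { intros e a b [C B]. apply ex_RInt_continuous. intros z _. now apply Hcont. }
  assert (Deriv : forall e t, adm e ->
    is_derive (fun t => RInt (fun s => g (clamp s) (e s)) 0 t) t (g (clamp t) (e t))).
  { intros e t A. pose proof A as [C B].
    apply (is_derive_RInt (fun s => g (clamp s) (e s)) _ 0).
    - apply filter_forall. intros b. apply (RInt_correct (V := V)). now apply Exint.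
    - now apply Hcont. }
  assert (TC : forall e t, adm e -> continuous (T e) t).
  { intros e t A. unfold T.
    apply (continuous_comp clamp (fun t => RInt (fun s => g (clamp s) (e s)) 0 t)).
    - apply clamp_continuous.
    - apply (ex_derive_continuous (fun t => RInt (fun s => g (clamp s) (e s)) 0 t)).
      eexists. apply Deriv, A. }
  assert (TL : forall e1 e2 c, adm e1 -> adm e2 -> 0 <= c ->
    (forall t, norm (minus (e1 t) (e2 t)) <= c * phi (clamp t)) ->
    forall t, norm (minus (T e1 t) (T e2 t)) <= c * q * phi (clamp t)).
  { intros e1 e2 c A1 A2 Hc H t. unfold T.
    destruct (Hint (clamp t) (clamp_bounds t)) as [I1 I2].
    apply Rle_trans with (c * Psi (clamp t)).
    - apply (norm_RInt_le (fun s => minus (g (clamp s) (e1 s)) (g (clamp s) (e2 s)))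
        (fun s => scal c (k s * phi s)) 0 (clamp t)).
      + apply clamp_bounds.
      + intros s Hs. pose proof (clamp_bounds t).
        assert (E : clamp s = s) by (apply clamp_id; lra).
        rewrite E. destruct A1 as [_ B1], A2 as [_ B2].
        specialize (B1 s). specialize (B2 s). specialize (H s). rewrite E in *.
        eapply Rle_trans; [apply Hlip; try assumption; lra|].
        unfold scal; simpl; unfold mult; simpl.
        replace (c * (k s * phi s)) with (k s * (c * phi s)) by ring.
        apply Rmult_le_compat_l; [apply Hk; lra|exact H].
      + apply (is_RInt_minus (V := V)); apply (RInt_correct (V := V)); now apply Exint.
      + apply (is_RInt_scal (V := R_NormedModule)). exact I1.
    - rewrite Rmult_assoc. apply Rmult_le_compat_l; assumption. }
  assert (A0 : adm (fun _ => zero)).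
  { split; [intros t; apply continuous_const|]. intros t. rewrite norm_zero_V.
    apply Rmult_le_pos; [assumption|apply Phi0]. }
  assert (T0 : forall t, norm (T (fun _ => zero) t) <= (1 - q) * r * phi (clamp t)).
  { intros t. apply Hzero, clamp_bounds. }
  assert (TA : forall e, adm e -> adm (T e)).
  { intros e A. split; [intros t; now apply TC|]. intros t.
    eapply Rle_trans; [apply (norm_le_minus _ (T (fun _ => zero) t))|].
    assert (H : norm (minus (T e t) (T (fun _ => zero) t)) <= r * q * phi (clamp t)).
    { apply TL; try assumption. intros s. rewrite norm_minus_zero. apply A. }
    specialize (T0 t). lra. }
  set (E := fix E n := match n with O => fun _ : R => (zero : V) | S n => T (E n) end).
  assert (EA : forall n, adm (E n)) by (induction n; simpl; auto).
  assert (ED : forall n t, norm (minus (E (S n) t) (E n t)) <= r * q ^ n * phi (clamp t)).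
  { induction n; intros t.
    - simpl. rewrite norm_minus_zero. eapply Rle_trans; [apply T0|].
      apply Rmult_le_compat_r; [apply Phi0|]. nra.
    - change (E (S (S n))) with (T (E (S n))). change (E (S n)) with (T (E n)) at 2.
      eapply Rle_trans.
      + apply (TL (E (S n)) (E n) (r * q ^ n)); try apply EA; [|exact IHn].
        apply Rmult_le_pos; [assumption|apply pow_le; lra].
      + simpl. right. ring. }
  set (C := r / (1 - q)).
  assert (C0 : 0 <= C).
  { unfold C, Rdiv. apply Rmult_le_pos; [assumption|].
    left; apply Rinv_0_lt_compat; lra. }
  assert (CE : r = C * (1 - q)) by (unfold C; field; lra).
  assert (EC : forall n m t, norm (minus (E (n + m)%nat t) (E n t))
      <= C * (q ^ n - q ^ (n + m)) * phi (clamp t)).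
  { intros n m t. induction m.
    - rewrite Nat.add_0_r, norm_minus_self. right. ring.
    - rewrite Nat.add_succ_r. eapply Rle_trans; [apply (norm_minus_triangle _ (E (n + m)%nat t))|].
      specialize (ED (n + m)%nat t). rewrite CE in ED. simpl pow. 
      replace (C * (q ^ n - q * q ^ (n + m)) * phi (clamp t)) with
       (C * (1 - q) * q ^ (n + m) * phi (clamp t)
        + C * (q ^ n - q ^ (n + m)) * phi (clamp t)) by ring.
      apply Rplus_le_compat; assumption. }
  assert (EC2 : forall n m t, norm (minus (E (n + m)%nat t) (E n t))
      <= C * q ^ n * phi (clamp t)).
  { intros n m t. eapply Rle_trans; [apply EC|]. apply Rmult_le_compat_r; [apply Phi0|].
    apply Rmult_le_compat_l; [assumption|]. pose proof (pow_le q (n + m) (proj1 Hq)). lra. }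
  assert (Ex : forall t, exists l : V, is_series (fun n => minus (E (S n) t) (E n t)) l).
  { intros t. apply (ex_series_le (V := V) _ (fun n => r * q ^ n * phi (clamp t))).
    - intros n. apply ED.
    - apply (ex_series_ext (fun n => (r * phi (clamp t)) * q ^ n)).
      + intros n. change (r * phi (clamp t) * q ^ n = r * q ^ n * phi (clamp t)). ring.
      + apply (ex_series_scal_l (r * phi (clamp t)) (pow q)). exists (/ (1 - q)).
        apply is_series_geom. rewrite Rabs_pos_eq; lra. }
  apply functional_choice in Ex. destruct Ex as [e He].
  assert (Lim : forall t (eps : posreal),
     exists N, forall n, (N <= n)%nat -> norm (minus (e t) (E n t)) < eps).
  { intros t eps.
    assert (F : filterlim (fun n => E (S n) t) eventually (locally (e t))).
    { eapply filterlim_ext; [|exact (He t)]. intros n. induction n.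
      - rewrite sum_O. simpl. now rewrite minus_zero_V.
      - rewrite sum_Sn, IHn. apply plus_minus_V. }
    destruct (proj1 (filterlim_locally_ball_norm _ _) F eps) as [N HN]. exists (S N). intros n Hn.
    destruct n as [|n]; [lia|]. rewrite norm_minus_sym. apply HN. lia. }
  assert (EL : forall n t, norm (minus (e t) (E n t)) <= C * q ^ n * phi (clamp t)).
  { intros n t. apply le_epsilon. intros eps Heps.
    destruct (Lim t (mkposreal eps Heps)) as [N HN].
    specialize (HN (n + N)%nat ltac:(lia)). simpl in HN.
    eapply Rle_trans; [apply (norm_minus_triangle _ (E (n + N)%nat t))|].
    specialize (EC2 n N t). lra. }
  assert (Small : forall eps, 0 < eps -> exists n, C * q ^ n * M < eps).
  { intros eps Heps.
    assert (CM : 0 <= C * M).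
    { apply Rmult_le_pos; [assumption|]. specialize (Phi0 0). lra. }
    destruct (pow_lt_1_zero q) with (y := eps / (C * M + 1)) as [N HN].
    - rewrite Rabs_pos_eq; lra.
    - apply Rdiv_lt_0_compat; lra.
    - exists N. specialize (HN N (le_n _)).
      rewrite Rabs_pos_eq in HN by (apply pow_le; lra).
      apply Rmult_lt_compat_r with (r := C * M + 1) in HN; [|lra].
      unfold Rdiv in HN. rewrite Rmult_assoc, Rinv_l, Rmult_1_r in HN by lra.
      pose proof (pow_le q N (proj1 Hq)). nra. }
  assert (EU : forall n t, norm (minus (e t) (E n t)) <= C * q ^ n * M).
  { intros n t. eapply Rle_trans; [apply EL|]. apply Rmult_le_compat_l; [|apply Phi0].
    apply Rmult_le_pos; [assumption|apply pow_le; lra]. }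
  assert (eA : adm e).
  { split.
    - intros t. refine (proj2 (filterlim_locally_ball_norm e (e t)) _). intros eps.
      destruct (Small (eps / 3)) as [n Hn]; [destruct eps; simpl; lra|].
      assert (P3 : 0 < eps / 3) by (destruct eps; simpl; lra).
      pose proof (proj1 (EA n) t) as Cn. unfold continuous in Cn.
      pose proof (proj1 (filterlim_locally_ball_norm _ _) Cn (mkposreal _ P3)) as Cn'.
      eapply filter_imp; [|exact Cn']. intros s Hs. unfold ball_norm in *. simpl in Hs.
      eapply Rle_lt_trans; [apply (norm_minus_triangle _ (E n s))|].
      eapply Rle_lt_trans; [apply Rplus_le_compat_l, (norm_minus_triangle _ (E n t))|].
      rewrite (norm_minus_sym (E n t)).
      apply Rle_lt_trans with (C * q ^ n * M + (norm (minus (E n s) (E n t)) + C * q ^ n * M)).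
      { apply Rplus_le_compat; [apply EU|apply Rplus_le_compat_l, EU]. }
      apply Rlt_trans with (C * q ^ n * M + (eps / 3 + C * q ^ n * M)); [|lra].
      apply Rplus_lt_compat_l, Rplus_lt_compat_r, Hs.
    - intros t. apply le_epsilon. intros eps Heps.
      destruct (Lim t (mkposreal eps Heps)) as [N HN]. specialize (HN N (le_n _)).
      simpl in HN. eapply Rle_trans; [apply (norm_le_minus _ (E N t))|].
      pose proof (proj2 (EA N) t). lra. }
  assert (Fix : forall t, T e t = e t).
  { intros t. apply eq_sym.
    assert (Z : norm (minus (e t) (T e t)) <= 0).
    { apply le_epsilon. intros eps Heps. rewrite Rplus_0_l.
      destruct (Small (eps / 2)) as [n Hn]; [lra|].
      eapply Rle_trans; [apply (norm_minus_triangle _ (E (S n) t))|].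
      assert (Q : norm (minus (E (S n) t) (T e t)) <= C * q ^ n * q * phi (clamp t)).
      { apply (TL (E n) e); try assumption; [apply EA| |].
        - apply Rmult_le_pos; [assumption|apply pow_le; lra].
        - intros s. rewrite norm_minus_sym. apply EL. }
      pose proof (EU (S n) t) as U. simpl pow in U.
      assert (P : 0 <= C * q ^ n) by (apply Rmult_le_pos; [assumption|apply pow_le; lra]).
      pose proof (Phi0 t).
      assert (C * q ^ n * q * phi (clamp t) <= C * q ^ n * M).
      { rewrite Rmult_assoc. apply Rmult_le_compat_l; [assumption|]. nra. }
      assert (C * (q * q ^ n) * M <= C * q ^ n * M).
      { replace (C * (q * q ^ n) * M) with (C * q ^ n * (q * M)) by ring.
        apply Rmult_le_compat_l; [assumption|]. nra. }
      lra. }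
    assert (Z2 : norm (minus (e t) (T e t)) = 0)
      by (apply Rle_antisym; [exact Z|apply norm_ge_0]).
    apply minus_zero_eq_V. exact (norm_eq_zero _ Z2). }
  (* The fixed point e is constant outside [0, 1]; the integral, equal to e inside, is differentiable
     at the end points as well. *)
  exists (fun t => RInt (fun s => g (clamp s) (e s)) 0 t). split.
  - apply (RInt_point (V := V)).
  - intros t Ht.
    assert (W : RInt (fun s => g (clamp s) (e s)) 0 t = e t).
    { rewrite <- (Fix t). unfold T. now rewrite clamp_id. }
    rewrite W. split.
    + rewrite <- (clamp_id t Ht) at 2. apply eA.
    + pose proof (Deriv e t eA) as D. rewrite clamp_id in D by exact Ht. exact D.
Qed.
End Picard.

(** * Derivatives of curves and the Gronwall inequality *)

Lemma filterdiff_pair {T U V : NormedModule R_AbsRing} (f : T -> U) (g : T -> V) x lf lg :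
  filterdiff f (locally x) lf -> filterdiff g (locally x) lg ->
  filterdiff (fun t => (f t, g t)) (locally x) (fun t => (lf t, lg t) : U * V).
Proof.
  intros Hf Hg. refine (filterdiff_comp'_2 f g (fun a b => (a, b)) x lf lg
    (fun a b => (a, b)) Hf Hg _).
  exact (filterdiff_linear _ (is_linear_prod _ _ is_linear_fst is_linear_snd)).
Qed.

Lemma is_derive_pair {U V : NormedModule R_AbsRing} (f : R -> U) (g : R -> V) t lf lg :
  is_derive f t lf -> is_derive g t lg ->
  is_derive (fun s => (f s, g s)) t ((lf, lg) : U * V).
Proof. intros Hf Hg. exact (filterdiff_pair f g t _ _ Hf Hg). Qed.

Lemma is_derive_fst {U V : NormedModule R_AbsRing} (f : R -> U * V) t l :
  is_derive f t l -> is_derive (fun s => fst (f s)) t (fst l).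
Proof.
  intros H. refine (filterdiff_ext_lin _ _ _ (filterdiff_comp' f fst t _ _ H
    (filterdiff_linear _ is_linear_fst)) _).
  reflexivity.
Qed.

Lemma is_derive_snd {U V : NormedModule R_AbsRing} (f : R -> U * V) t l :
  is_derive f t l -> is_derive (fun s => snd (f s)) t (snd l).
Proof.
  intros H. refine (filterdiff_ext_lin _ _ _ (filterdiff_comp' f snd t _ _ H
    (filterdiff_linear _ is_linear_snd)) _).
  reflexivity.
Qed.

Definition cx (z : state) : R := fst (fst (fst z)).
Definition cy (z : state) : R := snd (fst (fst z)).
Definition cu (z : state) : R := snd (fst z).
Definition cv (z : state) : R := snd z.

Lemma is_derive_state (x y u v : R -> R) t a b c d :
  is_derive x t a -> is_derive y t b -> is_derive u t c -> is_derive v t d ->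
  is_derive (fun s => (x s, y s, u s, v s) : state) t (a, b, c, d).
Proof.
  intros A B C D.
  exact (is_derive_pair _ _ _ _ _ (is_derive_pair _ _ _ _ _
    (is_derive_pair _ _ _ _ _ A B) C) D).
Qed.

Lemma continuous_of_derive (z : R -> state) t l : is_derive z t l -> continuous z t.
Proof.
  intros D. apply (ex_derive_continuous (V := prod_NormedModule _ (prod_NormedModule _
     (prod_NormedModule _ R_NormedModule R_NormedModule) R_NormedModule) R_NormedModule) z).
  exists l. exact D.
Qed.

Lemma is_derive_coords (z : R -> state) t l : is_derive z t l ->
  is_derive (fun s => cx (z s)) t (cx l) /\ is_derive (fun s => cy (z s)) t (cy l) /\
  is_derive (fun s => cu (z s)) t (cu l) /\ is_derive (fun s => cv (z s)) t (cv l).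
Proof.
  intros H. split; [|split; [|split]].
  - exact (is_derive_fst _ _ _ (is_derive_fst _ _ _ (is_derive_fst _ _ _ H))).
  - exact (is_derive_snd _ _ _ (is_derive_fst _ _ _ (is_derive_fst _ _ _ H))).
  - exact (is_derive_snd _ _ _ (is_derive_fst _ _ _ H)).
  - exact (is_derive_snd _ _ _ H).
Qed.

Lemma is_derive_glue {V : NormedModule R_AbsRing} (f g : R -> V) T l :
  is_derive f T l -> is_derive g T l -> f T = g T ->
  is_derive (fun t => if Rle_dec t T then f t else g t) T l.
Proof.
  intros [_ Hf] [_ Hg] E. split; [apply is_linear_scal_l|].
  intros x Hx eps. specialize (Hf x Hx eps). specialize (Hg x Hx eps).
  assert (X : x = T).
  { symmetry. apply (is_filter_lim_locally_unique (V := R_NormedModule)), Hx. }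
  subst x.
  eapply filter_imp; [|apply filter_and; [exact Hf|exact Hg]].
  intros s [A B]. destruct (Rle_dec T T) as [_|N]; [|exfalso; apply N, Rle_refl].
  destruct (Rle_dec s T); [exact A|]. rewrite E. exact B.
Qed.

Lemma decreasing_of_derive (f df : R -> R) a b : a <= b ->
  (forall t, a <= t <= b -> is_derive f t (df t)) ->
  (forall t, a <= t <= b -> df t <= 0) -> f b <= f a.
Proof.
  intros Hab Hd Hneg.
  destruct (MVT_gen f a b df) as [c [Hc E]].
  - intros x. rewrite Rmin_left, Rmax_right by lra. intros Hx. apply Hd; lra.
  - intros x. rewrite Rmin_left, Rmax_right by lra. intros Hx.
    apply continuity_pt_filterlim, (ex_derive_continuous f). eexists. apply Hd; lra.
  - rewrite Rmin_left, Rmax_right in Hc by lra. specialize (Hneg c Hc). nra.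
Qed.

Lemma wdot_le z w : wdot z w <= wnorm z * wnorm w.
Proof.
  apply Rsqr_incr_0_var; [|apply Rmult_le_pos; apply wnorm_ge0].
  unfold Rsqr. replace (wnorm z * wnorm w * (wnorm z * wnorm w))
    with (wnorm z ^ 2 * wnorm w ^ 2) by ring.
  rewrite !wnorm_sqr. destruct z as [[[x y] u] v], w as [[[a b] c] d]. simpl.
  pose proof (pow2_ge_0 (9 * (x * b - y * a))). pose proof (pow2_ge_0 (3 * (x * c - u * a))).
  pose proof (pow2_ge_0 (3 * (x * d - v * a))). pose proof (pow2_ge_0 (3 * (y * c - u * b))).
  pose proof (pow2_ge_0 (3 * (y * d - v * b))). pose proof (pow2_ge_0 (u * d - v * c)). nra.
Qed.

Lemma Derive_value (f : R -> R) (t l : R) :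
  is_derive f t l -> Derive (fun s : R => f s) t = l.
Proof. intros H. apply is_derive_unique, H. Qed.

Lemma is_derive_squares (x y u v : R -> R) (t a b c d : R) :
  is_derive x t a -> is_derive y t b -> is_derive u t c -> is_derive v t d ->
  is_derive (fun t => 9 * (x t * x t) + 9 * (y t * y t) + u t * u t + v t * v t) t
    (2 * (9 * (x t * a) + 9 * (y t * b) + u t * c + v t * d)).
Proof.
  intros X Y U W. auto_derive.
  - repeat split; eexists; eassumption.
  - rewrite (Derive_value _ _ _ X), (Derive_value _ _ _ Y), (Derive_value _ _ _ U),
      (Derive_value _ _ _ W). ring.
Qed.

Lemma exp_le_mono x y : x <= y -> exp x <= exp y.
Proof.
  intros [H|H]; [left; now apply exp_increasing|right; now rewrite H].
Qed.

(** The norm is replaced by sqrt (|e|^2 + eta^2), which is differentiable also where e vanishes;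
    then eta tends to 0. *)
Lemma gronwall (e de : R -> state) l d a b :
  0 <= l -> 0 <= d -> a <= b ->
  (forall t, a <= t <= b -> is_derive e t (de t)) ->
  (forall t, a <= t <= b -> wdot (e t) (de t) <= l * wnorm (e t) ^ 2 + d * wnorm (e t)) ->
  wnorm (e b) <= exp (l * (b - a)) * (wnorm (e a) + d * (b - a)).
Proof.
  intros Hl Hd Hab De Hdot.
  assert (DE : forall t, a <= t <= b ->
    is_derive (fun t => wdot (e t) (e t)) t (2 * wdot (e t) (de t))).
  { intros t Ht. destruct (is_derive_coords e t (de t) (De t Ht)) as [X [Y [U W]]].
    apply (is_derive_ext (fun t => 9 * (cx (e t) * cx (e t)) + 9 * (cy (e t) * cy (e t))
      + cu (e t) * cu (e t) + cv (e t) * cv (e t))).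
    { intros s. destruct (e s) as [[[? ?] ?] ?]; reflexivity. }
    evar_last; [apply (is_derive_squares _ _ _ _ _ _ _ _ _ X Y U W)|].
    destruct (e t) as [[[? ?] ?] ?], (de t) as [[[? ?] ?] ?].
    unfold wdot, cx, cy, cu, cv; cbn [fst snd]. ring. }
  assert (K : forall eta, 0 < eta ->
    wnorm (e b) <= exp (l * (b - a)) * (wnorm (e a) + eta + d * (b - a))).
  { intros eta Heta.
    set (N := fun t => sqrt (wdot (e t) (e t) + eta ^ 2)).
    assert (P : forall t, 0 < wdot (e t) (e t) + eta ^ 2).
    { intros t. rewrite <- wnorm_sqr. nra. }
    assert (NP : forall t, 0 < N t) by (intros t; apply sqrt_lt_R0, P).
    assert (NW : forall t, wnorm (e t) <= N t).
    { intros t. unfold N. rewrite <- wnorm_sqr.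
      rewrite <- (sqrt_pow2 (wnorm (e t))) at 1 by apply wnorm_ge0.
      apply sqrt_le_1_alt. nra. }
    assert (N2 : forall t, N t ^ 2 = wnorm (e t) ^ 2 + eta ^ 2).
    { intros t. unfold N. rewrite pow2_sqrt by (left; apply P). now rewrite wnorm_sqr. }
    assert (M : exp (- (l * (b - a))) * N b - d * (b - a) <= exp (- (l * (a - a))) * N a - d * (a - a)).
    { apply (decreasing_of_derive (fun t => exp (- (l * (t - a))) * N t - d * (t - a))
        (fun t => exp (- (l * (t - a))) * (wdot (e t) (de t) / N t - l * N t) - d)); [exact Hab| |].
      - intros t Ht. 
        assert (DN : is_derive N t (wdot (e t) (de t) / N t)).
        { unfold N. evar_last.
          - apply (is_derive_comp sqrt).
            + apply is_derive_Reals, derivable_pt_lim_sqrt, P.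
            + apply (is_derive_plus (V := R_NormedModule)); [apply DE, Ht|apply is_derive_const].
          - unfold plus, zero, scal; simpl. unfold mult; simpl. field.
            apply Rgt_not_eq, (NP t). }
        auto_derive; [eexists; exact DN|].
        rewrite (Derive_value _ _ _ DN). change (t + - a) with (t - a).
        generalize (wdot (e t) (de t) / N t), (exp (- (l * (t - a)))), (N t).
        intros; ring.
      - intros t Ht. 
        assert (E1 : 0 < exp (- (l * (t - a))) <= 1).
        { split; [apply exp_pos|]. rewrite <- exp_0. apply exp_le_mono. nra. }
        assert (Q : wdot (e t) (de t) / N t - l * N t <= d).
        { specialize (Hdot t Ht). specialize (NP t). specialize (NW t). specialize (N2 t).
          pose proof (wnorm_ge0 (e t)).
          apply Rmult_le_reg_r with (N t); [exact NP|].
          unfold Rdiv. rewrite Rmult_minus_distr_r, Rmult_assoc, Rinv_l by lra. nra. }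
        destruct (Rle_lt_dec 0 (wdot (e t) (de t) / N t - l * N t)); nra. }
    rewrite Rminus_diag in M. rewrite !Rmult_0_r, Ropp_0, exp_0 in M.
    assert (Na : N a <= wnorm (e a) + eta).
    { pose proof (wnorm_ge0 (e a)). unfold N. rewrite <- wnorm_sqr.
      rewrite <- (sqrt_pow2 (wnorm (e a) + eta)) by lra. apply sqrt_le_1_alt. nra. }
    eapply Rle_trans; [apply NW|].
    replace (N b) with (exp (l * (b - a)) * (exp (- (l * (b - a))) * N b)).
    - apply Rmult_le_compat_l; [left; apply exp_pos|lra].
    - rewrite <- Rmult_assoc, <- exp_plus, Rplus_opp_r, exp_0. ring. }
  apply le_epsilon. intros eps Heps.
  pose proof (exp_pos (l * (b - a))) as X.
  specialize (K (eps / exp (l * (b - a)))).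
  eapply Rle_trans; [apply K, Rdiv_lt_0_compat; assumption|].
  right. field. lra.
Qed.

(** * Approximate solutions *)

Ltac state_ring :=
  intros; repeat match goal with z : state |- _ => destruct z as [[[? ?] ?] ?] end;
  cbn [stretch unstretch];
  rewrite ?zero_state, ?opp_state, ?minus_state, ?plus_state, ?scal_state;
  rewrite ?opp_state, ?minus_state, ?plus_state, ?scal_state;
  rewrite ?opp_state, ?minus_state, ?plus_state, ?scal_state;
  cbn [stretch unstretch];
  apply state_ext; field.

Lemma stretch_minus (a b : state) : stretch (minus a b) = minus (stretch a) (stretch b).
Proof. state_ring. Qed.
Lemma stretch_plus (a b : state) : stretch (plus a b) = plus (stretch a) (stretch b).
Proof. state_ring. Qed.
Lemma unstretch_minus (a b : state) : unstretch (minus a b) = minus (unstretch a) (unstretch b).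
Proof. state_ring. Qed.
Lemma stretch_scal k (a : state) : stretch (scal k a) = scal k (stretch a).
Proof. state_ring. Qed.
Lemma stretch_unstretch a : stretch (unstretch a) = a.
Proof. state_ring. Qed.
Lemma unstretch_stretch a : unstretch (stretch a) = a.
Proof. state_ring. Qed.

Lemma wnorm_unstretch a : wnorm (unstretch a) = norm a.
Proof. unfold wnorm. now rewrite stretch_unstretch. Qed.

Lemma wnorm_plus (a b : state) : wnorm (plus a b) <= wnorm a + wnorm b.
Proof. unfold wnorm. rewrite stretch_plus. apply norm_state_triangle. Qed.

Lemma wnorm_scal k (a : state) : wnorm (scal k a) = Rabs k * wnorm a.
Proof. unfold wnorm. rewrite stretch_scal. apply norm_state_scal. Qed.

Lemma wnorm_opp (a : state) : wnorm (opp a) = wnorm a.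
Proof.
  replace (opp a) with (scal (-1) a) by state_ring.
  rewrite wnorm_scal, Rabs_left by lra. ring.
Qed.

Lemma wnorm_minus_sym (a b : state) : wnorm (minus a b) = wnorm (minus b a).
Proof. rewrite <- wnorm_opp. f_equal. state_ring. Qed.

Lemma wnorm_minus_triangle (a b c : state) :
  wnorm (minus a c) <= wnorm (minus a b) + wnorm (minus b c).
Proof.
  replace (minus a c) with (plus (minus a b) (minus b c)) by state_ring.
  apply wnorm_plus.
Qed.

Lemma norm_le_wnorm (a : state) : norm a <= wnorm a.
Proof.
  destruct a as [[[x y] u] v]. rewrite wnorm_eq, norm_state.
  apply sqrt_le_1_alt. nra.
Qed.

Lemma wnorm_le_norm (a : state) : wnorm a <= 3 * norm a.
Proof.
  destruct a as [[[x y] u] v]. rewrite wnorm_eq, norm_state.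
  rewrite <- (sqrt_pow2 3) by lra. rewrite <- sqrt_mult_alt by nra.
  apply sqrt_le_1_alt. nra.
Qed.

Lemma wnorm_coords a : 3 * Rabs (cx a) <= wnorm a /\ 3 * Rabs (cy a) <= wnorm a /\
  Rabs (cu a) <= wnorm a /\ Rabs (cv a) <= wnorm a.
Proof.
  destruct a as [[[x y] u] v]. rewrite wnorm_eq. unfold cx, cy, cu, cv; cbn [fst snd].
  repeat split; apply Rsqr_incr_0_var; try apply sqrt_pos; rewrite Rsqr_sqrt by nra;
    unfold Rsqr.
  - replace (3 * Rabs x * (3 * Rabs x)) with (9 * Rabs x ^ 2) by ring.
    rewrite pow2_abs. nra.
  - replace (3 * Rabs y * (3 * Rabs y)) with (9 * Rabs y ^ 2) by ring.
    rewrite pow2_abs. nra.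
  - replace (Rabs u * Rabs u) with (Rabs u ^ 2) by ring. rewrite pow2_abs. nra.
  - replace (Rabs v * Rabs v) with (Rabs v ^ 2) by ring. rewrite pow2_abs. nra.
Qed.

Lemma wnorm_le_coords x y u v :
  wnorm (x, y, u, v) <= 3 * (Rabs x + Rabs y) + Rabs u + Rabs v.
Proof.
  pose proof (Rabs_pos x). pose proof (Rabs_pos y).
  pose proof (Rabs_pos u). pose proof (Rabs_pos v).
  unfold wnorm, stretch. apply norm4_le; [lra|].
  rewrite <- (pow2_abs (3 * x)), <- (pow2_abs (3 * y)), <- (pow2_abs u), <- (pow2_abs v).
  rewrite !Rabs_mult, (Rabs_pos_eq 3) by lra.
  generalize dependent (Rabs x). generalize dependent (Rabs y).
  generalize dependent (Rabs u). generalize dependent (Rabs v). intros.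
  nra.
Qed.

Lemma continuous_of_lipschitz {U V : NormedModule R_AbsRing}
  (z : R -> U) (w : R -> V) (s C : R) :
  (forall s', norm (minus (w s') (w s)) <= C * norm (minus (z s') (z s))) ->
  continuous z s -> continuous w s.
Proof.
  intros H Hz. refine (proj2 (filterlim_locally_ball_norm w (w s)) _). intros eps.
  assert (P : 0 < eps / (Rabs C + 1)).
  { apply Rdiv_lt_0_compat; [apply cond_pos|]. pose proof (Rabs_pos C). lra. }
  pose proof (proj1 (filterlim_locally_ball_norm _ _) Hz (mkposreal _ P)) as Q.
  eapply filter_imp; [|exact Q]. intros s' Hs'.
  specialize (H s'). eapply Rle_lt_trans; [exact H|]. clear H.
  match goal with |- C * ?m < _ =>
    assert (N : 0 <= m) by apply norm_ge_0;
    change (m < eps / (Rabs C + 1)) in Hs'; revert Hs' N; generalize m end.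
  intros n Hs' N.
  pose proof (Rabs_pos C). pose proof (Rle_abs C).
  apply Rle_lt_trans with (n * (Rabs C + 1)); [nra|].
  replace (pos eps) with (eps / (Rabs C + 1) * (Rabs C + 1)) by (field; lra).
  apply Rmult_lt_compat_r; lra.
Qed.

Lemma field_continuous rho1 rho2 mu (z : R -> state) s :
  0 < rho1 -> 0 < rho2 -> 0 <= mu <= 1 ->
  (forall s, away rho1 rho2 mu (z s)) -> continuous z s ->
  continuous (fun s => field mu (z s)) s.
Proof.
  intros P1 P2 Hmu A Hz.
  set (G := 2 * ((1 - mu) / rho1 ^ 3 + mu / rho2 ^ 3)).
  set (K := 4 + G / 3).
  assert (G0 : 0 <= G) by (apply (tidal_ge0 rho1 rho2 mu G P1 P2 Hmu), Rle_refl).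
  refine (continuous_of_lipschitz z _ s (K * 3) _ Hz). intros s'.
  eapply Rle_trans; [apply norm_le_wnorm|].
  eapply Rle_trans; [apply (field_lipschitz rho1 rho2 mu G K); auto;
    unfold K; try lra; apply Rle_refl|].
  rewrite Rmult_assoc. apply Rmult_le_compat_l; [unfold K; lra|apply wnorm_le_norm].
Qed.

Lemma stretch_continuous (z : R -> state) s :
  continuous z s -> continuous (fun s => stretch (z s)) s.
Proof.
  intros Hz. refine (continuous_of_lipschitz z _ s 3 _ Hz). intros s'.
  pose proof (wnorm_le_norm (minus (z s') (z s))) as Q.
  unfold wnorm in Q. rewrite stretch_minus in Q. exact Q.
Qed.

Lemma unstretch_continuous (z : R -> state) s :
  continuous z s -> continuous (fun s => unstretch (z s)) s.
Proof.
  intros Hz. refine (continuous_of_lipschitz z _ s 1 _ Hz). intros s'.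
  pose proof (norm_le_wnorm (unstretch (minus (z s') (z s)))) as Q.
  rewrite wnorm_unstretch, unstretch_minus in Q. rewrite Rmult_1_l. exact Q.
Qed.

Lemma is_derive_unstretch (w : R -> state) t l :
  is_derive w t l -> is_derive (fun s => unstretch (w s)) t (unstretch l).
Proof.
  intros H. destruct (is_derive_coords w t l H) as [X [Y [U W]]].
  apply (is_derive_ext (fun s => (cx (w s) / 3, cy (w s) / 3, cu (w s), cv (w s)) : state)).
  { intros s. destruct (w s) as [[[? ?] ?] ?]. reflexivity. }
  destruct l as [[[a b] c] d].
  apply is_derive_state; try assumption;
  (eapply is_derive_ext; [intros s; apply Rmult_comm|]);
  unfold Rdiv; rewrite Rmult_comm; now apply is_derive_scal.
Qed.

(** By [field_one_sided] and [gronwall]. The growth rate (9 + G) / 6 is smaller than the Lipschitz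
    constant of [field_lipschitz], which would spoil the errors over the whole orbit. *)
Lemma shadow rho1 rho2 mu G h d (z p dp : R -> state) a b :
  0 < rho1 -> 0 < rho2 -> 0 <= mu <= 1 ->
  2 * ((1 - mu) / rho1 ^ 3 + mu / rho2 ^ 3) <= G ->
  0 <= h -> 0 <= d -> a <= b ->
  (forall t, a <= t <= b -> is_derive z t (scal h (field mu (z t)))) ->
  (forall t, a <= t <= b -> is_derive p t (dp t)) ->
  (forall t, a <= t <= b -> away rho1 rho2 mu (z t) /\ away rho1 rho2 mu (p t)) ->
  (forall t, a <= t <= b -> wnorm (minus (scal h (field mu (p t))) (dp t)) <= d) ->
  wnorm (minus (z b) (p b))
    <= exp (h * ((9 + G) / 6) * (b - a)) * (wnorm (minus (z a) (p a)) + d * (b - a)).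
Proof.
  intros P1 P2 Hmu HG Hh Hd Hab Dz Dp A Def.
  pose proof (tidal_ge0 _ _ _ _ P1 P2 Hmu HG) as G0.
  apply (gronwall (fun t => minus (z t) (p t)) (fun t => minus (scal h (field mu (z t))) (dp t)));
    try assumption.
  - apply Rmult_le_pos; lra.
  - intros t Ht. exact (is_derive_minus z p t _ _ (Dz t Ht) (Dp t Ht)).
  - intros t Ht. destruct (A t Ht) as [A1 A2].
    pose proof (field_one_sided _ _ _ _ _ _ P1 P2 Hmu A1 A2 HG) as O.
    set (f := field mu (z t)) in *. set (g := field mu (p t)) in *.
    pose proof (wdot_le (minus (z t) (p t)) (minus (scal h g) (dp t))) as C.
    specialize (Def t Ht). fold g in Def.
    assert (E : wdot (minus (z t) (p t)) (minus (scal h f) (dp t)) =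
      h * wdot (minus (z t) (p t)) (minus f g)
      + wdot (minus (z t) (p t)) (minus (scal h g) (dp t))).
    { clearbody f g. clear. generalize (z t), (p t), (dp t). intros a b c.
      destruct a as [[[? ?] ?] ?], b as [[[? ?] ?] ?], c as [[[? ?] ?] ?],
        f as [[[? ?] ?] ?], g as [[[? ?] ?] ?].
      rewrite !scal_state, !minus_state. cbn [wdot]. ring. }
    rewrite E. pose proof (wnorm_ge0 (minus (z t) (p t))). nra.
Qed.

(** * Existence over one time step *)

Lemma norm_RInt_bound {V : CompleteNormedModule R_AbsRing} (f : R -> V) (g : R -> R) t lg :
  0 <= t -> (forall s, continuous f s) ->
  (forall s, 0 <= s <= t -> norm (f s) <= g s) -> is_RInt g 0 t lg ->
  norm (RInt f 0 t) <= lg.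
Proof.
  intros Ht C B I. apply (norm_RInt_le f g 0 t); try assumption.
  apply (RInt_correct (V := V)), ex_RInt_continuous. intros; apply C.
Qed.

Lemma continuous_plus_state (f g : R -> state) s :
  continuous f s -> continuous g s -> continuous (fun s => plus (f s) (g s)) s.
Proof. intros A B. exact (continuous_plus f g s A B). Qed.
Lemma continuous_minus_state (f g : R -> state) s :
  continuous f s -> continuous g s -> continuous (fun s => minus (f s) (g s)) s.
Proof. intros A B. exact (continuous_minus f g s A B). Qed.
Lemma continuous_scal_state (k : R -> R) (f : R -> state) s :
  continuous k s -> continuous f s -> continuous (fun s => scal (k s) (f s)) s.
Proof. intros A B. exact (continuous_scal k f s A B). Qed.

Lemma displaced_minus (p e u : state) : minus (plus (plus p e) u) p = plus e u.
Proof. state_ring. Qed.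
Lemma minus_self (p : state) : minus p p = scal 0 p.
Proof. state_ring. Qed.
Lemma scal_minus_cancel k (f g d : state) :
  minus (minus (scal k f) d) (minus (scal k g) d) = scal k (minus f g).
Proof. state_ring. Qed.
Lemma scal_minus_split k (f g d : state) :
  minus (scal k f) d = plus (scal k (minus f g)) (minus (scal k g) d).
Proof. state_ring. Qed.
Lemma displaced_cancel (p e u v : state) :
  minus (plus (plus p e) (unstretch u)) (plus (plus p e) (unstretch v))
  = unstretch (minus u v).
Proof. state_ring. Qed.
Lemma plus_zero_minus (d s : state) : plus (plus d zero) (minus s d) = s.
Proof. state_ring. Qed.
Lemma displaced_zero (p z : state) : plus (plus p (minus z p)) (unstretch zero) = z.
Proof. change (unstretch zero) with ((0 / 3, 0 / 3, 0, 0) : state). state_ring. Qed.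

Lemma wnorm_minus_self (p : state) : wnorm (minus p p) = 0.
Proof. rewrite minus_self, wnorm_scal, Rabs_R0. ring. Qed.
Lemma norm_state_zero : norm (zero : state) = 0.
Proof. rewrite zero_state, norm_state. rewrite pow_ne_zero, !Rplus_0_r by discriminate.
  exact sqrt_0. Qed.

Section Step.
Variables (rho1 rho2 mu G K h R0 d e0 : R) (p dp : R -> state) (z0 : state).
Hypothesis P1 : 0 < rho1.
Hypothesis P2 : 0 < rho2.
Hypothesis Hmu : 0 <= mu <= 1.
Hypothesis HG : 2 * ((1 - mu) / rho1 ^ 3 + mu / rho2 ^ 3) <= G.
Hypothesis HK4 : 4 <= K.
Hypothesis HKG : 1 + G / 3 <= K.
Hypothesis Hh : 0 < h.
Hypothesis HhK : h * K < 1.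
Hypothesis Hd : 0 <= d.
Hypothesis He0 : 0 <= e0.
Hypothesis Dp : forall t, is_derive p t (dp t).
Hypothesis Cdp : forall t, continuous dp t.
Hypothesis Tube : forall t z, 0 <= t <= 1 -> wnorm (minus z (p t)) <= R0 ->
  away rho1 rho2 mu z.
Hypothesis Def : forall t, 0 <= t <= 1 ->
  wnorm (minus (scal h (field mu (p t))) (dp t)) <= d.
Hypothesis Init : wnorm (minus z0 (p 0)) <= e0.
Hypothesis Room : e0 + d + h * K * R0 <= R0.

(** The unknown of the Picard iteration is the correction to p + (z0 - p 0), confined to the ball of
    radius R0 - e0. The radius R0 serves only to stay away from the primaries; the final error
    comes from [shadow] and is much smaller. *)
Theorem step_exists : exists z : R -> state, z 0 = z0 /\
  (forall t, 0 <= t <= 1 -> is_derive z t (scal h (field mu (z t))) /\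
     away rho1 rho2 mu (z t) /\ wnorm (minus (z t) (p t)) <= R0) /\
  wnorm (minus (z 1) (p 1)) <= exp (h * ((9 + G) / 6)) * (e0 + d).
Proof.
  assert (hK0 : 0 <= h * K) by nra.
  assert (Rpos : 0 <= R0) by nra.
  assert (Re : 0 <= R0 - e0) by nra.
  set (eps0 := minus z0 (p 0) : state).
  set (q := fun (s : R) (v : state) => plus (plus (p s) eps0) (unstretch v) : state).
  set (g := fun (s : R) (v : state) => stretch (minus (scal h (field mu (q s v))) (dp s))).
  assert (Q : forall s v, wnorm (minus (q s v) (p s)) <= e0 + norm v).
  { intros s v. unfold q.
    rewrite displaced_minus.
    eapply Rle_trans; [apply wnorm_plus|]. rewrite wnorm_unstretch.
    apply Rplus_le_compat_r, Init. }
  assert (QA : forall s v, 0 <= s <= 1 -> norm v <= R0 - e0 -> away rho1 rho2 mu (q s v)).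
  { intros s v Hs Hv. apply (Tube s); [exact Hs|]. specialize (Q s v). lra. }
  assert (PA : forall s, 0 <= s <= 1 -> away rho1 rho2 mu (p s)).
  { intros s Hs. apply (Tube s); [exact Hs|].
    rewrite wnorm_minus_self. exact Rpos. }
  assert (Cp : forall t, continuous p t).
  { intros t. exact (continuous_of_derive p t _ (Dp t)). }
  assert (Cg : forall e : R -> state, (forall t, continuous e t) ->
     (forall t, norm (e t) <= R0 - e0) ->
     forall s, continuous (fun s => g (clamp s) (e s)) s).
  { intros e Ce Be s. unfold g. apply stretch_continuous, continuous_minus_state.
    - apply continuous_scal_state; [apply continuous_const|].
      apply (field_continuous rho1 rho2); try assumption.
      + intros s'. apply QA; [apply clamp_bounds|apply Be].
      + unfold q. apply continuous_plus_state; [apply continuous_plus_state|].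
        * apply (continuous_comp clamp p); [apply clamp_continuous|apply Cp].
        * apply continuous_const.
        * apply unstretch_continuous, Ce.
    - apply (continuous_comp clamp dp); [apply clamp_continuous|apply Cdp]. }
  assert (Lg : forall s u v, 0 <= s <= 1 -> norm u <= R0 - e0 -> norm v <= R0 - e0 ->
     norm (minus (g s u) (g s v)) <= h * K * norm (minus u v)).
  { intros s u v Hs Hu Hv. unfold g. rewrite <- stretch_minus.
    change (wnorm (minus (minus (scal h (field mu (q s u))) (dp s))
      (minus (scal h (field mu (q s v))) (dp s))) <= h * K * norm (minus u v)).
    rewrite scal_minus_cancel.
    rewrite wnorm_scal, Rabs_pos_eq by lra. rewrite Rmult_assoc.
    apply Rmult_le_compat_l; [lra|].
    eapply Rle_trans; [apply (field_lipschitz rho1 rho2 mu G K); auto|].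
    unfold q. rewrite displaced_cancel, wnorm_unstretch. apply Rle_refl. }
  assert (G0 : forall s, 0 <= s <= 1 -> norm (g s zero) <= e0 * (h * K) + d).
  { intros s Hs. unfold g.
    change (wnorm (minus (scal h (field mu (q s zero))) (dp s)) <= e0 * (h * K) + d).
    rewrite (scal_minus_split h _ (field mu (p s))).
    eapply Rle_trans; [apply wnorm_plus|]. apply Rplus_le_compat; [|apply Def, Hs].
    rewrite wnorm_scal, Rabs_pos_eq by lra.
    apply Rle_trans with (h * (K * e0)); [|right; ring].
    apply Rmult_le_compat_l; [lra|].
    eapply Rle_trans; [apply (field_lipschitz rho1 rho2 mu G K); auto|].
    - apply QA; [exact Hs|]. rewrite norm_state_zero. exact Re.
    - apply Rmult_le_compat_l; [lra|]. specialize (Q s zero). rewrite norm_state_zero in Q. lra. }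
  destruct (picard (V := prod_CompleteNormedModule (prod_CompleteNormedModule
     (prod_CompleteNormedModule R_CompleteNormedModule R_CompleteNormedModule)
      R_CompleteNormedModule) R_CompleteNormedModule)
     g (fun _ => h * K) (fun _ => 1) (fun t => h * K * t) (h * K) (R0 - e0) 1)
     as [w [W0 Hw]].
  - lra.
  - exact Re.
  - intros; lra.
  - intros; exact hK0.
  - intros e Ce Be. apply Cg; [exact Ce|]. intros t. specialize (Be t).
    rewrite Rmult_1_r in Be. exact Be.
  - intros s u v Hs Hu Hv. rewrite Rmult_1_r in Hu, Hv. now apply Lg.
  - intros t Ht. split; [|nra]. rewrite Rmult_1_r.
    pose proof (is_RInt_const (V := R_NormedModule) 0 t (h * K)) as I.
    replace (h * K * t) with (scal (t - 0) (h * K : R_NormedModule)); [exact I|].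
    unfold scal; simpl; unfold mult; simpl. ring.
  - intros t Ht.
    apply Rle_trans with ((t - 0) * (e0 * (h * K) + d)).
    + apply (norm_RInt_bound _ (fun _ => e0 * (h * K) + d)).
      * lra.
      * apply (Cg (fun _ => zero)); [intros; apply continuous_const|].
        intros _. rewrite norm_state_zero. exact Re.
      * intros s Hs. rewrite clamp_id by lra. apply G0. lra.
      * exact (is_RInt_const (V := R_NormedModule) 0 t (e0 * (h * K) + d)).
    + assert (0 <= e0 * (h * K) + d) by nra. nra.
  - set (z := fun s => q s (w s)).
    assert (Wb : forall t, 0 <= t <= 1 -> norm (w t : state) <= R0 - e0).
    { intros t Ht. destruct (Hw t Ht) as [B _]. rewrite Rmult_1_r in B. exact B. }
    assert (Dz : forall t, 0 <= t <= 1 -> is_derive z t (scal h (field mu (z t)))).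
    { intros t Ht. destruct (Hw t Ht) as [_ D].
      assert (D2 := is_derive_unstretch w t _ D).
      assert (D3 : is_derive (fun s => plus (p s) eps0) t (plus (dp t) zero)).
      { exact (is_derive_plus p (fun _ => eps0) t _ _ (Dp t) (is_derive_const eps0 t)). }
      assert (D4 := is_derive_plus _ _ t _ _ D3 D2).
      replace (scal h (field mu (z t))) with
        (plus (plus (dp t) zero) (unstretch (g t (w t)))); [exact D4|].
      unfold g. rewrite unstretch_stretch. apply plus_zero_minus. }
    assert (z0E : z 0 = z0).
    { unfold z, q. rewrite W0. apply displaced_zero. }
    assert (zR : forall t, 0 <= t <= 1 -> wnorm (minus (z t) (p t)) <= R0).
    { intros t Ht. specialize (Q t (w t)). specialize (Wb t Ht).
      unfold z. eapply Rle_trans; [exact Q|]. apply Rle_trans with (e0 + (R0 - e0)); [|lra].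
      apply Rplus_le_compat_l, Wb. }
    exists z. split; [exact z0E|]. split.
    + intros t Ht. split; [now apply Dz|]. split; [|now apply zR].
      apply (Tube t); auto.
    + replace (h * ((9 + G) / 6)) with (h * ((9 + G) / 6) * (1 - 0)) by ring.
      eapply Rle_trans; [apply (shadow rho1 rho2 mu G h d z p dp 0 1); auto; try lra|].
      * intros t Ht. split; [apply (Tube t); auto|auto].
      * apply Rmult_le_compat_l; [left; apply exp_pos|]. rewrite z0E.
        fold eps0. unfold eps0. lra.
Qed.
End Step.

(** * The local unstable manifold *)

Lemma displaced_minus2 (p u : state) : minus (plus p u) p = u.
Proof. state_ring. Qed.
Lemma displaced_cancel2 (p u v : state) :
  minus (plus p (unstretch u)) (plus p (unstretch v)) = unstretch (minus u v).
Proof. state_ring. Qed.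
Lemma displaced_zero2 (p : state) : plus p (unstretch zero) = p.
Proof. change (unstretch zero) with ((0 / 3, 0 / 3, 0, 0) : state). state_ring. Qed.
Lemma scal_minus_cancel2 k (f g d : state) :
  minus (scal k (minus f d)) (scal k (minus g d)) = scal k (minus f g).
Proof. state_ring. Qed.
Lemma plus_scal_minus (c k : R) (d f : state) : k * c = 1 ->
  plus d (scal k (minus f (scal c d))) = scal k f.
Proof.
  intros H. destruct d as [[[d1 d2] d3] d4], f as [[[f1 f2] f3] f4].
  rewrite !scal_state, minus_state, scal_state, plus_state.
  assert (E : forall x y, x + k * (y - c * x) = k * y)
    by (intros; transitivity (x + k * y - (k * c) * x); [ring|rewrite H; ring]).
  now rewrite !E.
Qed.

Section Local.
Variables (rho1 rho2 mu G K lam r d : R) (p dp : R -> state).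
Hypothesis P1 : 0 < rho1.
Hypothesis P2 : 0 < rho2.
Hypothesis Hmu : 0 <= mu <= 1.
Hypothesis HG : 2 * ((1 - mu) / rho1 ^ 3 + mu / rho2 ^ 3) <= G.
Hypothesis HK4 : 4 <= K.
Hypothesis HKG : 1 + G / 3 <= K.
Hypothesis HKl : K < 2 * lam.
Hypothesis Hd : 0 <= d.
Hypothesis Hr : d <= (2 * lam - K) * r.
Hypothesis Dp : forall t, is_derive p t (dp t).
Hypothesis Cdp : forall t, continuous dp t.
Hypothesis Tube : forall s z, 0 <= s <= 1 -> wnorm (minus z (p s)) <= r * s ^ 2 ->
  away rho1 rho2 mu z.
Hypothesis Def : forall s, 0 <= s <= 1 ->
  wnorm (minus (field mu (p s)) (scal (lam * s) (dp s))) <= d * s ^ 2.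

(** In the variable s = exp (lam t) a solution obeys lam s z' = field z. The operator that takes a
    correction of size r s^2 to the integral of field / (lam s) has the contraction factor
    K / (2 lam), since s^2 / s integrates to s^2 / 2. *)
Theorem local_exists : exists z : R -> state,
  forall s, 0 <= s <= 1 -> away rho1 rho2 mu (z s) /\ wnorm (minus (z s) (p s)) <= r * s ^ 2
    /\ (0 < s -> is_derive z s (scal (/ (lam * s)) (field mu (z s)))).
Proof.
  assert (L0 : 0 < lam) by lra.
  assert (r0 : 0 <= r) by nra.
  set (q := fun (s : R) (v : state) => plus (p s) (unstretch v) : state).
  set (N := fun (s : R) (v : state) =>
    minus (field mu (q s v)) (scal (lam * s) (dp s)) : state).
  set (g := fun (s : R) (v : state) =>
    if Rle_dec s 0 then (zero : state) else stretch (scal (/ (lam * s)) (N s v))).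
  assert (Q : forall s v, wnorm (minus (q s v) (p s)) = norm v).
  { intros s v. unfold q. rewrite displaced_minus2. apply wnorm_unstretch. }
  assert (QA : forall s v, 0 <= s <= 1 -> norm v <= r * s ^ 2 -> away rho1 rho2 mu (q s v)).
  { intros s v Hs Hv. apply (Tube s); [exact Hs|]. now rewrite Q. }
  assert (PA : forall s, 0 <= s <= 1 -> away rho1 rho2 mu (p s)).
  { intros s Hs. apply (Tube s); [exact Hs|]. rewrite wnorm_minus_self. nra. }
  assert (Cp : forall t, continuous p t).
  { intros t. exact (continuous_of_derive p t _ (Dp t)). }
  assert (NB : forall s v, 0 <= s <= 1 -> norm v <= r * s ^ 2 ->
     wnorm (N s v) <= (d + K * r) * s ^ 2).
  { intros s v Hs Hv. unfold N.
    replace (minus (field mu (q s v)) (scal (lam * s) (dp s))) with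
      (plus (minus (field mu (q s v)) (field mu (p s)))
        (minus (field mu (p s)) (scal (lam * s) (dp s)))).
    2: { generalize (field mu (q s v)), (field mu (p s)), (scal (lam * s) (dp s) : state).
         clear. state_ring. }
    eapply Rle_trans; [apply wnorm_plus|].
    rewrite Rmult_plus_distr_r, Rplus_comm. apply Rplus_le_compat; [apply Def, Hs|].
    eapply Rle_trans; [apply (field_lipschitz rho1 rho2 mu G K); auto|].
    rewrite Q, Rmult_assoc. apply Rmult_le_compat_l; lra. }
  assert (N0 : forall s, 0 <= s <= 1 -> wnorm (N s zero) <= d * s ^ 2).
  { intros s Hs. unfold N, q. rewrite displaced_zero2. now apply Def. }
  assert (GB : forall s v c, 0 < s -> wnorm (N s v) <= c * s ^ 2 ->
     norm (g s v : state) <= c / lam * s).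
  { intros s v c Hs Hc. unfold g. destruct (Rle_dec s 0); [lra|].
    change (wnorm (scal (/ (lam * s)) (N s v)) <= c / lam * s).
    assert (I : 0 < / (lam * s)) by (apply Rinv_0_lt_compat; nra).
    rewrite wnorm_scal, Rabs_pos_eq by lra.
    replace (c / lam * s) with (/ (lam * s) * (c * s ^ 2)) by (field; lra).
    apply Rmult_le_compat_l; lra. }
  assert (Cg : forall e : R -> state, (forall t, continuous e t) ->
     (forall t, norm (e t) <= r * clamp t ^ 2) ->
     forall s, continuous (fun s => g (clamp s) (e s)) s).
  { intros e Ce Be s0.
    destruct (Rle_lt_dec s0 0) as [S0|S0].
    - refine (continuous_of_lipschitz (fun s => s) _ s0 ((d + K * r) / lam) _ (continuous_id s0)).
      intros s'. assert (E0 : clamp s0 = 0).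
      { unfold clamp, Rmax, Rmin. repeat destruct Rle_dec; lra. }
      rewrite E0. assert (G0 : forall v, g 0 v = zero).
      { intros v. unfold g. destruct (Rle_dec 0 0); [reflexivity|lra]. }
      rewrite G0.
      apply Rle_trans with (norm (g (clamp s') (e s') : state)).
      { apply Req_le. apply f_equal.
        exact (minus_zero_r (G := prod_AbelianGroup (prod_AbelianGroup
         (prod_AbelianGroup R_AbelianGroup R_AbelianGroup) R_AbelianGroup) R_AbelianGroup)
          (g (clamp s') (e s'))). }
      assert (C0 : 0 <= (d + K * r) / lam).
      { apply Rmult_le_pos; [nra|left; now apply Rinv_0_lt_compat]. }
      apply Rle_trans with ((d + K * r) / lam * clamp s').
      + destruct (proj1 (clamp_bounds s')) as [H|H].
        * apply GB; [exact H|]. apply NB; [apply clamp_bounds|apply Be].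
        * rewrite <- H. rewrite G0, norm_state_zero. lra.
      + apply Rmult_le_compat_l; [exact C0|].
        pose proof (clamp_lipschitz s' s0) as CL. rewrite E0, Rminus_0_r in CL.
        rewrite Rabs_pos_eq in CL by apply clamp_bounds. exact CL.
    - apply (continuous_ext_loc _ (fun s => stretch (scal (/ (lam * clamp s)) (N (clamp s) (e s))))).
      { assert (P : 0 < s0) by exact S0. exists (mkposreal s0 P). intros s Hs.
        assert (Hs2 : 0 < s).
        { unfold ball in Hs; simpl in Hs; unfold AbsRing_ball, abs, minus, plus, opp in Hs;
          simpl in Hs. apply Rabs_def2 in Hs. lra. }
        unfold g. destruct (Rle_dec (clamp s) 0) as [H|H]; [|reflexivity].
        exfalso. revert H. unfold clamp, Rmax, Rmin. repeat destruct Rle_dec; lra. }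
      assert (Cc : continuous (fun s => lam * clamp s) s0).
      { apply (continuous_mult (K := R_AbsRing) (fun _ => lam) clamp);
          [apply continuous_const|apply clamp_continuous]. }
      apply stretch_continuous, continuous_scal_state.
      + apply (continuous_comp (fun s => lam * clamp s) Rinv); [exact Cc|].
        apply continuous_Rinv. apply Rgt_not_eq, Rmult_lt_0_compat; [exact L0|].
        unfold clamp, Rmax, Rmin. repeat destruct Rle_dec; lra.
      + unfold N. apply continuous_minus_state.
        * apply (field_continuous rho1 rho2); try assumption.
          -- intros s'. apply QA; [apply clamp_bounds|apply Be].
          -- unfold q. apply continuous_plus_state.
             ++ apply (continuous_comp clamp p); [apply clamp_continuous|apply Cp].
             ++ apply unstretch_continuous, Ce.
        * apply continuous_scal_state; [exact Cc|].
          apply (continuous_comp clamp dp); [apply clamp_continuous|apply Cdp]. }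
  set (k := fun s => if Rle_dec s 0 then 0 else K / (lam * s)).
  assert (Lg : forall s u v, 0 <= s <= 1 -> norm u <= r * s ^ 2 -> norm v <= r * s ^ 2 ->
     norm (minus (g s u) (g s v)) <= k s * norm (minus u v)).
  { intros s u v Hs Hu Hv. unfold g, k. destruct (Rle_dec s 0) as [H|H].
    - rewrite minus_self, norm_state_scal, Rabs_R0. lra.
    - unfold N. rewrite <- stretch_minus, scal_minus_cancel2.
      assert (I : 0 < / (lam * s)) by (apply Rinv_0_lt_compat; nra).
      change (wnorm (scal (/ (lam * s)) (minus (field mu (q s u)) (field mu (q s v))))
        <= K / (lam * s) * norm (minus u v)).
      rewrite wnorm_scal, Rabs_pos_eq by lra.
      unfold Rdiv. rewrite (Rmult_comm K), Rmult_assoc.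
      apply Rmult_le_compat_l; [lra|].
      eapply Rle_trans; [apply (field_lipschitz rho1 rho2 mu G K); auto|].
      unfold q. rewrite displaced_cancel2, wnorm_unstretch. apply Rle_refl. }
  assert (RI : forall c t, 0 <= t -> is_RInt (fun s => c * s) 0 t (c * (t ^ 2 / 2))).
  { intros c t Ht. replace (c * (t ^ 2 / 2)) with
      (minus (c * (t ^ 2 / 2) : R_NormedModule) (c * (0 ^ 2 / 2))).
    - apply (is_RInt_derive (fun s => c * (s ^ 2 / 2)) (fun s => c * s) 0 t).
      + intros x _. auto_derive; [trivial|field].
      + intros x _. apply (continuous_mult (K := R_AbsRing) (fun _ => c) (fun s => s));
          [apply continuous_const|apply continuous_id].
    - unfold minus, plus, opp; simpl. field. }
  destruct (picard (V := prod_CompleteNormedModule (prod_CompleteNormedModule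
     (prod_CompleteNormedModule R_CompleteNormedModule R_CompleteNormedModule)
      R_CompleteNormedModule) R_CompleteNormedModule)
     g k (fun s => s ^ 2) (fun t => K / lam * (t ^ 2 / 2)) (K / (2 * lam)) r 1)
     as [w [W0 Hw]].
  - split.
    + apply Rmult_le_pos; [lra|left; apply Rinv_0_lt_compat; lra].
    + apply Rmult_lt_reg_r with (2 * lam); [lra|]. unfold Rdiv.
      rewrite Rmult_assoc, Rinv_l by lra. lra.
  - exact r0.
  - intros t Ht. nra.
  - intros t Ht. unfold k. destruct (Rle_dec t 0); [lra|].
    apply Rmult_le_pos; [lra|left; apply Rinv_0_lt_compat; nra].
  - exact Cg.
  - exact Lg.
  - intros t Ht. split.
    + apply (is_RInt_ext (fun s => K / lam * s)); [|apply RI; lra].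
      intros x. rewrite Rmin_left, Rmax_right by lra. intros Hx.
      unfold k. destruct (Rle_dec x 0); [lra|]. 
      change (K / lam * x = K / (lam * x) * x ^ 2). field. lra.
    + right. field. lra.
  - intros t Ht.
    apply Rle_trans with (d / lam * (t ^ 2 / 2)).
    + apply (norm_RInt_bound _ (fun s => d / lam * s)); [lra| | |apply RI; lra].
      * apply (Cg (fun _ => zero)); [intros; apply continuous_const|].
        intros s. rewrite norm_state_zero. pose proof (clamp_bounds s). nra.
      * intros s Hs. rewrite clamp_id by lra. 
        destruct (proj1 Hs) as [H|H].
        -- apply GB; [exact H|]. apply N0. lra.
        -- subst s. unfold g. destruct (Rle_dec 0 0) as [_|B]; [|lra].
           apply Rle_trans with 0; [exact (Req_le _ _ norm_state_zero)|lra].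
    + replace ((1 - K / (2 * lam)) * r * t ^ 2) with
        ((2 * lam - K) * r * (t ^ 2 / (2 * lam))) by (field; lra).
      replace (d / lam * (t ^ 2 / 2)) with (d * (t ^ 2 / (2 * lam))) by (field; lra).
      apply Rmult_le_compat_r; [|exact Hr].
      apply Rmult_le_pos; [nra|left; apply Rinv_0_lt_compat; lra].
  - exists (fun s => q s (w s)). intros s Hs.
    destruct (Hw s Hs) as [B D].
    split; [apply QA; [exact Hs|exact B]|]. split; [rewrite Q; exact B|].
    intros Hs0. unfold g in D. destruct (Rle_dec s 0) as [|_]; [lra|].
    assert (D2 := is_derive_unstretch w s _ D).
    assert (D4 := is_derive_plus _ _ s _ _ (Dp s) D2).
    rewrite unstretch_stretch in D4. unfold N in D4.
    rewrite <- (plus_scal_minus (lam * s) (/ (lam * s)) (dp s)); [exact D4|].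
    apply Rinv_l. nra.
Qed.
End Local.

(** * Taylor models with integer coefficients *)

(** The integer z stands for the real z / 2^70. *)
Definition prec : nat := 70.
Definition fone : Z := Eval compute in (2 ^ Z.of_nat prec)%Z.

Fixpoint peval (P : list Z) (t : R) : R :=
  match P with nil => 0 | a :: P => IZR a + t * peval P t end.

Fixpoint padd (P Q : list Z) : list Z :=
  match P, Q with
  | nil, _ => Q
  | _, nil => P
  | a :: P, b :: Q => (a + b)%Z :: padd P Q
  end.

Definition pscale (k : Z) (P : list Z) : list Z := map (Z.mul k) P.

Fixpoint psize (P : list Z) : Z :=
  match P with nil => 0%Z | a :: P => (Z.abs a + psize P)%Z end.

(** The quotient by 2^n, by dropping binary digits. It is computed very often, and [Z.shiftr], an
    iterated halving of signed numbers, is much slower. *)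
Fixpoint chop (n : nat) (p : positive) : Z :=
  match n, p with
  | O, _ => Z.pos p
  | S n, xH => 0%Z
  | S n, xO q | S n, xI q => chop n q
  end.

Definition shr (z : Z) : Z :=
  match z with
  | Z0 => 0%Z
  | Zpos p => chop prec p
  | Zneg p => (- chop prec p)%Z
  end.

Definition pshr (P : list Z) : list Z := map shr P.

(** The product cut off at degree n, and a bound on [0, 1] of what was cut off. *)
Fixpoint pmul (n : nat) (P Q : list Z) : list Z * Z :=
  match P, n with
  | nil, _ => (nil, 0%Z)
  | _, O => (nil, (psize P * psize Q)%Z)
  | a :: P, S m =>
      let (R, e) := pmul m P Q in
      (padd (pscale a (firstn n Q)) (0%Z :: R), (e + Z.abs a * psize (skipn n Q))%Z)
  end.

(** As [pmul] for a square, with half as many multiplications. *)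
Fixpoint psquare (n : nat) (P : list Z) : list Z * Z :=
  match P, n with
  | nil, _ => (nil, 0%Z)
  | _, O => (nil, (psize P * psize P)%Z)
  | a :: P, S O => ((a * a)%Z :: nil, ((2 * Z.abs a + psize P) * psize P)%Z)
  | a :: P, S (S m) =>
      let (R, e) := psquare m P in
      ((a * a)%Z :: padd (pscale (2 * a) (firstn (S m) P)) (0%Z :: R),
       (e + 2 * Z.abs a * psize (skipn (S m) P))%Z)
  end.

Fixpoint pderiv_aux (k : Z) (P : list Z) : list Z :=
  match P with nil => nil | a :: P => (k * a)%Z :: pderiv_aux (k + 1) P end.
Definition pderiv (P : list Z) : list Z :=
  match P with nil => nil | _ :: P => pderiv_aux 1 P end.

(** A polynomial in t, lowest coefficient first, and a bound of the error for t in [0, 1]. *)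
Definition tm : Type := (list Z * Z)%type.

(** An upper bound of the quotient by 2^70. *)
Definition rup (z : Z) : Z := (shr z + 1)%Z.

Definition tadd (f g : tm) : tm := (padd (fst f) (fst g), (snd f + snd g)%Z).
Definition tscale (k : Z) (f : tm) : tm := (pscale k (fst f), (Z.abs k * snd f)%Z).
Definition tsub (f g : tm) : tm := tadd f (tscale (-1) g).
(** Back to scale 2^70 after a product; each of the shifted coefficients loses less than 1. *)
Definition tround (p : list Z * Z) (e : Z) : tm :=
  (pshr (fst p), (rup (snd p + e) + Z.of_nat (length (fst p)))%Z).
Definition tmul (n : nat) (f g : tm) : tm :=
  tround (pmul n (fst f) (fst g))
    (psize (fst f) * snd g + psize (fst g) * snd f + snd f * snd g)%Z.
Definition tsquare (n : nat) (f : tm) : tm :=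
  tround (psquare n (fst f))
    (psize (fst f) * snd f + psize (fst f) * snd f + snd f * snd f)%Z.
Definition tX (f : tm) : tm := (0%Z :: fst f, snd f).
Definition tbound (f : tm) : Z := (psize (fst f) + snd f)%Z.
Definition texact (P : list Z) : tm := (P, 0%Z).
Definition tone : tm := texact (fone :: nil).

(** Models of 1/sqrt f and 1/f from a guess Q of 1/sqrt f. The guess is judged by its residual
    Q^2 f - 1 alone; the test on the coefficients makes Q positive, so that it is not close to the
    negative root. *)
Definition tinvsqrt2 (n : nat) (f : tm) (Q : list Z) : bool * (tm * tm) :=
  let q2 := tsquare n (texact Q) in
  let eps := tbound (tsub (tmul n q2 f) tone) in
  (andb (2 * eps <=? fone)%Z
     (match Q with nil => false | a :: Q => (psize Q <? a)%Z end),
   ((Q, rup (2 * eps * psize Q)), (fst q2, (snd q2 + rup (4 * eps * tbound q2))%Z))).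

Definition tinvsqrt (n : nat) (f : tm) (Q : list Z) : bool * tm :=
  let (ok, V) := tinvsqrt2 n f Q in (ok, fst V).

Definition encl (f : R -> R) (m : tm) : Prop :=
  forall t, 0 <= t <= 1 -> Rabs (IZR fone * f t - peval (fst m) t) <= IZR (snd m).

Lemma fone_pos : 0 < IZR fone.
Proof. apply IZR_lt. reflexivity. Qed.

Lemma peval_add P Q t : peval (padd P Q) t = peval P t + peval Q t.
Proof.
  revert Q; induction P as [|a P IH]; intros [|b Q]; simpl; try ring.
  rewrite IH, plus_IZR. ring.
Qed.

Lemma peval_scale k P t : peval (pscale k P) t = IZR k * peval P t.
Proof.
  induction P as [|a P IH]; simpl; [ring|]. fold (pscale k P). rewrite IH, mult_IZR. ring.
Qed.

Lemma peval_bound P t : 0 <= t <= 1 -> Rabs (peval P t) <= IZR (psize P).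
Proof.
  intros Ht. induction P as [|a P IH]; simpl; [rewrite Rabs_R0; lra|].
  rewrite plus_IZR, abs_IZR. eapply Rle_trans; [apply Rabs_triang|].
  apply Rplus_le_compat_l. rewrite Rabs_mult, (Rabs_pos_eq t) by lra.
  pose proof (Rabs_pos (peval P t)). nra.
Qed.

Lemma peval_split n P t :
  peval P t = peval (firstn n P) t + t ^ n * peval (skipn n P) t.
Proof.
  revert P; induction n as [|n IH]; intros P; simpl; [ring|].
  destruct P as [|a P]; simpl; [ring|]. rewrite (IH P) at 1. ring.
Qed.

Lemma pmul_spec n P Q t : 0 <= t <= 1 ->
  Rabs (peval P t * peval Q t - peval (fst (pmul n P Q)) t) <= IZR (snd (pmul n P Q)).
Proof.
  intros Ht. revert n; induction P as [|a P IH]; intros n.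
  - replace (pmul n nil Q) with (@nil Z, 0%Z) by (destruct n; reflexivity).
    simpl. rewrite Rmult_0_l, Rminus_0_r, Rabs_R0. lra.
  - destruct n as [|m].
    + cbn [pmul fst snd]. rewrite Rminus_0_r, mult_IZR, Rabs_mult.
      apply Rmult_le_compat; try apply Rabs_pos; apply peval_bound, Ht.
    + cbn [pmul]. specialize (IH m). destruct (pmul m P Q) as [R e].
      cbn [fst snd] in *. rewrite peval_add, peval_scale, plus_IZR, mult_IZR, abs_IZR.
      cbn [peval]. rewrite (peval_split (S m) Q) at 1.
      set (n := S m) in *. 
      replace ((IZR a + t * peval P t) * (peval (firstn n Q) t + t ^ n * peval (skipn n Q) t)
        - (IZR a * peval (firstn n Q) t + (0 + t * peval R t)))
        with (t * (peval P t * peval Q t - peval R t)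
          + IZR a * (t ^ n * peval (skipn n Q) t))
        by (rewrite (peval_split n Q t); ring).
      eapply Rle_trans; [apply Rabs_triang|]. rewrite !Rabs_mult.
      pose proof (peval_bound (skipn n Q) t Ht) as B.
      assert (T : Rabs (t ^ n) <= 1).
      { rewrite <- RPow_abs, Rabs_pos_eq by lra. rewrite <- (pow1 n). apply pow_incr. lra. }
      apply Rplus_le_compat.
      * rewrite (Rabs_pos_eq t) by lra.
        rewrite <- (Rmult_1_l (IZR e)). apply Rmult_le_compat; try lra. apply Rabs_pos.
      * apply Rmult_le_compat_l; [apply Rabs_pos|].
        rewrite <- (Rmult_1_l (IZR (psize _))).
        apply Rmult_le_compat; try apply Rabs_pos; assumption.
Qed.

Lemma psquare_spec n P t : 0 <= t <= 1 ->
  Rabs (peval P t * peval P t - peval (fst (psquare n P)) t) <= IZR (snd (psquare n P)).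
Proof.
  intros Ht. assert (H : forall N, (length P <= N)%nat -> forall n,
    Rabs (peval P t * peval P t - peval (fst (psquare n P)) t) <= IZR (snd (psquare n P))).
  2: { exact (H _ (le_n _) n). }
  clear n. induction P as [|a P IH]; intros N HN n.
  - replace (psquare n nil) with (@nil Z, 0%Z) by (destruct n; reflexivity).
    simpl. rewrite Rmult_0_l, Rminus_0_r, Rabs_R0. lra.
  - pose proof (peval_bound P t Ht) as B. pose proof (Rabs_pos (peval P t)) as B0.
    destruct n as [|[|m]].
    + cbn [psquare fst snd]. pose proof (peval_bound (a :: P) t Ht) as C.
      rewrite Rminus_0_r, mult_IZR, Rabs_mult.
      apply Rmult_le_compat; try apply Rabs_pos; exact C.
    + cbn [psquare fst snd peval]. rewrite Rmult_0_r, Rplus_0_r.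
      rewrite !mult_IZR, plus_IZR, mult_IZR, abs_IZR.
      replace ((IZR a + t * peval P t) * (IZR a + t * peval P t) - IZR a * IZR a)
        with (t * ((2 * IZR a + t * peval P t) * peval P t)) by ring.
      rewrite Rabs_mult, (Rabs_pos_eq t), Rabs_mult by lra.
      assert (D : Rabs (2 * IZR a + t * peval P t) <= 2 * Rabs (IZR a) + IZR (psize P)).
      { eapply Rle_trans; [apply Rabs_triang|].
        rewrite !Rabs_mult, (Rabs_pos_eq t), (Rabs_pos_eq 2) by lra. nra. }
      pose proof (Rabs_pos (2 * IZR a + t * peval P t)) as D0.
      assert (F : Rabs (2 * IZR a + t * peval P t) * Rabs (peval P t)
        <= (2 * Rabs (IZR a) + IZR (psize P)) * IZR (psize P))
        by (apply Rmult_le_compat; assumption).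
      assert (0 <= Rabs (2 * IZR a + t * peval P t) * Rabs (peval P t))
        by (apply Rmult_le_pos; assumption).
      nra.
    + cbn [length] in HN. specialize (IH N ltac:(lia) m). cbn [psquare].
      destruct (psquare m P) as [R e]. cbn [fst snd peval] in *.
      rewrite peval_add, peval_scale, plus_IZR, !mult_IZR, abs_IZR.
      set (n := S m) in *. cbn [peval].
      pose proof (peval_bound (skipn n P) t Ht) as BS.
      rewrite <- (Rplus_0_l (t * peval R t)) at 1.
      replace ((IZR a + t * peval P t) * (IZR a + t * peval P t)
        - (IZR a * IZR a + t * (IZR 2 * IZR a * peval (firstn n P) t + (0 + (0 + t * peval R t)))))
        with (t * t * (peval P t * peval P t - peval R t)
          + 2 * IZR a * (t * (t ^ n * peval (skipn n P) t)))
        by (rewrite (peval_split n P t); ring).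
      eapply Rle_trans; [apply Rabs_triang|].
      assert (T : 0 <= t * t ^ n <= 1).
      { rewrite tech_pow_Rmult. split; [apply pow_le; lra|].
        rewrite <- (pow1 (S n)). apply pow_incr. lra. }
      apply Rplus_le_compat.
      * rewrite Rabs_mult, (Rabs_pos_eq (t * t)) by nra.
        pose proof (Rabs_pos (peval P t * peval P t - peval R t)).
        assert (0 <= t * t <= 1) by nra. nra.
      * replace (2 * IZR a * (t * (t ^ n * peval (skipn n P) t)))
          with (2 * IZR a * (t * t ^ n * peval (skipn n P) t)) by ring.
        set (w := t * t ^ n) in *. clearbody w.
        rewrite !Rabs_mult, (Rabs_pos_eq 2), (Rabs_pos_eq w) by lra.
        apply Rmult_le_compat_l; [pose proof (Rabs_pos (IZR a)); lra|].
        pose proof (Rabs_pos (peval (skipn n P) t)). nra.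
Qed.

Lemma chop_spec n p :
  (2 ^ Z.of_nat n * chop n p <= Z.pos p < 2 ^ Z.of_nat n * (chop n p + 1))%Z.
Proof.
  revert p; induction n as [|n IH]; intros p.
  - simpl chop. lia.
  - rewrite Nat2Z.inj_succ, Z.pow_succ_r by lia. pose proof (Z.pow_pos_nonneg 2 (Z.of_nat n)).
    destruct p as [p|p|]; simpl chop; try specialize (IH p); nia.
Qed.

Lemma shr_spec z : (- fone < z - fone * shr z < fone)%Z.
Proof.
  destruct z as [|p|p]; unfold shr; [split; reflexivity| |];
    pose proof (chop_spec prec p) as B; change (2 ^ Z.of_nat prec)%Z with fone in B; lia.
Qed.

Lemma rup_spec z : IZR z <= IZR fone * IZR (rup z).
Proof.
  rewrite <- mult_IZR. apply IZR_le. unfold rup.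
  pose proof (shr_spec z). lia.
Qed.

Lemma pshr_spec P t : 0 <= t <= 1 ->
  Rabs (peval P t - IZR fone * peval (pshr P) t) <= IZR fone * INR (length P).
Proof.
  intros Ht. induction P as [|a P IH].
  - simpl. rewrite !Rmult_0_r, Rminus_0_r, Rabs_R0. lra.
  - cbn [pshr map peval length]. fold (pshr P). rewrite S_INR.
    destruct (shr_spec a) as [B1 B2]. apply IZR_lt in B1, B2.
    rewrite opp_IZR, minus_IZR, mult_IZR in *.
    replace (IZR a + t * peval P t - IZR fone * (IZR (shr a) + t * peval (pshr P) t))
      with ((IZR a - IZR fone * IZR (shr a)) + t * (peval P t - IZR fone * peval (pshr P) t))
      by ring.
    eapply Rle_trans; [apply Rabs_triang|].
    assert (Rabs (IZR a - IZR fone * IZR (shr a)) <= IZR fone) by (apply Rabs_le; lra).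
    rewrite Rabs_mult, (Rabs_pos_eq t) by lra.
    pose proof (Rabs_pos (peval P t - IZR fone * peval (pshr P) t)). nra.
Qed.

Lemma encl_add f g m n : encl f m -> encl g n -> encl (fun t => f t + g t) (tadd m n).
Proof.
  intros A B t Ht. specialize (A t Ht). specialize (B t Ht). unfold tadd; cbn [fst snd].
  rewrite peval_add, plus_IZR.
  replace (IZR fone * (f t + g t) - (peval (fst m) t + peval (fst n) t))
    with ((IZR fone * f t - peval (fst m) t) + (IZR fone * g t - peval (fst n) t)) by ring.
  eapply Rle_trans; [apply Rabs_triang|]. lra.
Qed.

Lemma encl_scale k f m : encl f m -> encl (fun t => IZR k * f t) (tscale k m).
Proof.
  intros A t Ht. specialize (A t Ht). unfold tscale; cbn [fst snd].
  rewrite peval_scale, mult_IZR, abs_IZR.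
  replace (IZR fone * (IZR k * f t) - IZR k * peval (fst m) t)
    with (IZR k * (IZR fone * f t - peval (fst m) t)) by ring.
  rewrite Rabs_mult. apply Rmult_le_compat_l; [apply Rabs_pos|exact A].
Qed.

Lemma encl_ext f g m : (forall t, 0 <= t <= 1 -> f t = g t) -> encl f m -> encl g m.
Proof. intros E A t Ht. rewrite <- E by exact Ht. now apply A. Qed.

Lemma encl_sub f g m n : encl f m -> encl g n -> encl (fun t => f t - g t) (tsub m n).
Proof.
  intros A B. apply (encl_ext (fun t => f t + IZR (-1) * g t)); [intros; simpl; ring|].
  apply encl_add; [exact A|]. now apply encl_scale.
Qed.

Lemma encl_nonneg f m : encl f m -> 0 <= IZR (snd m).
Proof.
  intros A. eapply Rle_trans; [apply Rabs_pos|]. apply (A 0). lra.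
Qed.

Lemma encl_product (f g : R -> R) (m n : tm) (p : list Z * Z) :
  (forall t, 0 <= t <= 1 ->
     Rabs (peval (fst m) t * peval (fst n) t - peval (fst p) t) <= IZR (snd p)) ->
  encl f m -> encl g n ->
  encl (fun t => f t * g t)
    (tround p (psize (fst m) * snd n + psize (fst n) * snd m + snd m * snd n)%Z).
Proof.
  intros Prod A B t Ht.
  pose proof (encl_nonneg _ _ A) as Em. pose proof (encl_nonneg _ _ B) as En.
  specialize (A t Ht). specialize (B t Ht).
  destruct m as [P e], n as [Q e']; cbn [fst snd] in *.
  pose proof (Prod t Ht) as M. unfold tround; cbn [fst snd].
  destruct p as [R c]; cbn [fst snd] in *.
  pose proof (pshr_spec R t Ht) as Sh.
  pose proof (peval_bound P t Ht) as BP. pose proof (peval_bound Q t Ht) as BQ.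
  pose proof (rup_spec (c + (psize P * e' + psize Q * e + e * e'))%Z) as U.
  rewrite !plus_IZR, !mult_IZR in U.
  rewrite plus_IZR, <- INR_IZR_INZ.
  set (r := IZR (rup _)) in *. clearbody r.
  pose proof fone_pos as S0.
  apply Rmult_le_reg_l with (IZR fone); [exact S0|].
  rewrite <- (Rabs_pos_eq (IZR fone)) at 1 by lra. rewrite <- Rabs_mult.
  set (F := f t) in *. set (H := g t) in *.
  set (p := peval P t) in *. set (q := peval Q t) in *.
  set (s := IZR fone) in *.
  replace (s * (s * (F * H) - peval (pshr R) t)) with
    ((s * F - p) * (s * H - q) + p * (s * H - q) + q * (s * F - p)
     + (p * q - peval R t) + (peval R t - s * peval (pshr R) t)) by ring.
  assert (X1 : Rabs ((s * F - p) * (s * H - q)) <= IZR e * IZR e')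
    by (rewrite Rabs_mult; apply Rmult_le_compat; try apply Rabs_pos; assumption).
  assert (X2 : Rabs (p * (s * H - q)) <= IZR (psize P) * IZR e')
    by (rewrite Rabs_mult; apply Rmult_le_compat; try apply Rabs_pos; assumption).
  assert (X3 : Rabs (q * (s * F - p)) <= IZR (psize Q) * IZR e)
    by (rewrite Rabs_mult; apply Rmult_le_compat; try apply Rabs_pos; assumption).
  eapply Rle_trans; [apply Rabs_triang|].
  eapply Rle_trans; [apply Rplus_le_compat_r, Rabs_triang|].
  eapply Rle_trans; [apply Rplus_le_compat_r, Rplus_le_compat_r, Rabs_triang|].
  eapply Rle_trans;
    [apply Rplus_le_compat_r, Rplus_le_compat_r, Rplus_le_compat_r, Rabs_triang|].
  rewrite Rmult_plus_distr_l. lra.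
Qed.

Lemma encl_mul k f g m n : encl f m -> encl g n -> encl (fun t => f t * g t) (tmul k m n).
Proof. apply encl_product. intros t Ht. now apply pmul_spec. Qed.

Lemma encl_square k f m : encl f m -> encl (fun t => f t * f t) (tsquare k m).
Proof. intros A. apply encl_product; [|exact A|exact A]. intros t Ht. now apply psquare_spec. Qed.

Lemma encl_exact P : encl (fun t => peval P t / IZR fone) (texact P).
Proof.
  intros t Ht. unfold texact; cbn [fst snd]. pose proof fone_pos.
  replace (IZR fone * (peval P t / IZR fone) - peval P t) with 0 by (field; lra).
  rewrite Rabs_R0. lra.
Qed.

Lemma encl_one : encl (fun _ => 1) tone.
Proof.
  apply (encl_ext (fun t => peval (fone :: nil) t / IZR fone)); [|apply encl_exact].
  intros t _. cbn [peval]. pose proof fone_pos. field. lra.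
Qed.

Lemma encl_X f m : encl f m -> encl (fun t => t * f t) (tX m).
Proof.
  intros A t Ht. unfold tX; cbn [fst snd peval].
  replace (IZR fone * (t * f t) - (0 + t * peval (fst m) t))
    with (t * (IZR fone * f t - peval (fst m) t)) by ring.
  rewrite Rabs_mult, (Rabs_pos_eq t) by lra.
  pose proof (encl_nonneg _ _ A). specialize (A t Ht).
  pose proof (Rabs_pos (IZR fone * f t - peval (fst m) t)). nra.
Qed.

Lemma encl_bound f m t : encl f m -> 0 <= t <= 1 ->
  Rabs (f t) <= IZR (tbound m) / IZR fone.
Proof.
  intros A Ht. specialize (A t Ht). pose proof (peval_bound (fst m) t Ht) as B.
  pose proof fone_pos as S0. unfold tbound. rewrite plus_IZR.
  apply Rmult_le_reg_l with (IZR fone); [exact S0|].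
  rewrite <- (Rabs_pos_eq (IZR fone)) at 1 by lra. rewrite <- Rabs_mult.
  replace (IZR fone * ((IZR (psize (fst m)) + IZR (snd m)) / IZR fone))
    with (IZR (psize (fst m)) + IZR (snd m)) by (field; lra).
  replace (IZR fone * f t) with (peval (fst m) t + (IZR fone * f t - peval (fst m) t)) by ring.
  eapply Rle_trans; [apply Rabs_triang|]. lra.
Qed.

(** If q^2 f = 1 + e and s = 1/sqrt f, then (q - s)(q + s) = e s^2. *)
Lemma encl_invsqrt2 k f m Q : encl f m -> fst (tinvsqrt2 k m Q) = true ->
  (forall t, 0 <= t <= 1 -> 0 < f t) /\
  encl (fun t => / sqrt (f t)) (fst (snd (tinvsqrt2 k m Q))) /\
  encl (fun t => / sqrt (f t) * / sqrt (f t)) (snd (snd (tinvsqrt2 k m Q))).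
Proof.
  intros A. unfold tinvsqrt2. cbn [fst snd].
  set (q := fun t => peval Q t / IZR fone).
  pose proof (encl_exact Q) as EQ. fold q in EQ.
  pose proof (encl_square k _ _ EQ) as EQ2. set (q2 := tsquare k (texact Q)) in *.
  change (encl (fun t => q t * q t) q2) in EQ2. clearbody q2.
  set (m' := tsub (tmul k q2 m) tone).
  assert (R : encl (fun t => q t * q t * f t - 1) m').
  { apply encl_sub; [|apply encl_one].
    exact (encl_mul k _ _ _ _ EQ2 A). }
  pose proof (fun t Ht => encl_bound _ _ t R Ht) as B.
  set (eps := tbound m') in *. clearbody eps.
  intros C. apply andb_prop in C. destruct C as [C1 C2].
  apply Z.leb_le in C1. apply IZR_le in C1. rewrite mult_IZR in C1.
  pose proof fone_pos as S0.
  assert (QP : forall t, 0 <= t <= 1 -> 0 < q t).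
  { intros t Ht. destruct Q as [|a Q]; [discriminate|]. apply Z.ltb_lt in C2.
    unfold q. apply Rdiv_lt_0_compat; [|exact S0]. cbn [peval].
    pose proof (peval_bound Q t Ht) as D. apply IZR_lt in C2.
    pose proof (Rabs_pos (peval Q t)).
    assert (- Rabs (peval Q t) <= peval Q t)
      by (pose proof (Rle_abs (- peval Q t)); rewrite Rabs_Ropp in *; lra).
    nra. }
  set (E := IZR eps / IZR fone) in *.
  assert (E12 : E <= 1 / 2).
  { unfold E. apply Rmult_le_reg_r with (IZR fone); [exact S0|].
    unfold Rdiv. rewrite Rmult_assoc, Rinv_l by lra. lra. }
  assert (FP : forall t, 0 <= t <= 1 -> 0 < f t).
  { intros t Ht. specialize (B t Ht). specialize (QP t Ht).
    apply Rabs_le_between in B.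
    apply Rnot_le_lt. intros H. assert (0 < q t * q t) by nra. nra. }
  split; [exact FP|].
  assert (Key : forall t, 0 <= t <= 1 -> let s := / sqrt (f t) in
    0 < s /\ s <= 2 * q t /\ Rabs (q t - s) <= E * s /\
    Rabs (s * s - q t * q t) <= E * (s * s)).
  { intros t Ht s. specialize (B t Ht). specialize (QP t Ht). specialize (FP t Ht).
    pose proof (sqrt_lt_R0 _ FP) as SP.
    assert (sE : sqrt (f t) * sqrt (f t) = f t) by (apply sqrt_sqrt; lra).
    assert (sP : 0 < s) by now apply Rinv_0_lt_compat.
    assert (fs : f t * s * s = 1) by (rewrite <- sE; unfold s; field; lra).
    set (e := q t * q t * f t - 1) in *.
    assert (K : (q t - s) * (q t + s) = e * s * s).
    { unfold e. transitivity (q t * q t * (f t * s * s) - s * s); [rewrite fs; ring|ring]. }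
    assert (D2 : Rabs (s * s - q t * q t) <= E * (s * s)).
    { replace (s * s - q t * q t) with (- (e * (s * s))) by lra.
      rewrite Rabs_Ropp, Rabs_mult, (Rabs_pos_eq (s * s)) by nra.
      apply Rmult_le_compat_r; [nra|exact B]. }
    assert (D : Rabs (q t - s) <= E * s).
    { assert (H : Rabs (q t - s) * (q t + s) = Rabs e * s * s).
      { rewrite <- (Rabs_pos_eq (q t + s)) at 1 by lra. rewrite <- Rabs_mult, K, !Rabs_mult.
        rewrite (Rabs_pos_eq s) by lra. ring. }
      pose proof (Rabs_pos (q t - s)). pose proof (Rabs_pos e).
      apply Rmult_le_reg_r with s; [exact sP|]. nra. }
    assert (s2 : s <= 2 * q t).
    { assert (- (E * s) <= q t - s) by (apply Rabs_le_between in D; lra). nra. }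
    split; [exact sP|]. split; [exact s2|]. split; [exact D|exact D2]. }
  assert (E0 : 0 <= E) by (eapply Rle_trans; [apply Rabs_pos|exact (B 0 ltac:(lra))]).
  assert (eE : IZR eps = E * IZR fone) by (unfold E; field; lra).
  split; intros t Ht; cbn [fst snd]; destruct (Key t Ht) as [sP [s2 [D D2]]];
    set (s := / sqrt (f t)) in *; specialize (QP t Ht).
  - pose proof (peval_bound Q t Ht) as BQ.
    assert (qE : peval Q t = IZR fone * q t) by (unfold q; field; lra).
    rewrite qE in BQ |- *.
    rewrite Rabs_mult, (Rabs_pos_eq (q t)), (Rabs_pos_eq (IZR fone)) in BQ by lra.
    pose proof (rup_spec (2 * eps * psize Q)) as U. rewrite !mult_IZR in U.
    set (r := IZR (rup _)) in *. clearbody r.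
    replace (IZR fone * s - IZR fone * q t) with (- (IZR fone * (q t - s))) by ring.
    rewrite Rabs_Ropp, Rabs_mult, (Rabs_pos_eq (IZR fone)) by lra.
    rewrite eE in U.
    apply Rmult_le_reg_l with (IZR fone); [exact S0|].
    apply Rle_trans with (2 * (E * IZR fone) * IZR (psize Q)); [|exact U].
    assert (E * s <= E * (2 * q t)) by (apply Rmult_le_compat_l; lra).
    apply Rle_trans with (IZR fone * (IZR fone * (E * (2 * q t)))).
    + apply Rmult_le_compat_l; [lra|]. apply Rmult_le_compat_l; lra.
    + replace (IZR fone * (IZR fone * (E * (2 * q t))))
        with (2 * (E * IZR fone) * (IZR fone * q t)) by ring.
      apply Rmult_le_compat_l; [nra|exact BQ].
  - pose proof (encl_bound _ _ t EQ2 Ht) as BQ.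
    cbv beta in BQ. rewrite (Rabs_pos_eq (q t * q t)) in BQ by nra.
    specialize (EQ2 t Ht). cbv beta in EQ2.
    pose proof (rup_spec (4 * eps * tbound q2)) as U. rewrite !mult_IZR, eE in U.
    rewrite plus_IZR. set (r := IZR (rup _)) in *. clearbody r.
    replace (IZR fone * (s * s) - peval (fst q2) t)
      with ((IZR fone * (q t * q t) - peval (fst q2) t)
        + IZR fone * (s * s - q t * q t)) by ring.
    eapply Rle_trans; [apply Rabs_triang|]. apply Rplus_le_compat; [exact EQ2|].
    rewrite Rabs_mult, (Rabs_pos_eq (IZR fone)) by lra.
    assert (F1 : Rabs (s * s - q t * q t) <= E * (4 * (q t * q t))).
    { eapply Rle_trans; [exact D2|]. apply Rmult_le_compat_l; [exact E0|]. nra. }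
    set (w := IZR (tbound q2)) in *.
    assert (F2 : IZR fone * (q t * q t) <= w).
    { replace w with (IZR fone * (w / IZR fone)) by (field; lra).
      apply Rmult_le_compat_l; lra. }
    apply Rmult_le_reg_l with (IZR fone); [exact S0|].
    eapply Rle_trans; [|exact U].
    apply Rle_trans with (IZR fone * (IZR fone * (E * (4 * (q t * q t))))).
    + apply Rmult_le_compat_l; [lra|]. apply Rmult_le_compat_l; lra.
    + replace (IZR fone * (IZR fone * (E * (4 * (q t * q t)))))
        with (4 * (E * IZR fone) * (IZR fone * (q t * q t))) by ring.
      apply Rmult_le_compat_l; [nra|exact F2].
Qed.

Lemma encl_invsqrt k f m Q : encl f m -> fst (tinvsqrt k m Q) = true ->
  (forall t, 0 <= t <= 1 -> 0 < f t) /\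
  encl (fun t => / sqrt (f t)) (snd (tinvsqrt k m Q)).
Proof.
  intros A. pose proof (encl_invsqrt2 k f m Q A) as H. unfold tinvsqrt.
  destruct (tinvsqrt2 k m Q) as [ok [V V2]]. cbn [fst snd] in *.
  intros E. destruct (H E) as [P [EV _]]. split; assumption.
Qed.

Lemma peval_deriv_aux k P t :
  peval (pderiv_aux k P) t = IZR k * peval P t + t * peval (pderiv P) t.
Proof.
  revert k; induction P as [|a P IH]; intros k; cbn [pderiv_aux peval pderiv]; [ring|].
  rewrite (IH (k + 1)%Z), (IH 1%Z), mult_IZR, plus_IZR. ring.
Qed.

Lemma is_derive_peval P t : is_derive (peval P) t (peval (pderiv P) t).
Proof.
  induction P as [|a P IH].
  - apply (is_derive_const (V := R_NormedModule) 0).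
  - cbn [pderiv]. rewrite peval_deriv_aux.
    evar_last.
    + apply (is_derive_plus (V := R_NormedModule) (fun _ => IZR a) (fun t => t * peval P t)).
      * apply is_derive_const.
      * apply (is_derive_mult (fun t => t) (peval P)); [apply is_derive_id|exact IH|].
        intros; apply Rmult_comm.
    + unfold plus, zero, mult, one; simpl. unfold mult, one, plus; simpl. ring.
Qed.

(** * The checker of one integration step *)

Open Scope bool_scope.
Local Open Scope Z_scope.

Fixpoint dot (P Q : list Z) : Z :=
  match P, Q with a :: P, b :: Q => a * b + dot P Q | _, _ => 0 end.
Definition conv (P Q : list Z) : Z := dot P (rev Q).
Fixpoint wdotZ (c dc : Z) (P Q : list Z) : Z :=
  match P, Q with a :: P, b :: Q => c * (a * b) + wdotZ (c + dc) dc P Q | _, _ => 0 end.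
Definition fmul (a b : Z) : Z := shr (a * b).

Definition zstate : Type := (Z * Z * Z * Z)%type.
Definition polys : Type := (list Z * list Z * list Z * list Z)%type.

Definition autoconv (P : list Z) : Z :=
  let h := Nat.div2 (length P) in
  2 * dot (firstn h P) (rev P)
  + (if Nat.odd (length P) then let m := nth h P 0 in m * m else 0).

(** Taylor coefficients of a solution in time divided by h, and those of the inverse distances, as a
    guess that [verify] judges by its residual. The lists hold the highest coefficient first. *)
Fixpoint taylor (n : nat) (k mu h : Z)
  (X Y U V A R1 R2 V1 V2 C1 C2 C : list Z) : polys * list Z * list Z :=
  match n with
  | O => (rev X, rev Y, rev U, rev V, rev V1, rev V2)
  | S n =>
    let r1 := shr (autoconv A + autoconv Y) in
    let r2 := r1 + 2 * hd 0 A + (if k =? 0 then fone else 0) in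
    let R1 := r1 :: R1 in
    let R2 := r2 :: R2 in
    let vc := fun R V C =>
      if k =? 0 then let v := Z.sqrt (fone * fone * fone / hd 0 R) in (v, fmul (fmul v v) v)
      else
        let v0 := last V 0 in
        let c := fmul (shr (wdotZ (-3 * k) 1 R (rev C))) (fmul v0 v0) / (2 * k) in
        (shr (conv (c :: C) R), c) in
    let (v1, c1) := vc R1 V1 C1 in
    let (v2, c2) := vc R2 V2 C2 in
    let V1 := v1 :: V1 in
    let V2 := v2 :: V2 in
    let C1 := c1 :: C1 in
    let C2 := c2 :: C2 in
    let C := shr ((fone - mu) * c1 + mu * c2) :: C in
    let fx := shr (conv C A + mu * c2) in
    let fy := shr (conv C Y) in
    let next := fmul (h / (k + 1)) in
    let x := next (hd 0 U + hd 0 Y) in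
    let y := next (hd 0 V - hd 0 X) in
    let u := next (hd 0 V - fx) in
    let v := next (- hd 0 U - fy) in
    taylor n (k + 1) mu h (x :: X) (y :: Y) (u :: U) (v :: V) (x :: A) R1 R2 V1 V2 C1 C2 C
  end.

Definition cube (w : Z) : Z := rup (rup (w * w) * w).
Definition psum (P : list Z) : Z := fold_right Z.add 0 P.

(** d bounds the residual of the proposed polynomials, w1 and w2 the inverse distances to the
    primaries in the tube of radius R, G the tidal force there, K the Lipschitz constant, and z an
    eighth of the Gronwall exponent, whence the growth factor (1 + z + z^2)^8. The result is the
    state at the end, its error, and a bound of the distance from the initial state during the
    step. *)
Definition verify (N : nat) (mu emu R h : Z) (st : zstate) (e0 : Z)
  (X Y U V Q1 Q2 : list Z) : option (zstate * Z * Z) :=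
  let '(x0, y0, u0, v0) := st in
  let m := (mu :: nil, emu) in
  let tx := texact X in let ty := texact Y in
  let tu := texact U in let tv := texact V in
  let A := tsub tx m in
  let S1 := tadd (tsquare N A) (tsquare N ty) in
  let S2 := tadd S1 (tadd (tscale 2 A) tone) in
  let '(ok1, (I1, J1)) := tinvsqrt2 N S1 Q1 in
  let '(ok2, (I2, J2)) := tinvsqrt2 N S2 Q2 in
  let C1 := tmul N (tsub tone m) (tmul N I1 J1) in
  let C2 := tmul N m (tmul N I2 J2) in
  let C := tadd C1 C2 in
  let FX := tadd (tmul N C A) C2 in
  let FY := tmul N C ty in
  let th := texact (h :: nil) in
  let d1 := tbound (tsub (tmul N th (tadd tu ty)) (texact (pderiv X))) in
  let d2 := tbound (tsub (tmul N th (tsub tv tx)) (texact (pderiv Y))) in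
  let d3 := tbound (tsub (tmul N th (tsub tv FX)) (texact (pderiv U))) in
  let d4 := tbound (tsub (tmul N th (tsub (tscale (-1) tu) FY)) (texact (pderiv V))) in
  let d := 3 * (d1 + d2) + d3 + d4 in
  let v1 := tbound I1 in let v2 := tbound I2 in
  let w1 := v1 + rup (rup (v1 * v1) * R) in
  let w2 := v2 + rup (rup (v2 * v2) * R) in
  let G := 2 * rup ((fone - (mu - emu)) * cube w1 + (mu + emu) * cube w2) in
  let K := fone + Z.max (3 * fone) (G / 3 + 1) in
  let z := h * (9 * fone + G) / (48 * fone) + 1 in
  let g := fone + z + rup (z * z) in
  let g := rup (g * g) in let g := rup (g * g) in let g := rup (g * g) in
  if ok1 && ok2 && (hd 0 X =? x0) && (hd 0 Y =? y0) && (hd 0 U =? u0) && (hd 0 V =? v0)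
    && (0 <? h) && (0 <=? emu) && (0 <=? mu - emu) && (mu + emu <=? fone)
    && (0 <=? e0) && (v1 * R <=? fone * fone) && (v2 * R <=? fone * fone)
    && (w1 <=? 10 * fone) && (w2 <=? 10 * fone)
    && (h * K <? fone * fone) && (e0 + d + rup (rup (h * K) * R) <=? R)
    && (8 * z <=? 3 * fone) && (0 <=? R)
  then Some ((psum X, psum Y, psum U, psum V), rup ((e0 + d) * g),
     3 * (psize (tl X) + psize (tl Y)) + psize (tl U) + psize (tl V) + R)
  else None.

Definition step (n : nat) (mu emu R h : Z) (st : zstate) (e0 : Z)
  : option (zstate * Z * Z) :=
  let '(x0, y0, u0, v0) := st in
  let '(X, Y, U, V, Q1, Q2) :=
    taylor n 0 mu h (x0 :: nil) (y0 :: nil) (u0 :: nil) (v0 :: nil) (x0 - mu :: nil)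
      nil nil nil nil nil nil nil in
  verify (S n) mu emu R h st e0 X Y U V Q1 Q2.

Fixpoint run (n : nat) (mu emu R : Z) (hs : list Z) (st : zstate) (e0 : Z)
  : option (zstate * Z) :=
  match hs with
  | nil => Some (st, e0)
  | h :: hs =>
    match step n mu emu R h st e0 with
    | Some (st, e1, _) => run n mu emu R hs st e1
    | None => None
    end
  end.
Close Scope Z_scope.

(** * Correctness of the checker *)

Definition val (z : Z) : R := IZR z / IZR fone.
Definition real (st : zstate) : state :=
  let '(x, y, u, v) := st in (val x, val y, val u, val v).

Lemma val_le a b : (a <= b)%Z -> val a <= val b.
Proof.
  intros H. apply IZR_le in H. pose proof fone_pos. unfold val, Rdiv.
  apply Rmult_le_compat_r; [left; now apply Rinv_0_lt_compat|exact H].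
Qed.
Lemma val_lt a b : (a < b)%Z -> val a < val b.
Proof.
  intros H. apply IZR_lt in H. pose proof fone_pos. unfold val, Rdiv.
  apply Rmult_lt_compat_r; [now apply Rinv_0_lt_compat|exact H].
Qed.
Lemma val_add a b : val (a + b) = val a + val b.
Proof. unfold val. rewrite plus_IZR. pose proof fone_pos. field. lra. Qed.
Lemma val_sub a b : val (a - b) = val a - val b.
Proof. unfold val. rewrite minus_IZR. pose proof fone_pos. field. lra. Qed.
Lemma val_scale k a : val (k * a) = IZR k * val a.
Proof. unfold val. rewrite mult_IZR. pose proof fone_pos. field. lra. Qed.
Lemma val_0 : val 0 = 0.
Proof. unfold val. pose proof fone_pos. field. lra. Qed.
Lemma val_fone : val fone = 1.
Proof. unfold val. pose proof fone_pos. field. lra. Qed.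
Lemma val_mul a b : val a * val b = IZR (a * b) / (IZR fone * IZR fone).
Proof. unfold val. rewrite mult_IZR. pose proof fone_pos. field. lra. Qed.
Lemma val_mul_le a b c : (a * b <= c * fone)%Z -> val a * val b <= val c.
Proof.
  intros H. apply IZR_le in H. rewrite !mult_IZR in H. pose proof fone_pos. unfold val.
  apply Rmult_le_reg_r with (IZR fone * IZR fone); [nra|].
  replace (IZR a / IZR fone * (IZR b / IZR fone) * (IZR fone * IZR fone))
    with (IZR a * IZR b) by (field; lra).
  replace (IZR c / IZR fone * (IZR fone * IZR fone)) with (IZR c * IZR fone) by (field; lra).
  exact H.
Qed.
Lemma val_rup z : IZR z / (IZR fone * IZR fone) <= val (rup z).
Proof.
  pose proof (rup_spec z) as H. pose proof fone_pos. unfold val.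
  apply Rmult_le_reg_r with (IZR fone * IZR fone); [nra|].
  replace (IZR z / (IZR fone * IZR fone) * (IZR fone * IZR fone)) with (IZR z) by (field; lra).
  replace (IZR (rup z) / IZR fone * (IZR fone * IZR fone)) with (IZR fone * IZR (rup z))
    by (field; lra).
  exact H.
Qed.
Lemma val_mul_rup a b : val a * val b <= val (rup (a * b)).
Proof. rewrite val_mul. apply val_rup. Qed.

Lemma planar_triangle a b a' b' :
  sqrt (a ^ 2 + b ^ 2) <= sqrt (a' ^ 2 + b' ^ 2) + sqrt ((a - a') ^ 2 + (b - b') ^ 2).
Proof.
  assert (N : forall x y, sqrt (x ^ 2 + y ^ 2) = norm ((x, y, 0, 0) : state))
    by (intros; rewrite norm_state; f_equal; ring).
  rewrite !N.
  replace ((a, b, 0, 0) : state) with (plus ((a', b', 0, 0) : state) ((a - a', b - b', 0, 0) : state)).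
  - apply norm_state_triangle.
  - rewrite plus_state. apply state_ext; ring.
Qed.

Lemma planar_le_wnorm x y u v : sqrt (x ^ 2 + y ^ 2) <= wnorm (x, y, u, v) / 3.
Proof.
  rewrite wnorm_eq. apply Rmult_le_reg_l with 3; [lra|].
  replace (3 * (sqrt (9 * x ^ 2 + 9 * y ^ 2 + u ^ 2 + v ^ 2) / 3))
    with (sqrt (9 * x ^ 2 + 9 * y ^ 2 + u ^ 2 + v ^ 2)) by field.
  rewrite <- (sqrt_pow2 3) at 1 by lra. rewrite <- sqrt_mult_alt by nra.
  apply sqrt_le_1_alt. nra.
Qed.

Lemma r1_lipschitz mu z z' : r1 mu z' - wnorm (minus z z') / 3 <= r1 mu z.
Proof.
  destruct z as [[[x y] u] v], z' as [[[x' y'] u'] v']. rewrite minus_state.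
  pose proof (planar_le_wnorm (x - x') (y - y') (u - u') (v - v')) as H.
  pose proof (planar_triangle (x' - mu) y' (x - mu) y) as T. unfold r1.
  replace ((x' - mu - (x - mu)) ^ 2 + (y' - y) ^ 2) with ((x - x') ^ 2 + (y - y') ^ 2) in T
    by ring.
  lra.
Qed.

Lemma r2_lipschitz mu z z' : r2 mu z' - wnorm (minus z z') / 3 <= r2 mu z.
Proof.
  destruct z as [[[x y] u] v], z' as [[[x' y'] u'] v']. rewrite minus_state.
  pose proof (planar_le_wnorm (x - x') (y - y') (u - u') (v - v')) as H.
  pose proof (planar_triangle (x' - mu + 1) y' (x - mu + 1) y) as T. unfold r2.
  replace ((x' - mu + 1 - (x - mu + 1)) ^ 2 + (y' - y) ^ 2)
    with ((x - x') ^ 2 + (y - y') ^ 2) in T by ring.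
  lra.
Qed.

(** From a bound v of 1/r at the centre of a ball of radius R to a bound of 1/r on the ball; the
    weighted norm moves positions by at most R / 3. *)
Lemma inverse_radius_bound r r' v w R : 0 < r -> / r <= v -> 0 <= R -> v * R <= 1 ->
  v + v ^ 2 * R <= w -> r - R / 3 <= r' -> / w <= r'.
Proof.
  intros Hr Hv HR HvR Hw Hr'.
  assert (v0 : 0 < v) by (pose proof (Rinv_0_lt_compat r Hr); lra).
  assert (w0 : 0 < w) by nra.
  assert (V : / v <= r).
  { rewrite <- (Rinv_inv r). apply Rinv_le_contravar; [now apply Rinv_0_lt_compat|exact Hv]. }
  eapply Rle_trans; [|exact Hr'].
  apply Rle_trans with (/ v - R / 3); [|lra].
  apply Rmult_le_reg_l with (w * v); [nra|].
  replace (w * v * / w) with v by (field; lra).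
  replace (w * v * (/ v - R / 3)) with (w * (1 - v * R / 3)) by (field; lra).
  assert (x0 : 0 <= v * R) by nra.
  apply Rle_trans with ((v + v ^ 2 * R) * (1 - v * R / 3)).
  - replace ((v + v ^ 2 * R) * (1 - v * R / 3))
      with (v + v * (v * R * (2 - v * R) / 3)) by field.
    assert (0 <= v * R * (2 - v * R) / 3) by nra. nra.
  - apply Rmult_le_compat_r; lra.
Qed.

(** From 1 - x/2 <= exp (- x/2) and (1 + x + x^2) (1 - x/2)^2 >= 1. *)
Lemma exp_le_quadratic x : 0 <= x <= 3 / 8 -> exp x <= 1 + x + x ^ 2.
Proof.
  intros Hx.
  pose proof (exp_ineq1_le (- (x / 2))) as H.
  assert (E : exp x * (exp (- (x / 2)) * exp (- (x / 2))) = 1).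
  { rewrite <- !exp_plus. replace (x + (- (x / 2) + - (x / 2))) with 0 by field. apply exp_0. }
  pose proof (exp_pos x). set (y := exp (- (x / 2))) in *. clearbody y.
  assert (A : (1 - x / 2) * (1 - x / 2) <= y * y) by (apply Rmult_le_compat; lra).
  assert (B : exp x * ((1 - x / 2) * (1 - x / 2)) <= 1).
  { apply Rle_trans with (exp x * (y * y)); [apply Rmult_le_compat_l; lra|lra]. }
  assert (C : 1 <= (1 + x + x ^ 2) * ((1 - x / 2) * (1 - x / 2))).
  { replace ((1 + x + x ^ 2) * ((1 - x / 2) * (1 - x / 2)))
      with (1 + x ^ 2 / 4 * (1 - 3 * x + x ^ 2)) by field.
    assert (0 <= 1 - 3 * x + x ^ 2) by nra. nra. }
  apply Rmult_le_reg_r with ((1 - x / 2) * (1 - x / 2)); [nra|]. lra.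
Qed.

Lemma kepler_inverse x y : kepler x y =
  (x * (/ sqrt (x ^ 2 + y ^ 2) * (/ sqrt (x ^ 2 + y ^ 2) * / sqrt (x ^ 2 + y ^ 2))),
   y * (/ sqrt (x ^ 2 + y ^ 2) * (/ sqrt (x ^ 2 + y ^ 2) * / sqrt (x ^ 2 + y ^ 2)))).
Proof. unfold kepler. rewrite <- pow_inv. f_equal; ring. Qed.

Lemma peval_0 P : peval P 0 = IZR (hd 0%Z P).
Proof. destruct P as [|a P]; cbn [peval hd]; [reflexivity|ring]. Qed.

Lemma peval_1 P : peval P 1 = IZR (psum P).
Proof.
  induction P as [|a P IH]; [reflexivity|].
  change (psum (a :: P)) with (a + psum P)%Z. cbn [peval]. rewrite IH, plus_IZR. ring.
Qed.

Lemma peval_variation P t : 0 <= t <= 1 ->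
  Rabs (peval P t / IZR fone - val (hd 0%Z P)) <= val (psize (tl P)).
Proof.
  intros Ht. pose proof fone_pos as S0.
  destruct P as [|a P]; cbn [peval hd tl].
  - unfold val. replace (0 / IZR fone - 0 / IZR fone) with 0 by ring.
    rewrite Rabs_R0. simpl. unfold Rdiv. rewrite Rmult_0_l. lra.
  - unfold val. replace ((IZR a + t * peval P t) / IZR fone - IZR a / IZR fone)
      with (t * peval P t / IZR fone) by (field; lra).
    unfold Rdiv. rewrite Rabs_mult, (Rabs_pos_eq (/ _)) by (left; now apply Rinv_0_lt_compat).
    apply Rmult_le_compat_r; [left; now apply Rinv_0_lt_compat|].
    pose proof (peval_bound P t Ht). pose proof (Rabs_pos (peval P t)).
    rewrite Rabs_mult, (Rabs_pos_eq t) by lra. nra.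
Qed.

Lemma encl_const c m e : Rabs (IZR fone * c - IZR m) <= IZR e ->
  encl (fun _ => c) (m :: nil, e).
Proof.
  intros H t _. cbn [fst snd peval]. rewrite Rmult_0_r, Rplus_0_r. exact H.
Qed.

Lemma away_weaken rho1 rho2 rho1' rho2' mu z : rho1' <= rho1 -> rho2' <= rho2 ->
  away rho1 rho2 mu z -> away rho1' rho2' mu z.
Proof. intros H1 H2 [A B]. split; lra. Qed.

Lemma is_derive_rescale (z : R -> state) (h t : R) l : 0 < h ->
  is_derive z (t / h) (scal h l) -> is_derive (fun t => z (t / h)) t l.
Proof.
  intros Hh D.
  assert (E : is_derive (fun t : R => t / h) t (/ h)) by (auto_derive; [trivial|field; lra]).
  pose proof (is_derive_comp z (fun t => t / h) t _ _ D E) as C.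
  assert (X : scal (/ h) (scal h l) = l).
  { destruct l as [[[a b] c] d]. rewrite !scal_state. apply state_ext; field; lra. }
  rewrite <- X. exact C.
Qed.

Lemma val_cube w : 0 <= val w -> val w ^ 3 <= val (cube w).
Proof.
  intros H. unfold cube. eapply Rle_trans; [|apply val_mul_rup].
  replace (val w ^ 3) with (val w * val w * val w) by ring.
  apply Rmult_le_compat_r; [exact H|]. apply val_mul_rup.
Qed.

Lemma val_tbound f m t : encl f m -> 0 <= t <= 1 -> Rabs (f t) <= val (tbound m).
Proof. apply encl_bound. Qed.

(** Projections instead of [injection], which would normalise the large integers inside. *)
Lemma some_triple_inj {A B C : Type} (a a' : A) (b b' : B) (c c' : C) :
  Some (a, b, c) = Some (a', b', c') -> a = a' /\ b = b' /\ c = c'.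
Proof. intros H. injection H. auto. Qed.

Definition pcurve (X Y U V : list Z) (t : R) : state :=
  (peval X t / IZR fone, peval Y t / IZR fone, peval U t / IZR fone, peval V t / IZR fone).

Lemma is_derive_pcurve X Y U V t :
  is_derive (pcurve X Y U V) t (pcurve (pderiv X) (pderiv Y) (pderiv U) (pderiv V) t).
Proof.
  assert (D : forall P, is_derive (fun t => peval P t / IZR fone) t
    (peval (pderiv P) t / IZR fone)).
  { intros P. unfold Rdiv. eapply is_derive_ext; [intros r; apply Rmult_comm|].
    rewrite Rmult_comm. apply is_derive_scal, is_derive_peval. }
  apply is_derive_state; apply D.
Qed.

Lemma continuous_pcurve X Y U V t : continuous (pcurve X Y U V) t.
Proof.
  exact (continuous_of_derive _ _ _ (is_derive_pcurve X Y U V t)).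
Qed.

Theorem verify_sound N mu m emu rad h st e0 X Y U V Q1 Q2 st' e1 var z0 :
  verify N m emu rad h st e0 X Y U V Q1 Q2 = Some (st', e1, var) ->
  Rabs (IZR fone * mu - IZR m) <= IZR emu ->
  wnorm (minus z0 (real st)) <= val e0 ->
  0 < val h /\
  exists y : R -> state, y 0 = z0 /\
    (forall t, 0 <= t <= val h -> away (1 / 10) (1 / 10) mu (y t) /\
       is_derive y t (field mu (y t)) /\ wnorm (minus (y t) (real st)) <= val var) /\
    wnorm (minus (y (val h)) (real st')) <= val e1.
Proof.
  intros HV Hmu Hz0. destruct st as [[[x0 y0] u0] v0]. unfold verify in HV. cbv zeta in HV.
  pose proof fone_pos as S0.
  set (fx := fun t => peval X t / IZR fone). set (fy := fun t => peval Y t / IZR fone).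
  set (fu := fun t => peval U t / IZR fone). set (fv := fun t => peval V t / IZR fone).
  set (p := fun t => (fx t, fy t, fu t, fv t) : state).
  set (dp := fun t => (peval (pderiv X) t / IZR fone, peval (pderiv Y) t / IZR fone,
    peval (pderiv U) t / IZR fone, peval (pderiv V) t / IZR fone) : state).
  pose proof (encl_exact X) as EX. pose proof (encl_exact Y) as EY.
  pose proof (encl_exact U) as EU. pose proof (encl_exact V) as EV.
  fold fx in EX. fold fy in EY. fold fu in EU. fold fv in EV.
  pose proof (encl_const mu m emu Hmu) as EM.
  pose proof (encl_sub _ _ _ _ EX EM) as EA.
  pose proof (encl_add _ _ _ _ (encl_square N _ _ EA) (encl_square N _ _ EY)) as ES1.
  pose proof (encl_add _ _ _ _ ES1 (encl_add _ _ _ _ (encl_scale 2 _ _ EA) encl_one)) as ES2.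
  match type of ES1 with encl _ ?a => set (S1 := a) in * end.
  match type of ES2 with encl _ ?a => set (S2 := a) in * end.
  apply (encl_ext _ (fun t => (fx t - mu) ^ 2 + fy t ^ 2)) in ES1; [|intros; ring].
  apply (encl_ext _ (fun t => (fx t - mu + 1) ^ 2 + fy t ^ 2)) in ES2; [|intros; ring].
  pose proof (encl_invsqrt2 N _ _ Q1 ES1) as I1. pose proof (encl_invsqrt2 N _ _ Q2 ES2) as I2.
  destruct (tinvsqrt2 N S1 Q1) as [ok1 [J1 K1]]. destruct (tinvsqrt2 N S2 Q2) as [ok2 [J2 K2]].
  cbn [fst snd] in I1, I2.
  match type of HV with (if ?c then _ else _) = _ => destruct c eqn:C; [|discriminate] end.
  apply andb_prop in C; destruct C as [C B19]. apply andb_prop in C; destruct C as [C B18]. apply andb_prop in C; destruct C as [C B17].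
  apply andb_prop in C; destruct C as [C B16]. apply andb_prop in C; destruct C as [C B15].
  apply andb_prop in C; destruct C as [C B14]. apply andb_prop in C; destruct C as [C B13].
  apply andb_prop in C; destruct C as [C B12]. apply andb_prop in C; destruct C as [C B11].
  apply andb_prop in C; destruct C as [C B10]. apply andb_prop in C; destruct C as [C B9].
  apply andb_prop in C; destruct C as [C B8]. apply andb_prop in C; destruct C as [C B7].
  apply andb_prop in C; destruct C as [C B6]. apply andb_prop in C; destruct C as [C B5].
  apply andb_prop in C; destruct C as [C B4]. apply andb_prop in C; destruct C as [C B3].
  apply andb_prop in C; destruct C as [B1 B2].
  destruct (I1 B1) as [F1 [EI1 EK1]]. destruct (I2 B2) as [F2 [EI2 EK2]]. clear I1 I2 B1 B2.
  apply Z.eqb_eq in B3, B4, B5, B6.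
  apply Z.ltb_lt in B7, B16. apply Z.leb_le in B8, B9, B10, B11, B12, B13, B14, B15, B17, B18, B19.
  (* enclosures of the force and of the defects *)
  pose proof (encl_mul N _ _ _ _ (encl_sub _ _ _ _ encl_one EM)
    (encl_mul N _ _ _ _ EI1 EK1)) as EC1.
  pose proof (encl_mul N _ _ _ _ EM
    (encl_mul N _ _ _ _ EI2 EK2)) as EC2.
  pose proof (encl_add _ _ _ _ EC1 EC2) as EC.
  pose proof (encl_add _ _ _ _ (encl_mul N _ _ _ _ EC EA) EC2) as EFX.
  pose proof (encl_mul N _ _ _ _ EC EY) as EFY.
  match type of EC1 with encl _ ?a => set (C1 := a) in * end.
  match type of EC2 with encl _ ?a => set (C2 := a) in * end.
  match type of EC with encl _ ?a => set (CC := a) in * end.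
  match type of EFX with encl _ ?a => set (FX := a) in * end.
  match type of EFY with encl _ ?a => set (FY := a) in * end.
  apply (encl_ext _ (fun t => fst (force mu (fx t) (fy t)))) in EFX.
  2: { intros t _. unfold force. cbn [fst]. rewrite !kepler_inverse. cbn [fst]. ring. }
  apply (encl_ext _ (fun t => snd (force mu (fx t) (fy t)))) in EFY.
  2: { intros t _. unfold force. cbn [snd]. rewrite !kepler_inverse. cbn [snd]. ring. }
  pose proof (encl_exact (h :: nil)) as Eh.
  apply (encl_ext _ (fun _ => val h)) in Eh.
  2: { intros t _. unfold val. cbn [peval]. now rewrite Rmult_0_r, Rplus_0_r. }
  pose proof (encl_sub _ _ _ _ (encl_mul N _ _ _ _ Eh (encl_add _ _ _ _ EU EY))
    (encl_exact (pderiv X))) as ED1.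
  pose proof (encl_sub _ _ _ _ (encl_mul N _ _ _ _ Eh (encl_sub _ _ _ _ EV EX))
    (encl_exact (pderiv Y))) as ED2.
  pose proof (encl_sub _ _ _ _ (encl_mul N _ _ _ _ Eh (encl_sub _ _ _ _ EV EFX))
    (encl_exact (pderiv U))) as ED3.
  pose proof (encl_sub _ _ _ _ (encl_mul N _ _ _ _ Eh
    (encl_sub _ _ _ _ (encl_scale (-1) _ _ EU) EFY)) (encl_exact (pderiv V))) as ED4.
  match type of ED1 with encl _ ?a => set (D1 := tbound a) in * end.
  match type of ED2 with encl _ ?a => set (D2 := tbound a) in * end.
  match type of ED3 with encl _ ?a => set (D3 := tbound a) in * end.
  match type of ED4 with encl _ ?a => set (D4 := tbound a) in * end.
  set (d := (3 * (D1 + D2) + D3 + D4)%Z) in *.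
  pose proof (val_tbound _ _ 0 ED1 ltac:(lra)) as T1.
  assert (BD1 := fun t => val_tbound _ _ t ED1). assert (BD2 := fun t => val_tbound _ _ t ED2).
  assert (BD3 := fun t => val_tbound _ _ t ED3). assert (BD4 := fun t => val_tbound _ _ t ED4).
  cbv beta in BD1, BD2, BD3, BD4. fold D1 in BD1. fold D2 in BD2. fold D3 in BD3. fold D4 in BD4.
  assert (BV1 := fun t => val_tbound _ _ t EI1). assert (BV2 := fun t => val_tbound _ _ t EI2).
  cbv beta in BV1, BV2.
  set (v1 := tbound J1) in *. set (v2 := tbound J2) in *.
  clearbody v1 v2 D1 D2 D3 D4. clear T1 ED1 ED2 ED3 ED4 Eh EFX EFY EI1 EI2.
  set (w1 := (v1 + rup (rup (v1 * v1) * rad))%Z) in *.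
  set (w2 := (v2 + rup (rup (v2 * v2) * rad))%Z) in *.
  set (G := (2 * rup ((fone - (m - emu)) * cube w1 + (m + emu) * cube w2))%Z) in *.
  set (K := (fone + Z.max (3 * fone) (G / 3 + 1))%Z) in *.
  set (z := (h * (9 * fone + G) / (48 * fone) + 1)%Z) in *.
  set (g := (fone + z + rup (z * z))%Z) in *.
  destruct (some_triple_inj _ _ _ _ _ _ HV) as [HV1 [HV2 HV3]]. clear HV.
  (* real versions of the integer checks *)
  assert (h0 : 0 < val h) by (rewrite <- val_0; apply val_lt, B7).
  assert (Rmu : Rabs (mu - val m) <= val emu).
  { unfold val. apply Rmult_le_reg_l with (IZR fone); [exact S0|].
    replace (IZR fone * (IZR emu / IZR fone)) with (IZR emu) by (field; lra).
    rewrite <- (Rabs_pos_eq (IZR fone)) at 1 by lra. rewrite <- Rabs_mult.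
    replace (IZR fone * (mu - IZR m / IZR fone)) with (IZR fone * mu - IZR m) by (field; lra).
    exact Hmu. }
  apply Rabs_le_between in Rmu.
  apply val_le in B9. rewrite val_0, val_sub in B9.
  apply val_le in B10. rewrite val_fone, val_add in B10.
  assert (mu01 : 0 <= mu <= 1) by lra.
  assert (He0 : 0 <= val e0) by (rewrite <- val_0; apply val_le, B11).
  assert (v1p : 0 < val v1).
  { specialize (BV1 0 ltac:(lra)). specialize (F1 0 ltac:(lra)).
    pose proof (Rinv_0_lt_compat _ (sqrt_lt_R0 _ F1)). rewrite Rabs_pos_eq in BV1; lra. }
  assert (v2p : 0 < val v2).
  { specialize (BV2 0 ltac:(lra)). specialize (F2 0 ltac:(lra)).
    pose proof (Rinv_0_lt_compat _ (sqrt_lt_R0 _ F2)). rewrite Rabs_pos_eq in BV2; lra. }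
  assert (Vd : val d = 3 * (val D1 + val D2) + val D3 + val D4)
    by (unfold d; rewrite !val_add, val_scale, val_add; reflexivity).
  assert (d0 : 0 <= val d).
  { pose proof (Rle_trans _ _ _ (Rabs_pos _) (BD1 0 ltac:(lra))).
    pose proof (Rle_trans _ _ _ (Rabs_pos _) (BD2 0 ltac:(lra))).
    pose proof (Rle_trans _ _ _ (Rabs_pos _) (BD3 0 ltac:(lra))).
    pose proof (Rle_trans _ _ _ (Rabs_pos _) (BD4 0 ltac:(lra))). lra. }
  clearbody d.
  assert (hK : val h * val K < 1).
  { rewrite val_mul. apply IZR_lt in B16. rewrite (mult_IZR fone fone) in B16.
    apply Rmult_lt_reg_r with (IZR fone * IZR fone); [nra|].
    unfold Rdiv. rewrite Rmult_assoc, Rinv_l, Rmult_1_l, Rmult_1_r by nra. exact B16. }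
  assert (K4 : 4 <= val K).
  { unfold K. rewrite val_add, val_fone.
    assert (3 * 1 <= val (Z.max (3 * fone) (G / 3 + 1))).
    { rewrite <- val_fone. change 3 with (IZR 3). rewrite <- val_scale. apply val_le, Z.le_max_l. }
    lra. }
  assert (KG : 1 + val G / 3 <= val K).
  { unfold K. rewrite val_add, val_fone.
    assert (val G <= 3 * val (Z.max (3 * fone) (G / 3 + 1))).
    { change 3 with (IZR 3) at 1. rewrite <- val_scale. apply val_le.
      pose proof (Z.le_max_r (3 * fone) (G / 3 + 1)).
      pose proof (Z.div_mod G 3 ltac:(discriminate)).
      pose proof (Z.mod_pos_bound G 3 ltac:(reflexivity)). lia. }
    lra. }
  assert (Room0 : val e0 + val d + val (rup (rup (h * K) * rad)) <= val rad)
    by (rewrite <- !val_add; apply val_le, B17).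
  assert (hKr : val h * val K <= val (rup (h * K))) by apply val_mul_rup.
  assert (Rrad : val (rup (h * K)) * val rad <= val (rup (rup (h * K) * rad))) by apply val_mul_rup.
  assert (rad0 : 0 <= val rad) by (rewrite <- val_0; apply val_le, B19).
  assert (Room : val e0 + val d + val h * val K * val rad <= val rad).
  { assert (val h * val K * val rad <= val (rup (h * K)) * val rad)
      by (apply Rmult_le_compat_r; assumption). lra. }
  assert (W1 : val v1 + val v1 ^ 2 * val rad <= val w1).
  { unfold w1. rewrite val_add. apply Rplus_le_compat_l.
    eapply Rle_trans; [|apply val_mul_rup]. apply Rmult_le_compat_r; [exact rad0|].
    replace (val v1 ^ 2) with (val v1 * val v1) by ring. apply val_mul_rup. }
  assert (W2 : val v2 + val v2 ^ 2 * val rad <= val w2).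
  { unfold w2. rewrite val_add. apply Rplus_le_compat_l.
    eapply Rle_trans; [|apply val_mul_rup]. apply Rmult_le_compat_r; [exact rad0|].
    replace (val v2 ^ 2) with (val v2 * val v2) by ring. apply val_mul_rup. }
  assert (w1p : 0 < val w1) by nra. assert (w2p : 0 < val w2) by nra.
  assert (vR1 : val v1 * val rad <= 1).
  { rewrite <- val_fone. apply val_mul_le, B12. }
  assert (vR2 : val v2 * val rad <= 1).
  { rewrite <- val_fone. apply val_mul_le, B13. }
  apply val_le in B14. apply val_le in B15. rewrite val_scale, val_fone in B14, B15.
  assert (HG : 2 * ((1 - mu) / (/ val w1) ^ 3 + mu / (/ val w2) ^ 3) <= val G).
  { unfold Rdiv. rewrite !pow_inv, !Rinv_inv. unfold G. rewrite val_scale.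
    apply Rmult_le_compat_l; [lra|]. eapply Rle_trans; [|apply val_rup].
    rewrite plus_IZR, Rdiv_plus_distr, <- !val_mul.
    rewrite !val_sub, val_add, val_fone.
    apply Rplus_le_compat; apply Rmult_le_compat; try lra;
      try (apply pow_le; lra); apply val_cube; lra. }
  assert (G0 : 0 <= val G).
  { eapply Rle_trans; [|exact HG]. rewrite !Rdiv_def, !pow_inv, !Rinv_inv.
    pose proof (pow_le (val w1) 3 ltac:(lra)). pose proof (pow_le (val w2) 3 ltac:(lra)).
    nra. }
  clearbody w1 w2.
  assert (Zb : val h * ((9 + val G) / 6) <= 8 * val z).
  { assert (A : (h * (9 * fone + G) <= 48 * fone * z)%Z).
    { unfold z. pose proof (Z.div_mod (h * (9 * fone + G)) (48 * fone) ltac:(discriminate)).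
      pose proof (Z.mod_pos_bound (h * (9 * fone + G)) (48 * fone) ltac:(reflexivity)). lia. }
    assert (B : (h * (9 * fone + G) <= 48 * z * fone)%Z) by lia.
    apply val_mul_le in B. rewrite val_add, !val_scale, val_fone in B. lra. }
  clearbody K z. clearbody G.
  apply val_le in B18. rewrite !val_scale, val_fone in B18.
  assert (z0p : 0 <= val z) by nra.
  assert (Eg : exp (val z) <= val g).
  { unfold g. rewrite !val_add, val_fone.
    eapply Rle_trans; [apply exp_le_quadratic; lra|].
    pose proof (val_mul_rup z z). replace (val z ^ 2) with (val z * val z) by ring. lra. }
  clearbody g.
  assert (Sq : forall a w, exp a <= val w -> exp (2 * a) <= val (rup (w * w))).
  { intros a w H. replace (2 * a) with (a + a) by ring. rewrite exp_plus.
    eapply Rle_trans; [|apply val_mul_rup]. pose proof (exp_pos a).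
    apply Rmult_le_compat; lra. }
  pose proof (Sq _ _ (Sq _ _ (Sq _ _ Eg))) as E8. clear Sq Eg.
  set (g8 := rup (rup (rup (g * g) * rup (g * g)) * rup (rup (g * g) * rup (g * g)))) in *.
  clearbody g8.
  assert (Eh : exp (val h * ((9 + val G) / 6)) <= val g8).
  { eapply Rle_trans; [|exact E8]. apply exp_le_mono. lra. }
  assert (Tube : forall t w, 0 <= t <= 1 -> wnorm (minus w (p t)) <= val rad ->
    away (/ val w1) (/ val w2) mu w).
  { intros t w Ht Hw. split.
    - apply (inverse_radius_bound (r1 mu (p t)) (r1 mu w) (val v1) (val w1) (val rad)); auto.
      + apply sqrt_lt_R0, F1, Ht.
      + specialize (BV1 t Ht). eapply Rle_trans; [apply Rle_abs|exact BV1].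
      + pose proof (r1_lipschitz mu w (p t)). lra.
    - apply (inverse_radius_bound (r2 mu (p t)) (r2 mu w) (val v2) (val w2) (val rad)); auto.
      + apply sqrt_lt_R0, F2, Ht.
      + specialize (BV2 t Ht). eapply Rle_trans; [apply Rle_abs|exact BV2].
      + pose proof (r2_lipschitz mu w (p t)). lra. }
  assert (Def : forall t, 0 <= t <= 1 ->
    wnorm (minus (scal (val h) (field mu (p t))) (dp t)) <= val d).
  { intros t Ht. unfold p, dp. cbn [field]. rewrite scal_state, minus_state.
    eapply Rle_trans; [apply wnorm_le_coords|]. rewrite Vd.
    specialize (BD1 t Ht). specialize (BD2 t Ht). specialize (BD3 t Ht). specialize (BD4 t Ht).
    replace (-1 * fu t) with (- fu t) in BD4 by ring. lra. }
  assert (Dp : forall t, is_derive p t (dp t)).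
  { intros t. exact (is_derive_pcurve X Y U V t). }
  assert (Cdp : forall t, continuous dp t).
  { intros t. exact (continuous_pcurve (pderiv X) (pderiv Y) (pderiv U) (pderiv V) t). }
  assert (P0 : p 0 = real (x0, y0, u0, v0)).
  { unfold p, real, fx, fy, fu, fv. rewrite !peval_0, B3, B4, B5, B6. reflexivity. }
  assert (Q1p : p 1 = real st').
  { rewrite <- HV1. unfold p, real, fx, fy, fu, fv. rewrite !peval_1. reflexivity. }
  rewrite <- P0 in Hz0.
  destruct (step_exists (/ val w1) (/ val w2) mu (val G) (val K) (val h) (val rad) (val d)
    (val e0) p dp z0) as [y [Y0 [Hy Y1]]]; auto.
  { now apply Rinv_0_lt_compat. } { now apply Rinv_0_lt_compat. }
  split; [exact h0|]. exists (fun t => y (t / val h)).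
  split; [|split].
  - replace (0 / val h) with 0 by (unfold Rdiv; ring). exact Y0.
  - intros t Ht.
    assert (Ht' : 0 <= t / val h <= 1).
    { split; [apply Rmult_le_pos; [lra|left; now apply Rinv_0_lt_compat]|].
      apply Rmult_le_reg_r with (val h); [exact h0|].
      unfold Rdiv. rewrite Rmult_assoc, Rinv_l by lra. lra. }
    destruct (Hy _ Ht') as [D [A B]]. split; [|split].
    + apply (away_weaken (/ val w1) (/ val w2)); [| |exact A];
      (replace (1 / 10) with (/ 10) by field; apply Rinv_le_contravar; lra).
    + apply is_derive_rescale; assumption.
    + rewrite <- HV3, <- P0.
      eapply Rle_trans; [apply (wnorm_minus_triangle _ (p (t / val h)))|].
      rewrite !val_add, val_scale, val_add.
      assert (Hvar : wnorm (minus (p (t / val h)) (p 0)) <=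
        3 * (val (psize (tl X)) + val (psize (tl Y))) + val (psize (tl U)) + val (psize (tl V))).
      { rewrite P0. unfold p, real. rewrite minus_state.
        eapply Rle_trans; [apply wnorm_le_coords|]. rewrite <- B3, <- B4, <- B5, <- B6.
        pose proof (peval_variation X _ Ht'). pose proof (peval_variation Y _ Ht').
        pose proof (peval_variation U _ Ht'). pose proof (peval_variation V _ Ht').
        unfold fx, fy, fu, fv. lra. }
      lra.
  - replace (val h / val h) with 1 by (field; lra). rewrite <- Q1p.
    eapply Rle_trans; [exact Y1|]. rewrite <- HV2.
    eapply Rle_trans; [|apply val_mul_rup]. rewrite val_add, Rmult_comm.
    apply Rmult_le_compat_l; lra.
Qed.

(** * The checker of the local unstable manifold *)

Local Open Scope Z_scope.

(** Power series of 1/sqrt by its recurrence, as a guess for [tinvsqrt]. *)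
Fixpoint invsqrt_series (n : nat) (k : Z) (used rest V : list Z) : list Z :=
  match n with
  | O => rev V
  | S n =>
    let used := hd 0 rest :: used in
    let v := if k =? 0 then Z.sqrt (fone * fone * fone / hd 0 rest)
      else wdotZ (- k) (-1) used (rev V) / (2 * k * last used 0) in
    invsqrt_series n (k + 1) used (tl rest) (v :: V)
  end.

Definition tisqrt (n : nat) (f : tm) : bool * tm :=
  tinvsqrt n f (invsqrt_series n 0 nil (fst f) nil).
Definition tinv (n : nat) (f : tm) : bool * tm := tisqrt n (tmul n f f).

Definition thalf : tm := texact (fone / 2 :: nil).

(** c is the constant of the linearised equations x'' - 2 y' = (1 + 2 c) x, y'' + 2 x' = (1 - c) y;
    lam is the positive eigenvalue and (1, eta) the position part of its eigenvector. *)
Record params := Params {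
  p_mu : tm; p_a : tm; p_ia : tm; p_ig : tm; p_c : tm; p_lam : tm; p_eta : tm }.

(** All parameters as functions of t when g is given as a function of t. Intervals instead of
    polynomials would lose the cancellations between the terms of c, and with them a factor of
    10^4 in the width. *)
Definition param_models (n : nat) (g : tm) : bool * params :=
  let mul := tmul n in
  let a := tsub tone g in
  let (ok1, ia) := tinv n a in
  let (ok2, ig) := tinv n g in
  let ia2 := mul ia ia in
  let ig2 := mul ig ig in
  let (ok3, iD) := tinv n (tsub (tadd ia2 ig2) tone) in
  let mu := mul (tsub ia2 a) iD in
  let c := tadd (mul (tsub tone mu) (mul ia2 ia)) (mul mu (mul ig2 ig)) in
  let disc := tsub (tscale 9 (mul c c)) (tscale 8 c) in
  let (ok4, is) := tisqrt n disc in
  let l2 := mul thalf (tadd (tsub c (tscale 2 tone)) (mul disc is)) in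
  let (ok5, il) := tisqrt n l2 in
  (ok1 && ok2 && ok3 && ok4 && ok5,
   Params mu a ia ig c (mul l2 il)
     (mul thalf (mul (tsub (tsub l2 tone) (tscale 2 c)) il))).

(** An interval that contains all values of the function. *)
Definition collapse (m : tm) : tm :=
  match fst m with
  | c0 :: c1 :: P => (c0 + c1 / 2 :: nil, Z.abs c1 / 2 + 1 + psize P + snd m)
  | _ => m
  end.

Definition interval_params (g : tm) : bool * params :=
  let (ok, P) := param_models 3 g in
  (ok, Params (collapse (p_mu P)) (collapse (p_a P)) (collapse (p_ia P)) (collapse (p_ig P))
     (collapse (p_c P)) (collapse (p_lam P)) (collapse (p_eta P))).

(** What remains of the attraction of a primary at (b, 0), times |b|^3, after its linear part at the
    origin has been removed, divided by s^2, at the point (s X, s Y). *)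
Definition primary_models (n : nat) (b ib X Y QQ : tm) : bool * (tm * tm) :=
  let mul := tmul n in
  let U := tadd (tscale (-2) (mul X ib)) (tX (mul QQ (mul ib ib))) in
  let u := tX U in
  let (ok1, V) := tisqrt n (tadd tone u) in
  let V2 := mul V V in
  let H := tadd tone V in
  let (ok2, iH) := tinv n H in
  let K := mul thalf (mul (mul V2 (mul iH iH))
    (tadd (tadd (tscale 2 (mul V2 V)) (tscale 4 V2)) (tadd (tscale 6 V) (tscale 3 tone)))) in
  let W := mul U (tsub (mul u K) (mul thalf (tscale 3 tone))) in
  (ok1 && ok2,
   (tsub (tadd (mul thalf (tscale 3 (mul QQ ib))) (mul X W)) (mul b (mul (mul U U) K)),
    mul Y W)).

(** The residual of [manifold_curve], divided by s^2: the orders 0 and 1 in s cancel identically, by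
    the equations of the libration point and of the eigenvector, and only the rest is computed. *)
Definition local_defect (n : nat) (P : params) (g : tm) (amp : Z) (X Y U V : list Z)
  : bool * Z :=
  let mul := tmul n in
  let '(Params mu a ia ig c lam eta) := P in
  let A := texact (amp :: nil) in
  let tx := texact X in let ty := texact Y in
  let tu := texact U in let tv := texact V in
  let X1 := tadd A (tX tx) in
  let Y1 := tadd (mul A eta) (tX ty) in
  let QQ := tadd (mul X1 X1) (mul Y1 Y1) in
  let (ok1, M1) := primary_models n a ia X1 Y1 QQ in
  let (ok2, M2) := primary_models n (tscale (-1) g) (tscale (-1) ig) X1 Y1 QQ in
  let m1 := mul (tsub tone mu) (mul ia (mul ia ia)) in
  let m2 := mul mu (mul ig (mul ig ig)) in
  let NX := tadd (mul m1 (fst M1)) (mul m2 (fst M2)) in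
  let NY := tadd (mul m1 (snd M1)) (mul m2 (snd M2)) in
  let euler := fun P => mul lam (texact (pderiv_aux 2 P)) in
  let d1 := tbound (tsub (tadd tu ty) (euler X)) in
  let d2 := tbound (tsub (tsub tv tx) (euler Y)) in
  let d3 := tbound (tsub (tsub (tadd tv (mul (tscale 2 c) tx)) NX) (euler U)) in
  let d4 := tbound (tsub (tsub (tsub (tscale (-1) tu) (mul c ty)) NY) (euler V)) in
  (ok1 && ok2, 3 * (d1 + d2) + d3 + d4).
Close Scope Z_scope.

(** * Parameters and local residual: correctness *)

(** The mass that balances the forces at distance g from the small and 1 - g from the large
    primary. *)
Definition mu_of (g : R) : R :=
  (/ (1 - g) * / (1 - g) - (1 - g)) * / (/ (1 - g) * / (1 - g) + / g * / g - 1).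
Definition c_of (g : R) : R :=
  (1 - mu_of g) * (/ (1 - g) * / (1 - g) * / (1 - g)) + mu_of g * (/ g * / g * / g).
Definition disc_of (g : R) : R := 9 * (c_of g * c_of g) - 8 * c_of g.
(** Positive root of L^2 + (2 - c) L + 1 + c - 2 c^2, the characteristic polynomial of the libration
    point in L = lam^2. *)
Definition lam2_of (g : R) : R := (c_of g - 2 + sqrt (disc_of g)) / 2.
Definition lam_of (g : R) : R := sqrt (lam2_of g).
Definition eta_of (g : R) : R := (lam2_of g - 1 - 2 * c_of g) / (2 * lam_of g).
Definition x_of (g : R) : R := mu_of g - (1 - g).

Lemma half_exact : encl (fun _ => 1 / 2) thalf.
Proof.
  unfold thalf. apply (encl_ext (fun t => peval (fone / 2 :: nil)%Z t / IZR fone)).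
  - intros t _. cbn [peval]. rewrite Rmult_0_r, Rplus_0_r.
    assert (H : IZR fone = 2 * IZR (fone / 2)) by (rewrite <- mult_IZR; reflexivity).
    pose proof fone_pos. rewrite H. field. lra.
  - apply encl_exact.
Qed.

Lemma encl_isqrt n f m : encl f m -> fst (tisqrt n m) = true ->
  (forall t, 0 <= t <= 1 -> 0 < f t) /\ encl (fun t => / sqrt (f t)) (snd (tisqrt n m)).
Proof. apply encl_invsqrt. Qed.

Lemma encl_inv n f m : encl f m -> (forall t, 0 <= t <= 1 -> 0 < f t) ->
  fst (tinv n m) = true -> encl (fun t => / f t) (snd (tinv n m)).
Proof.
  intros A P H. destruct (encl_isqrt n (fun t => f t * f t) _ (encl_mul n _ _ _ _ A A) H) as [_ B].
  refine (encl_ext _ _ _ _ B). intros t Ht. cbv beta.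
  rewrite sqrt_square; [reflexivity|]. left. now apply P.
Qed.

Definition encl_params (P : params) (g : R -> R) : Prop :=
  encl (fun t => mu_of (g t)) (p_mu P) /\ encl (fun t => 1 - g t) (p_a P) /\
  encl (fun t => / (1 - g t)) (p_ia P) /\ encl (fun t => / g t) (p_ig P) /\
  encl (fun t => c_of (g t)) (p_c P) /\ encl (fun t => lam_of (g t)) (p_lam P) /\
  encl (fun t => eta_of (g t)) (p_eta P).

Lemma param_models_sound n (g : R -> R) m : (forall t, 0 <= t <= 1 -> 0 < g t < 1) ->
  encl g m -> fst (param_models n m) = true ->
  encl_params (snd (param_models n m)) g /\
  forall t, 0 <= t <= 1 -> 0 < disc_of (g t) /\ 0 < lam2_of (g t).
Proof.
  intros Hg Eg. unfold param_models.
  pose proof (encl_sub _ _ _ _ encl_one Eg) as Ea.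
  pose proof (encl_inv n _ _ Ea) as Eia. pose proof (encl_inv n _ _ Eg) as Eig.
  destruct (tinv n (tsub tone m)) as [ok1 ia]. destruct (tinv n m) as [ok2 ig].
  cbn [fst snd] in Eia, Eig.
  pose proof (encl_inv n (fun t => / (1 - g t) * / (1 - g t) + / g t * / g t - 1)
    (tsub (tadd (tmul n ia ia) (tmul n ig ig)) tone)) as ED.
  destruct (tinv n (tsub (tadd (tmul n ia ia) (tmul n ig ig)) tone)) as [ok3 iD].
  cbn [fst snd] in ED.
  set (mu := tmul n (tsub (tmul n ia ia) (tsub tone m)) iD).
  set (c := tadd (tmul n (tsub tone mu) (tmul n (tmul n ia ia) ia))
    (tmul n mu (tmul n (tmul n ig ig) ig))).
  pose proof (encl_isqrt n (fun t => disc_of (g t)) (tsub (tscale 9 (tmul n c c)) (tscale 8 c)))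
    as Es.
  destruct (tisqrt n (tsub (tscale 9 (tmul n c c)) (tscale 8 c))) as [ok4 is].
  cbn [fst snd] in Es.
  set (l2 := tmul n thalf (tadd (tsub c (tscale 2 tone))
    (tmul n (tsub (tscale 9 (tmul n c c)) (tscale 8 c)) is))).
  pose proof (encl_isqrt n (fun t => lam2_of (g t)) l2) as El.
  fold l2. fold c mu.
  destruct (tisqrt n l2) as [ok5 il]. cbn [fst snd] in El |- *.
  intros H. apply andb_prop in H. destruct H as [H H5].
  apply andb_prop in H. destruct H as [H H4]. apply andb_prop in H. destruct H as [H H3].
  apply andb_prop in H. destruct H as [H1 H2].
  specialize (Eia ltac:(intros t Ht; specialize (Hg t Ht); lra) H1).
  specialize (Eig ltac:(intros t Ht; specialize (Hg t Ht); lra) H2).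
  assert (D0 : forall t, 0 <= t <= 1 -> 0 < / (1 - g t) * / (1 - g t) + / g t * / g t - 1).
  { intros t Ht. specialize (Hg t Ht).
    assert (1 < / (1 - g t)) by (rewrite <- Rinv_1; apply Rinv_lt_contravar; lra).
    assert (0 < / g t) by (apply Rinv_0_lt_compat; lra). nra. }
  specialize (ED (encl_sub _ _ _ _ (encl_add _ _ _ _ (encl_mul n _ _ _ _ Eia Eia)
    (encl_mul n _ _ _ _ Eig Eig)) encl_one) D0 H3).
  assert (Emu : encl (fun t => mu_of (g t)) mu).
  { exact (encl_mul n _ _ _ _ (encl_sub _ _ _ _ (encl_mul n _ _ _ _ Eia Eia) Ea) ED). }
  assert (Ec : encl (fun t => c_of (g t)) c).
  { exact (encl_add _ _ _ _ (encl_mul n _ _ _ _ (encl_sub _ _ _ _ encl_one Emu)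
     (encl_mul n _ _ _ _ (encl_mul n _ _ _ _ Eia Eia) Eia))
     (encl_mul n _ _ _ _ Emu (encl_mul n _ _ _ _ (encl_mul n _ _ _ _ Eig Eig) Eig))). }
  pose proof (encl_sub _ _ _ _ (encl_scale 9 _ _ (encl_mul n _ _ _ _ Ec Ec))
    (encl_scale 8 _ _ Ec)) as Edisc.
  destruct (Es Edisc H4) as [disc0 Eis].
  assert (El2 : encl (fun t => lam2_of (g t)) l2).
  { refine (encl_ext _ _ _ _ (encl_mul n _ _ _ _ half_exact (encl_add _ _ _ _
      (encl_sub _ _ _ _ Ec (encl_scale 2 _ _ encl_one)) (encl_mul n _ _ _ _ Edisc Eis)))).
    intros t Ht. unfold lam2_of. specialize (disc0 t Ht).
    assert (Q : disc_of (g t) * / sqrt (disc_of (g t)) = sqrt (disc_of (g t))).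
    { rewrite <- (sqrt_sqrt (disc_of (g t))) at 1 by lra.
      field. apply Rgt_not_eq, sqrt_lt_R0, disc0. }
    change (1 / 2 * (c_of (g t) - 2 * 1 + disc_of (g t) * / sqrt (disc_of (g t)))
      = (c_of (g t) - 2 + sqrt (disc_of (g t))) / 2).
    rewrite Q. field. }
  destruct (El El2 H5) as [l20 Eil].
  assert (lam0 : forall t, 0 <= t <= 1 -> 0 < lam_of (g t))
    by (intros t Ht; apply sqrt_lt_R0, l20, Ht).
  split; [|intros t Ht; split; [apply disc0, Ht|apply l20, Ht]].
  unfold encl_params; cbn [p_mu p_a p_ia p_ig p_c p_lam p_eta].
  repeat (split; [first [exact Emu | exact Ea | exact Eia | exact Eig | exact Ec | idtac]|]).
  - refine (encl_ext _ _ _ _ (encl_mul n _ _ _ _ El2 Eil)). intros t Ht.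
    specialize (l20 t Ht). specialize (lam0 t Ht). unfold lam_of in *.
    rewrite <- (sqrt_sqrt (lam2_of (g t))) at 1 by lra. field. lra.
  - refine (encl_ext _ _ _ _ (encl_mul n _ _ _ _ half_exact (encl_mul n _ _ _ _
      (encl_sub _ _ _ _ (encl_sub _ _ _ _ El2 encl_one) (encl_scale 2 _ _ Ec)) Eil))).
    intros t Ht. specialize (lam0 t Ht). unfold eta_of. fold (lam_of (g t)). field. lra.
Qed.

Lemma encl_collapse f m t : encl f m -> 0 <= t <= 1 -> encl (fun _ => f t) (collapse m).
Proof.
  intros E Ht. specialize (E t Ht). unfold collapse.
  destruct m as [[|c0 [|c1 P]] e]; cbn [fst snd] in *.
  - intros s _. exact E.
  - intros s _. cbn [fst snd peval] in *. rewrite Rmult_0_r in *. exact E.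
  - apply encl_const. cbn [peval] in E. pose proof (peval_bound P t Ht) as B.
    rewrite !plus_IZR.
    assert (C : Rabs (t * IZR c1 - IZR (c1 / 2)) <= IZR (Z.abs c1 / 2) + 1).
    { pose proof (Z.div_mod c1 2 ltac:(discriminate)) as D.
      pose proof (Z.mod_pos_bound c1 2 ltac:(reflexivity)) as M.
      pose proof (Z.div_mod (Z.abs c1) 2 ltac:(discriminate)) as D'.
      pose proof (Z.mod_pos_bound (Z.abs c1) 2 ltac:(reflexivity)) as M'.
      assert (H1 : (0 <= c1 - 2 * (c1 / 2) <= 1)%Z) by lia.
      assert (H2 : (- (2 * (Z.abs c1 / 2) + 1) <= c1 <= 2 * (Z.abs c1 / 2) + 1)%Z) by lia.
      destruct H1 as [H1 H1'], H2 as [H2 H2'].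
      apply IZR_le in H1, H1', H2, H2'.
      rewrite ?minus_IZR, ?opp_IZR, ?plus_IZR, ?mult_IZR in *.
      apply Rabs_le. destruct (Rle_lt_dec 0 (IZR c1)); nra. }
    assert (P2 : Rabs (t * (t * peval P t)) <= IZR (psize P)).
    { rewrite !Rabs_mult, (Rabs_pos_eq t) by lra. pose proof (Rabs_pos (peval P t)).
      rewrite <- Rmult_assoc. assert (0 <= t * t <= 1) by nra. nra. }
    replace (IZR fone * f t - (IZR c0 + IZR (c1 / 2))) with
      ((IZR fone * f t - (IZR c0 + t * (IZR c1 + t * peval P t)))
       + (t * IZR c1 - IZR (c1 / 2)) + t * (t * peval P t)) by ring.
    eapply Rle_trans; [apply Rabs_triang|].
    eapply Rle_trans; [apply Rplus_le_compat_r, Rabs_triang|]. lra.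
Qed.

Lemma interval_params_sound (g : R -> R) m t : (forall t, 0 <= t <= 1 -> 0 < g t < 1) ->
  encl g m -> fst (interval_params m) = true -> 0 <= t <= 1 ->
  encl_params (snd (interval_params m)) (fun _ => g t) /\
  0 < disc_of (g t) /\ 0 < lam2_of (g t).
Proof.
  intros Hg Eg. pose proof (param_models_sound 3 g m Hg Eg) as S. unfold interval_params.
  destruct (param_models 3 m) as [ok P]. cbn [fst snd] in *. intros H Ht.
  destruct (S H) as [[E1 [E2 [E3 [E4 [E5 [E6 E7]]]]]] Pos].
  split; [|now apply Pos]. unfold encl_params; cbn [p_mu p_a p_ia p_ig p_c p_lam p_eta].
  split; [exact (encl_collapse _ _ t E1 Ht)|]. split; [exact (encl_collapse _ _ t E2 Ht)|].
  split; [exact (encl_collapse _ _ t E3 Ht)|]. split; [exact (encl_collapse _ _ t E4 Ht)|].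
  split; [exact (encl_collapse _ _ t E5 Ht)|]. split; [exact (encl_collapse _ _ t E6 Ht)|].
  exact (encl_collapse _ _ t E7 Ht).
Qed.

(** The squared distance to the primary is b^2 (1 + s bend). *)
Definition bend (s X Y b : R) : R :=
  IZR (-2) * (X * / b) + s * ((X * X + Y * Y) * (/ b * / b)).
Definition isqrt_bend (s X Y b : R) : R := / sqrt (1 + s * bend s X Y b).
(** For V = 1/sqrt (1 + u) one has V^3 = 1 - (3/2) u + u^2 cubic_rest V. *)
Definition cubic_rest (V : R) : R :=
  1 / 2 * (V * V * (/ (1 + V) * / (1 + V)) *
     (2 * (V * V * V) + 4 * (V * V) + (6 * V + 3 * 1))).
Definition rem_factor (s X Y b : R) : R :=
  bend s X Y b * (s * bend s X Y b * cubic_rest (isqrt_bend s X Y b) - 1 / 2 * (3 * 1)).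
Definition rem_x (s X Y b : R) : R :=
  1 / 2 * (3 * ((X * X + Y * Y) * / b)) + X * rem_factor s X Y b
  - b * (bend s X Y b * bend s X Y b * cubic_rest (isqrt_bend s X Y b)).
Definition rem_y (s X Y b : R) : R := Y * rem_factor s X Y b.

Lemma primary_expansion s X Y b : b <> 0 -> 0 < 1 + s * bend s X Y b ->
  kepler (s * X - b) (s * Y) =
  ((/ Rabs b) ^ 3 * (- b - 2 * (s * X) + s ^ 2 * rem_x s X Y b),
   (/ Rabs b) ^ 3 * (s * Y + s ^ 2 * rem_y s X Y b)).
Proof.
  intros Hb Hu. unfold rem_x, rem_y, rem_factor.
  set (V := isqrt_bend s X Y b). set (K := cubic_rest V).
  unfold isqrt_bend in V. set (U := bend s X Y b) in *. unfold bend in U.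
  set (W := U * (s * U * K - 1 / 2 * (3 * 1))).
  assert (R2 : (s * X - b) ^ 2 + (s * Y) ^ 2 = Rabs b ^ 2 * (1 + s * U)).
  { rewrite pow2_abs. unfold U. field. exact Hb. }
  assert (Sb : sqrt ((s * X - b) ^ 2 + (s * Y) ^ 2) = Rabs b * sqrt (1 + s * U)).
  { rewrite R2, sqrt_mult_alt by apply pow2_ge_0. rewrite sqrt_pow2 by apply Rabs_pos. reflexivity. }
  pose proof (sqrt_lt_R0 _ Hu) as S0.
  assert (V0 : 0 < V) by now apply Rinv_0_lt_compat.
  assert (VV : V * V * (1 + s * U) = 1).
  { unfold V. rewrite <- (sqrt_sqrt (1 + s * U)) at 3 by lra. field. lra. }
  assert (V3 : V ^ 3 = 1 - 3 / 2 * (s * U) + (s * U) ^ 2 * K).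
  { assert (Eu : s * U = (1 - V * V) / (V * V)).
    { apply Rmult_eq_reg_l with (V * V); [|nra]. 
      replace (V * V * ((1 - V * V) / (V * V))) with (1 - V * V) by (field; lra). lra. }
    unfold K, cubic_rest. rewrite Eu. field. split; lra. }
  assert (Ik : / (Rabs b * sqrt (1 + s * U)) ^ 3 = (/ Rabs b) ^ 3 * V ^ 3).
  { rewrite <- Rpow_mult_distr. unfold V. rewrite <- pow_inv, Rinv_mult. reflexivity. }
  unfold kepler. rewrite Sb, Ik, V3.
  f_equal.
  - transitivity ((/ Rabs b) ^ 3 * ((s * X - b) * (1 - 3 / 2 * (s * U) + (s * U) ^ 2 * K))); [ring|].
    f_equal. unfold W.
    assert (bU : b * U = -2 * X + s * ((X * X + Y * Y) * / b)) by (unfold U; field; exact Hb).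
    transitivity (- b + s * X + 3 / 2 * s * (b * U) - 3 / 2 * (s * X) * (s * U)
      + s * X * (s * U) ^ 2 * K - s ^ 2 * b * U * U * K); [field|].
    rewrite bU. field. exact Hb.
  - unfold W. field. apply Rabs_no_R0, Hb.
Qed.

Lemma primary_models_sound n b X Y mb mib mX mY mQ :
  encl (fun _ => b) mb -> encl (fun _ => / b) mib -> encl X mX -> encl Y mY ->
  encl (fun t => X t * X t + Y t * Y t) mQ ->
  fst (primary_models n mb mib mX mY mQ) = true ->
  (forall t, 0 <= t <= 1 -> 0 < 1 + t * bend t (X t) (Y t) b) /\
  encl (fun t => rem_x t (X t) (Y t) b) (fst (snd (primary_models n mb mib mX mY mQ))) /\
  encl (fun t => rem_y t (X t) (Y t) b) (snd (snd (primary_models n mb mib mX mY mQ))).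
Proof.
  intros Eb Eib EX EY EQ. unfold primary_models.
  pose proof (encl_add _ _ _ _ (encl_scale (-2) _ _ (encl_mul n _ _ _ _ EX Eib))
    (encl_X _ _ (encl_mul n _ _ _ _ EQ (encl_mul n _ _ _ _ Eib Eib)))) as EU.
  match type of EU with encl _ ?a => set (U := a) in * end.
  change (encl (fun t => bend t (X t) (Y t) b) U) in EU.
  pose proof (encl_X _ _ EU) as Eu.
  pose proof (encl_isqrt n _ _ (encl_add _ _ _ _ encl_one Eu)) as EV.
  destruct (tisqrt n (tadd tone (tX U))) as [ok1 V]. cbn [fst snd] in EV.
  pose proof (encl_inv n (fun t => 1 + isqrt_bend t (X t) (Y t) b) (tadd tone V)) as EH.
  destruct (tinv n (tadd tone V)) as [ok2 iH]. cbn [fst snd] in EH |- *.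
  intros H. apply andb_prop in H. destruct H as [H1 H2].
  destruct (EV H1) as [P EV']. clear EV.
  change (encl (fun t => isqrt_bend t (X t) (Y t) b) V) in EV'.
  assert (Vp : forall t, 0 <= t <= 1 -> 0 < isqrt_bend t (X t) (Y t) b).
  { intros t Ht. apply Rinv_0_lt_compat, sqrt_lt_R0, P, Ht. }
  specialize (EH (encl_add _ _ _ _ encl_one EV')
    ltac:(intros t Ht; specialize (Vp t Ht); lra) H2).
  pose proof (encl_mul n _ _ _ _ EV' EV') as EV2.
  pose proof (encl_mul n _ _ _ _ half_exact (encl_mul n _ _ _ _
    (encl_mul n _ _ _ _ EV2 (encl_mul n _ _ _ _ EH EH))
    (encl_add _ _ _ _
      (encl_add _ _ _ _ (encl_scale 2 _ _ (encl_mul n _ _ _ _ EV2 EV')) (encl_scale 4 _ _ EV2))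
      (encl_add _ _ _ _ (encl_scale 6 _ _ EV') (encl_scale 3 _ _ encl_one))))) as EK.
  match type of EK with encl _ ?a => set (K := a) in * end.
  change (encl (fun t => cubic_rest (isqrt_bend t (X t) (Y t) b)) K) in EK.
  pose proof (encl_mul n _ _ _ _ EU (encl_sub _ _ _ _ (encl_mul n _ _ _ _ Eu EK)
    (encl_mul n _ _ _ _ half_exact (encl_scale 3 _ _ encl_one)))) as EW.
  match type of EW with encl _ ?a => set (W := a) in * end.
  change (encl (fun t => rem_factor t (X t) (Y t) b) W) in EW.
  split; [exact P|]. split.
  - exact (encl_sub _ _ _ _ (encl_add _ _ _ _
      (encl_mul n _ _ _ _ half_exact (encl_scale 3 _ _ (encl_mul n _ _ _ _ EQ Eib)))
      (encl_mul n _ _ _ _ EX EW))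
      (encl_mul n _ _ _ _ Eb (encl_mul n _ _ _ _ (encl_mul n _ _ _ _ EU EU) EK))).
  - exact (encl_mul n _ _ _ _ EY EW).
Qed.

(** Approximate unstable manifold: libration point, s times the eigenvector of length amp, and
    polynomials from order s^2 on. *)
Definition manifold_curve (g amp : R) (X Y U V : list Z) (s : R) : state :=
  (x_of g + s * (amp + s * (peval X s / IZR fone)),
   s * (amp * eta_of g + s * (peval Y s / IZR fone)),
   s * (amp * (lam_of g - eta_of g) + s * (peval U s / IZR fone)),
   x_of g + s * (amp * (lam_of g * eta_of g + 1) + s * (peval V s / IZR fone))).
Definition manifold_tangent (g amp : R) (X Y U V : list Z) (s : R) : state :=
  (amp + s * (peval (pderiv_aux 2 X) s / IZR fone),
   amp * eta_of g + s * (peval (pderiv_aux 2 Y) s / IZR fone),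
   amp * (lam_of g - eta_of g) + s * (peval (pderiv_aux 2 U) s / IZR fone),
   amp * (lam_of g * eta_of g + 1) + s * (peval (pderiv_aux 2 V) s / IZR fone)).

(** The eigenvector equations for (1, eta, lam - eta, lam eta + 1). *)
Lemma eigen_relations g : 0 < g < 1 -> 0 < disc_of g -> 0 < lam2_of g ->
  lam_of g ^ 2 - 2 * lam_of g * eta_of g = 1 + 2 * c_of g /\
  lam_of g ^ 2 * eta_of g + 2 * lam_of g = (1 - c_of g) * eta_of g.
Proof.
  intros Hg Hd Hl. assert (L0 : 0 < lam_of g) by (apply sqrt_lt_R0, Hl).
  assert (L2 : lam_of g ^ 2 = lam2_of g) by (apply pow2_sqrt; lra).
  split.
  - rewrite L2. unfold eta_of. field. lra.
  - assert (Q : lam2_of g * lam2_of g + (2 - c_of g) * lam2_of g + 1 + c_of g - 2 * (c_of g * c_of g) = 0).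
    { unfold lam2_of. assert (S := sqrt_sqrt (disc_of g) ltac:(lra)).
      unfold disc_of at 3 in S. set (q := sqrt (disc_of g)) in *.
      transitivity ((q * q - 9 * (c_of g * c_of g) + 8 * c_of g) / 4); [field|].
      rewrite S. field. }
    apply Rmult_eq_reg_l with (2 * lam_of g); [|lra].
    replace (2 * lam_of g * (lam_of g ^ 2 * eta_of g + 2 * lam_of g))
      with (lam_of g ^ 2 * (2 * lam_of g * eta_of g) + 4 * lam_of g ^ 2) by ring.
    replace (2 * lam_of g * ((1 - c_of g) * eta_of g))
      with ((1 - c_of g) * (2 * lam_of g * eta_of g)) by ring.
    replace (2 * lam_of g * eta_of g) with (lam2_of g - 1 - 2 * c_of g)
      by (unfold eta_of; field; lra).
    rewrite L2. nra.
Qed.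

(** Equilibrium of the centrifugal force and the two attractions. *)
Lemma x_of_eq g : 0 < g < 1 ->
  x_of g = (1 - mu_of g) * (/ (1 - g)) ^ 3 * - (1 - g) + mu_of g * (/ g) ^ 3 * g.
Proof.
  intros Hg. 
  assert (ia1 : 1 < / (1 - g)) by (rewrite <- Rinv_1; apply Rinv_lt_contravar; lra).
  assert (ig0 : 0 < / g) by (apply Rinv_0_lt_compat; lra).
  assert (D0 : 0 < / (1 - g) * / (1 - g) + / g * / g - 1) by nra.
  assert (M : mu_of g * (/ (1 - g) * / (1 - g) + / g * / g - 1)
    = / (1 - g) * / (1 - g) - (1 - g)) by (unfold mu_of; rewrite Rmult_assoc, Rinv_l by lra; ring).
  assert (A1 : (1 - g) * / (1 - g) = 1) by (field; lra).
  assert (A2 : g * / g = 1) by (field; lra).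
  unfold x_of.
  replace ((1 - mu_of g) * (/ (1 - g)) ^ 3 * - (1 - g))
    with (- (1 - mu_of g) * (/ (1 - g) * / (1 - g)) * ((1 - g) * / (1 - g))) by ring.
  replace (mu_of g * (/ g) ^ 3 * g) with (mu_of g * (/ g * / g) * (g * / g)) by ring.
  rewrite A1, A2. lra.
Qed.

Lemma local_defect_sound n P g mg amp X Y U V d :
  0 < g < 1 -> 0 < disc_of g -> 0 < lam2_of g ->
  encl (fun _ => g) mg -> encl_params P (fun _ => g) ->
  local_defect n P mg amp X Y U V = (true, d) ->
  forall s, 0 <= s <= 1 ->
    wnorm (minus (field (mu_of g) (manifold_curve g (val amp) X Y U V s))
      (scal (lam_of g * s) (manifold_tangent g (val amp) X Y U V s))) <= val d * s ^ 2.
Proof.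
  intros Hg Hd Hl Eg [Emu [Ea [Eia [Eig [Ec [Elam Eeta]]]]]] H.
  destruct P as [mmu ma mia mig mc mlam meta]. cbn [p_mu p_a p_ia p_ig p_c p_lam p_eta] in *.
  unfold local_defect in H. cbv zeta in H.
  set (x2 := fun t => peval X t / IZR fone). set (y2 := fun t => peval Y t / IZR fone).
  set (u2 := fun t => peval U t / IZR fone). set (v2 := fun t => peval V t / IZR fone).
  pose proof (encl_exact X) as EX. fold x2 in EX. pose proof (encl_exact Y) as EY. fold y2 in EY.
  pose proof (encl_exact U) as EU. fold u2 in EU. pose proof (encl_exact V) as EV. fold v2 in EV.
  pose proof (encl_exact (amp :: nil)) as EA.
  apply (encl_ext _ (fun _ => val amp)) in EA.
  2: { intros t _. unfold val. cbn [peval]. now rewrite Rmult_0_r, Rplus_0_r. }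
  pose proof (encl_add _ _ _ _ EA (encl_X _ _ EX)) as EX1.
  pose proof (encl_add _ _ _ _ (encl_mul n _ _ _ _ EA Eeta) (encl_X _ _ EY)) as EY1.
  set (X1 := fun t => val amp + t * x2 t). set (Y1 := fun t => val amp * eta_of g + t * y2 t).
  change (encl X1 (tadd (texact (amp :: nil)) (tX (texact X)))) in EX1.
  change (encl Y1 (tadd (tmul n (texact (amp :: nil)) meta) (tX (texact Y)))) in EY1.
  set (mX1 := tadd (texact (amp :: nil)) (tX (texact X))) in *.
  set (mY1 := tadd (tmul n (texact (amp :: nil)) meta) (tX (texact Y))) in *.
  pose proof (encl_add _ _ _ _ (encl_mul n _ _ _ _ EX1 EX1) (encl_mul n _ _ _ _ EY1 EY1)) as EQ.
  pose proof (primary_models_sound n (1 - g) X1 Y1 _ _ _ _ _ Ea Eia EX1 EY1 EQ) as S1.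
  assert (Emg : encl (fun _ => - g) (tscale (-1) mg)).
  { refine (encl_ext _ _ _ _ (encl_scale (-1) _ _ Eg)). intros; ring. }
  assert (Emig : encl (fun _ => / - g) (tscale (-1) mig)).
  { refine (encl_ext _ _ _ _ (encl_scale (-1) _ _ Eig)). intros; field; lra. }
  pose proof (primary_models_sound n (- g) X1 Y1 _ _ _ _ _ Emg Emig EX1 EY1 EQ) as S2.
  match type of H with context [primary_models n ma mia mX1 mY1 ?q] =>
    destruct (primary_models n ma mia mX1 mY1 q) as [ok1 [M1x M1y]];
    destruct (primary_models n (tscale (-1) mg) (tscale (-1) mig) mX1 mY1 q) as [ok2 [M2x M2y]]
  end.
  cbn [fst snd] in S1, S2, H.
  match type of H with (?a, ?b) = _ =>
    assert (H1 : a = true) by exact (f_equal fst H);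
    assert (H2 : b = d) by exact (f_equal snd H) end.
  clear H. apply andb_prop in H1. destruct H1 as [O1 O2].
  destruct (S1 O1) as [B1 [E1x E1y]]. destruct (S2 O2) as [B2 [E2x E2y]]. clear S1 S2.
  pose proof (encl_mul n _ _ _ _ (encl_sub _ _ _ _ encl_one Emu)
    (encl_mul n _ _ _ _ Eia (encl_mul n _ _ _ _ Eia Eia))) as Em1.
  pose proof (encl_mul n _ _ _ _ Emu (encl_mul n _ _ _ _ Eig (encl_mul n _ _ _ _ Eig Eig))) as Em2.
  pose proof (encl_add _ _ _ _ (encl_mul n _ _ _ _ Em1 E1x) (encl_mul n _ _ _ _ Em2 E2x)) as ENX.
  pose proof (encl_add _ _ _ _ (encl_mul n _ _ _ _ Em1 E1y) (encl_mul n _ _ _ _ Em2 E2y)) as ENY.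
  pose proof (encl_sub _ _ _ _ (encl_add _ _ _ _ EU EY)
    (encl_mul n _ _ _ _ Elam (encl_exact (pderiv_aux 2 X)))) as D1.
  pose proof (encl_sub _ _ _ _ (encl_sub _ _ _ _ EV EX)
    (encl_mul n _ _ _ _ Elam (encl_exact (pderiv_aux 2 Y)))) as D2.
  pose proof (encl_sub _ _ _ _ (encl_sub _ _ _ _ (encl_add _ _ _ _ EV
    (encl_mul n _ _ _ _ (encl_scale 2 _ _ Ec) EX)) ENX)
    (encl_mul n _ _ _ _ Elam (encl_exact (pderiv_aux 2 U)))) as D3.
  pose proof (encl_sub _ _ _ _ (encl_sub _ _ _ _ (encl_sub _ _ _ _ (encl_scale (-1) _ _ EU)
    (encl_mul n _ _ _ _ Ec EY)) ENY)
    (encl_mul n _ _ _ _ Elam (encl_exact (pderiv_aux 2 V)))) as D4.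
  intros s Hs.
  pose proof (val_tbound _ _ s D1 Hs) as C1. pose proof (val_tbound _ _ s D2 Hs) as C2.
  pose proof (val_tbound _ _ s D3 Hs) as C3. pose proof (val_tbound _ _ s D4 Hs) as C4.
  cbv beta in C1, C2, C3, C4.
  rewrite <- H2. rewrite !val_add, val_scale, val_add.
  clear H2 D1 D2 D3 D4 ENX ENY Em1 Em2 E1x E1y E2x E2y EQ EX1 EY1.
  destruct (eigen_relations g Hg Hd Hl) as [R1 R2].
  specialize (B1 s Hs). specialize (B2 s Hs).
  pose proof (primary_expansion s (X1 s) (Y1 s) (1 - g) ltac:(lra) B1) as F1.
  pose proof (primary_expansion s (X1 s) (Y1 s) (- g) ltac:(lra) B2) as F2.
  rewrite Rabs_pos_eq in F1 by lra. rewrite Rabs_Ropp, Rabs_pos_eq in F2 by lra.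
  pose proof (x_of_eq g Hg) as XE.
  set (mu := mu_of g) in *. set (c := c_of g) in *. set (lam := lam_of g) in *.
  set (eta := eta_of g) in *.
  assert (CE : c = (1 - mu) * (/ (1 - g)) ^ 3 + mu * (/ g) ^ 3) by (unfold c, c_of; fold mu; ring).
  unfold manifold_curve, manifold_tangent. cbn [field]. fold lam eta.
  unfold X1, Y1 in F1, F2, B1, B2, C1, C2, C3, C4.
  fold (x2 s) (y2 s) (u2 s) (v2 s).
  unfold force. cbn [fst snd].
  replace (x_of g + s * (val amp + s * x2 s) - mu) with (s * (val amp + s * x2 s) - (1 - g))
    by (unfold x_of; fold mu; ring).
  replace (s * (val amp + s * x2 s) - (1 - g) + 1) with (s * (val amp + s * x2 s) - - g) by ring.
  rewrite F1, F2. cbn [fst snd].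
  set (p1 := rem_x s _ _ (1 - g)) in *. set (p2 := rem_x s _ _ (- g)) in *.
  set (q1 := rem_y s _ _ (1 - g)) in *. set (q2 := rem_y s _ _ (- g)) in *.
  set (ex := peval (pderiv_aux 2 X) s / IZR fone) in *.
  set (ey := peval (pderiv_aux 2 Y) s / IZR fone) in *.
  set (eu := peval (pderiv_aux 2 U) s / IZR fone) in *.
  set (ev := peval (pderiv_aux 2 V) s / IZR fone) in *.
  rewrite scal_state, minus_state.
  eapply Rle_trans; [apply wnorm_le_coords|].
  rewrite XE. clear XE F1 F2 B1 B2.
  fold mu. change (- - g) with (- - g).
  set (ja := / (1 - g)) in *. set (jg := / g) in *.
  set (A := val amp) in *.
  clearbody p1 p2 q1 q2 ex ey eu ev x2 y2 u2 v2 ja jg A lam eta.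
  match goal with |- 3 * (Rabs ?a + Rabs ?b) + Rabs ?e + Rabs ?f <= _ =>
    assert (Ia : a = s ^ 2 * (u2 s + y2 s - lam * ex)) by ring;
    assert (Ib : b = s ^ 2 * (v2 s - x2 s - lam * ey)) by ring;
    assert (Ie : e = s ^ 2 * (v2 s + 2 * c * x2 s
      - ((1 - mu) * (ja * (ja * ja)) * p1 + mu * (jg * (jg * jg)) * p2) - lam * eu));
    [ apply Rminus_diag_uniq;
      transitivity (s * A * ((1 + 2 * c) - (lam ^ 2 - 2 * lam * eta)));
      [ rewrite CE; ring | rewrite R1; ring ] |];
    assert (If : f = s ^ 2 * (-1 * u2 s - c * y2 s
      - ((1 - mu) * (ja * (ja * ja)) * q1 + mu * (jg * (jg * jg)) * q2) - lam * ev));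
    [ apply Rminus_diag_uniq;
      transitivity (s * A * ((1 - c) * eta - (lam ^ 2 * eta + 2 * lam)));
      [ rewrite CE; ring | rewrite R2; ring ] |]
  end.
  rewrite Ia, Ib, Ie, If. rewrite !Rabs_mult, !(Rabs_pos_eq (s ^ 2)) by apply pow2_ge_0.
  pose proof (pow2_ge_0 s) as S2.
  match goal with |- 3 * (s ^ 2 * ?a + s ^ 2 * ?b) + s ^ 2 * ?e + s ^ 2 * ?f <= ?r * s ^ 2 =>
    replace (3 * (s ^ 2 * a + s ^ 2 * b) + s ^ 2 * e + s ^ 2 * f)
      with ((3 * (a + b) + e + f) * s ^ 2) by ring;
    apply Rmult_le_compat_r; [exact S2|] end.
  lra.
Qed.

(** * Branches of the unstable manifold *)

(** The distance 1/10 from the primaries is a uniform bound for all orbits considered here. *)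
Definition sol (mu : R) (y : R -> state) (t : R) : Prop :=
  away (1 / 10) (1 / 10) mu (y t) /\ is_derive y t (field mu (y t)).

Lemma is_derive_shift (w : R -> state) T t l :
  is_derive w (t - T) l -> is_derive (fun t => w (t - T)) t l.
Proof.
  intros D. assert (E : is_derive (fun t : R => t - T) t 1) by (auto_derive; [trivial|ring]).
  pose proof (is_derive_comp w (fun t => t - T) t _ _ D E) as C.
  replace l with (scal 1 l : state); [exact C|]. exact (scal_one l).
Qed.

Lemma sol_ext_locally mu (y y' : R -> state) t eps : 0 < eps ->
  (forall s, Rabs (s - t) < eps -> y s = y' s) -> sol mu y t -> sol mu y' t.
Proof.
  intros He H [A D]. assert (E : y t = y' t) by (apply H; rewrite Rminus_diag, Rabs_R0; exact He).
  unfold sol. rewrite <- E. split; [exact A|].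
  apply (is_derive_ext_loc y); [|exact D]. exists (mkposreal _ He). exact H.
Qed.

(** A solution up to time T, continued by a solution with the same value at T; differentiability
    at T holds since both pieces have the derivative prescribed by the field. *)
Lemma sol_glue mu (y w : R -> state) T :
  (forall t, t <= T -> sol mu y t) -> sol mu w T -> w T = y T ->
  exists x : R -> state, (forall t, t <= T -> sol mu x t) /\
    (forall t, T <= t -> sol mu w t -> sol mu x t) /\
    (forall t, t <= T -> x t = y t) /\ (forall t, T <= t -> x t = w t).
Proof.
  intros Hy Hw E. set (x := fun t => if Rle_dec t T then y t else w t).
  assert (E1 : forall t, t <= T -> x t = y t)
    by (intros t Ht; unfold x; destruct (Rle_dec t T); [reflexivity|lra]).
  assert (E2 : forall t, T <= t -> x t = w t).
  { intros t Ht. unfold x. destruct (Rle_dec t T); [|reflexivity].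
    replace t with T by lra. now rewrite E. }
  assert (ST : sol mu x T).
  { destruct (Hy T ltac:(lra)) as [A D], Hw as [_ D']. rewrite E in D'.
    unfold sol. rewrite E1 by lra. split; [exact A|].
    apply (is_derive_glue y w); [exact D|exact D'|now rewrite E]. }
  exists x. split; [|split; [|split; assumption]].
  - intros t Ht. destruct (Req_dec t T) as [-> | N]; [exact ST|].
    apply (sol_ext_locally mu y x t (T - t)); [lra| |now apply Hy].
    intros s Hs. apply Rabs_def2 in Hs. symmetry. apply E1. lra.
  - intros t Ht S. destruct (Req_dec t T) as [-> | N]; [exact ST|].
    apply (sol_ext_locally mu w x t (t - T)); [lra| |exact S].
    intros s Hs. apply Rabs_def2 in Hs. symmetry. apply E2. lra.
Qed.

Lemma sol_extend mu (y w : R -> state) T h : 0 < h ->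
  (forall t, t <= T -> sol mu y t) -> w 0 = y T ->
  (forall t, 0 <= t <= h -> sol mu w t) ->
  exists y' : R -> state, (forall t, t <= T + h -> sol mu y' t) /\
    (forall t, t <= T -> y' t = y t) /\ (forall t, T <= t -> y' t = w (t - T)).
Proof.
  intros Hh Hy W0 Hw.
  assert (Sw : forall t, T <= t <= T + h -> sol mu (fun t => w (t - T)) t).
  { intros t Ht. destruct (Hw (t - T) ltac:(lra)) as [A D]. split; [exact A|].
    apply is_derive_shift, D. }
  destruct (sol_glue mu y (fun t => w (t - T)) T Hy) as [x [S1 [S2 [E1 E2]]]].
  - apply Sw. lra.
  - now rewrite Rminus_diag.
  - exists x. split; [|split; assumption]. intros t Ht.
    destruct (Rle_lt_dec t T); [now apply S1|]. apply S2; [lra|]. apply Sw. lra.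
Qed.

Lemma step_sound n mu m emu rad h st e0 st' e1 var z0 :
  step n m emu rad h st e0 = Some (st', e1, var) ->
  Rabs (IZR fone * mu - IZR m) <= IZR emu ->
  wnorm (minus z0 (real st)) <= val e0 ->
  0 < val h /\
  exists y : R -> state, y 0 = z0 /\
    (forall t, 0 <= t <= val h -> sol mu y t /\ wnorm (minus (y t) (real st)) <= val var) /\
    wnorm (minus (y (val h)) (real st')) <= val e1.
Proof.
  intros H Hm Hz. destruct st as [[[x0 y0] u0] v0]. unfold step in H.
  destruct (taylor n 0 m h _ _ _ _ _ _ _ _ _ _ _ _) as [[[[[X Y] U] V] Q1] Q2].
  destruct (verify_sound _ _ _ _ _ _ _ _ _ _ _ _ _ _ _ _ _ _ H Hm Hz) as [h0 [y [Y0 [Hy Y1]]]].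
  split; [exact h0|]. exists y. split; [exact Y0|]. split; [|exact Y1].
  intros t Ht. destruct (Hy t Ht) as [A [D B]]. split; [split; assumption|exact B].
Qed.

Definition total (hs : list Z) : Z := fold_right Z.add 0%Z hs.

Lemma run_sound n mu m emu rad hs : forall st e0 st' e1 y T,
  run n m emu rad hs st e0 = Some (st', e1) ->
  Rabs (IZR fone * mu - IZR m) <= IZR emu ->
  (forall t, t <= T -> sol mu y t) ->
  wnorm (minus (y T) (real st)) <= val e0 ->
  0 <= val (total hs) /\
  exists y' : R -> state, (forall t, t <= T + val (total hs) -> sol mu y' t) /\
    (forall t, t <= T -> y' t = y t) /\
    wnorm (minus (y' (T + val (total hs))) (real st')) <= val e1.
Proof.
  induction hs as [|h hs IH]; intros st e0 st' e1 y T H Hm Hy Hz.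
  - change (total nil) with 0%Z. rewrite val_0, Rplus_0_r. split; [lra|].
    simpl in H. injection H as <- <-. exists y. auto.
  - change (total (h :: hs)) with (h + total hs)%Z. rewrite val_add.
    cbn [run] in H. destruct (step n m emu rad h st e0) as [[[st2 e2] var]|] eqn:E; [|discriminate].
    destruct (step_sound _ _ _ _ _ _ _ _ _ _ _ _ E Hm Hz) as [h0 [w [W0 [Hw W1]]]].
    destruct (sol_extend mu y w T (val h) h0 Hy W0) as [y2 [S2 [A2 B2]]].
    { intros t Ht. apply Hw, Ht. }
    destruct (IH st2 e2 st' e1 y2 (T + val h) H Hm S2) as [N0 [y' [S' [A' B']]]].
    { rewrite B2 by lra. replace (T + val h - T) with (val h) by ring. exact W1. }
    split; [lra|]. exists y'. rewrite <- Rplus_assoc. split; [exact S'|]. split; [|exact B'].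
    intros t Ht. rewrite A' by lra. now apply A2.
Qed.

Definition linear_part (amp g s : R) : state :=
  (x_of g + s * amp, s * (amp * eta_of g), s * (amp * (lam_of g - eta_of g)),
   x_of g + s * (amp * (lam_of g * eta_of g + 1))).

(** The bounds on the parameters that the estimates need; the intervals of g below satisfy them. *)
Definition admissible (g : R) : Prop :=
  1 / 10 <= g <= 3 / 20 /\ 0 < disc_of g /\ 0 < lam2_of g /\
  0 <= mu_of g <= 43 / 10000 /\ 11 / 4 <= lam_of g.

(** A piece of the unstable manifold up to time T. The last clause selects, among all solutions
    that emerge from the libration point, the one with amplitude amp at time 0, up to an error of
    second order. In the region of the second clause the tidal force is at most 12, which
    makes the Lipschitz constant 1 + 12/3 = 5 smaller than twice the eigenvalue. *)
Definition branch (amp g T : R) (y : R -> state) : Prop :=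
  (forall t, t <= T -> sol (mu_of g) y t) /\
  (forall t, t <= 0 -> away (17 / 20) (1 / 10) (mu_of g) (y t)) /\
  (forall t, t <= 0 -> wnorm (minus (y t) (linear_part amp g (exp (lam_of g * t))))
     <= exp (lam_of g * t) ^ 2).

Definition mid (m : tm) : Z := psum (fst m).

Definition start_x (P : params) (amp : Z) : tm :=
  tadd (tsub (p_mu P) (p_a P)) (texact (amp :: nil)).
Definition start_y (P : params) (amp : Z) : tm := tmul 1 (texact (amp :: nil)) (p_eta P).
Definition start_u (P : params) (amp : Z) : tm :=
  tmul 1 (texact (amp :: nil)) (tsub (p_lam P) (p_eta P)).
Definition start_v (P : params) (amp : Z) : tm :=
  tadd (tsub (p_mu P) (p_a P))
    (tmul 1 (texact (amp :: nil)) (tadd (tmul 1 (p_lam P) (p_eta P)) tone)).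

(** Start of the branch at s = 1: coordinates, their error, and a model of the mass. r is the
    constant of the tube r s^2 around the polynomial curve. *)
Definition local_check (n : nat) (gm : tm) (amp : Z) (X Y U V : list Z) (r : Z)
  : option (zstate * Z * tm) :=
  let (ok1, P) := interval_params gm in
  let mg := collapse gm in
  let (ok2, d) := local_defect n P mg amp X Y U V in
  let x := start_x P amp in let y := start_y P amp in
  let u := start_u P amp in let v := start_v P amp in
  let g := mid mg in let eg := snd mg in
  if ok1 && ok2 && (0 <=? r)%Z && (2 * d <=? r)%Z
    && (fone <=? 10 * (g - eg))%Z && (20 * (g + eg) <=? 3 * fone)%Z
    && (17 * fone <=? 20 * (fone - (g + eg) - amp - psize X - r))%Z
    && (psize X + r <=? amp)%Z
    && (0 <=? mid (p_mu P) - snd (p_mu P))%Z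
    && (10000 * (mid (p_mu P) + snd (p_mu P)) <=? 43 * fone)%Z
    && (11 * fone <=? 4 * (mid (p_lam P) - snd (p_lam P)))%Z
    && (3 * (psize X + psize Y) + psize U + psize V + r <=? fone)%Z
  then Some
    ((mid x + psum X, mid y + psum Y, mid u + psum U, mid v + psum V)%Z,
     (3 * (snd x + snd y) + snd u + snd v + r)%Z, p_mu P)
  else None.

Lemma encl_mid f c m : encl f m -> f 1 = c -> Rabs (c - val (mid m)) <= val (snd m).
Proof.
  intros E <-. specialize (E 1 ltac:(lra)). rewrite peval_1 in E. fold (mid m) in E.
  pose proof fone_pos. unfold val.
  apply Rmult_le_reg_l with (IZR fone); [assumption|].
  replace (IZR fone * (IZR (snd m) / IZR fone)) with (IZR (snd m)) by (field; lra).
  rewrite <- (Rabs_pos_eq (IZR fone)) at 1 by lra. rewrite <- Rabs_mult.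
  replace (IZR fone * (f 1 - IZR (mid m) / IZR fone)) with (IZR fone * f 1 - IZR (mid m))
    by (field; lra).
  exact E.
Qed.

Lemma is_derive_quadratic_lift (k A : R) P s :
  is_derive (fun s => k + s * (A + s * (peval P s / IZR fone))) s
    (A + s * (peval (pderiv_aux 2 P) s / IZR fone)).
Proof.
  pose proof (is_derive_peval P s) as D. pose proof fone_pos.
  auto_derive; [eexists; exact D|].
  rewrite (Derive_value _ _ _ D), peval_deriv_aux. field. lra.
Qed.

Lemma is_derive_manifold g A X Y U V s :
  is_derive (manifold_curve g A X Y U V) s (manifold_tangent g A X Y U V s).
Proof.
  assert (D0 : forall A P, is_derive (fun s => s * (A + s * (peval P s / IZR fone))) s
    (A + s * (peval (pderiv_aux 2 P) s / IZR fone))).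
  { intros B P. apply (is_derive_ext (fun s => 0 + s * (B + s * (peval P s / IZR fone)))).
    - intros t. apply Rplus_0_l.
    - apply is_derive_quadratic_lift. }
  exact (is_derive_state _ _ _ _ s _ _ _ _
    (is_derive_quadratic_lift (x_of g) A X s) (D0 (A * eta_of g) Y)
    (D0 (A * (lam_of g - eta_of g)) U)
    (is_derive_quadratic_lift (x_of g) (A * (lam_of g * eta_of g + 1)) V s)).
Qed.

Lemma continuous_manifold_tangent g A X Y U V s :
  continuous (manifold_tangent g A X Y U V) s.
Proof.
  assert (D : forall A P, is_derive (fun s => A + s * (peval P s / IZR fone)) s
     (peval P s / IZR fone + s * (peval (pderiv P) s / IZR fone))).
  { intros B P. pose proof (is_derive_peval P s) as D. pose proof fone_pos.
    auto_derive; [eexists; exact D|]. rewrite (Derive_value _ _ _ D). field. lra. }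
  pose proof (is_derive_state _ _ _ _ s _ _ _ _ (D A (pderiv_aux 2 X))
    (D (A * eta_of g) (pderiv_aux 2 Y)) (D (A * (lam_of g - eta_of g)) (pderiv_aux 2 U))
    (D (A * (lam_of g * eta_of g + 1)) (pderiv_aux 2 V))) as DS.
  exact (continuous_of_derive _ _ _ DS).
Qed.

Ltac val_simpl H :=
  repeat first [ rewrite val_add in H | rewrite val_sub in H | rewrite val_scale in H
    | rewrite val_fone in H | rewrite val_0 in H ].

Lemma local_check_facts n gm mg amp X Y U V r st e0 mm :
  mg = collapse gm -> local_check n gm amp X Y U V r = Some (st, e0, mm) ->
  exists P d, interval_params gm = (true, P) /\ local_defect n P mg amp X Y U V = (true, d) /\
  (0 <= r)%Z /\ (2 * d <= r)%Z /\
  (fone <= 10 * (mid mg - snd mg))%Z /\ (20 * (mid mg + snd mg) <= 3 * fone)%Z /\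
  (17 * fone <= 20 * (fone - (mid mg + snd mg) - amp - psize X - r))%Z /\
  (psize X + r <= amp)%Z /\
  (0 <= mid (p_mu P) - snd (p_mu P))%Z /\
  (10000 * (mid (p_mu P) + snd (p_mu P)) <= 43 * fone)%Z /\
  (11 * fone <= 4 * (mid (p_lam P) - snd (p_lam P)))%Z /\
  (3 * (psize X + psize Y) + psize U + psize V + r <= fone)%Z /\
  st = (mid (start_x P amp) + psum X, mid (start_y P amp) + psum Y,
        mid (start_u P amp) + psum U, mid (start_v P amp) + psum V)%Z /\
  e0 = (3 * (snd (start_x P amp) + snd (start_y P amp)) + snd (start_u P amp)
        + snd (start_v P amp) + r)%Z /\
  mm = p_mu P.
Proof.
  unfold local_check. intros Hmg H.
  destruct (interval_params gm) as [ok1 P]. 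
  cbv zeta in H. rewrite <- Hmg in H.
  destruct (local_defect n P mg amp X Y U V) as [ok2 d] eqn:ED.
  match type of H with (if ?c then _ else _) = _ => destruct c eqn:C; [|discriminate] end.
  apply andb_prop in C; destruct C as [C B12]. apply andb_prop in C; destruct C as [C B11].
  apply andb_prop in C; destruct C as [C B10]. apply andb_prop in C; destruct C as [C B9].
  apply andb_prop in C; destruct C as [C B8]. apply andb_prop in C; destruct C as [C B7].
  apply andb_prop in C; destruct C as [C B6]. apply andb_prop in C; destruct C as [C B5].
  apply andb_prop in C; destruct C as [C B4]. apply andb_prop in C; destruct C as [C B3].
  apply andb_prop in C; destruct C as [B1 B2]. subst ok1 ok2.
  apply Z.leb_le in B3, B4, B5, B6, B7, B8, B9, B10, B11, B12.
  destruct (some_triple_inj _ _ _ _ _ _ H) as [H1 [H2 H3]].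
  exists P, d. repeat (split; [first [assumption | reflexivity | symmetry; assumption]|]).
  symmetry; assumption.
Qed.

Theorem local_sound n gm amp X Y U V r st e0 mm (gf : R -> R) t0 g :
  local_check n gm amp X Y U V r = Some (st, e0, mm) -> encl gf gm -> 0 <= t0 <= 1 ->
  gf t0 = g ->
  admissible g /\ encl (fun _ => mu_of g) mm /\
  exists y, branch (val amp) g 0 y /\ wnorm (minus (y 0) (real st)) <= val e0.
Proof.
  intros H Egf Ht0 Eg0. pose proof (encl_collapse _ _ t0 Egf Ht0) as Eg. cbv beta in Eg.
  rewrite Eg0 in Eg.
  set (mg := collapse gm) in *.
  destruct (local_check_facts _ _ mg _ _ _ _ _ _ _ _ _ eq_refl H) as [P [d [EP [ED [B3 [B4 [B5 [B6
    [B7 [B8 [B9 [B10 [B11 [B12 [H1 [H2 H3]]]]]]]]]]]]]]]]. clear H.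
  apply val_le in B3, B4, B5, B6, B7, B8, B9, B10, B11, B12.
  val_simpl B3. val_simpl B4. val_simpl B5. val_simpl B6. val_simpl B7.
  val_simpl B8. val_simpl B9. val_simpl B10. val_simpl B11. val_simpl B12.
  assert (gf01 : forall t, 0 <= t <= 1 -> 1 / 10 <= gf t <= 3 / 20 /\
     - val (snd mg) <= gf t - val (mid mg) <= val (snd mg)).
  { intros t Ht. pose proof (encl_mid _ (gf t) _ (encl_collapse _ _ t Egf Ht) eq_refl) as Mg.
    fold mg in Mg. apply Rabs_le_between in Mg. lra. }
  destruct (gf01 t0 Ht0) as [Bg Mg]. rewrite Eg0 in Bg, Mg.
  assert (g01 : 0 < g < 1) by lra.
  pose proof (interval_params_sound gf gm t0
    ltac:(intros t Ht; destruct (gf01 t Ht); lra) Egf) as S.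
  rewrite EP in S. cbn [fst snd] in S. rewrite Eg0 in S.
  destruct (S eq_refl Ht0) as [EPs [disc0 l20]]. clear S.
  pose proof (local_defect_sound n P g mg amp X Y U V d g01 disc0 l20 Eg EPs ED) as Def.
  destruct EPs as [Emu [Ea [Eia [Eig [Ec [Elam Eeta]]]]]].
  pose proof (encl_mid _ (mu_of g) _ Emu eq_refl) as Mmu. apply Rabs_le_between in Mmu.
  pose proof (encl_mid _ (lam_of g) _ Elam eq_refl) as Mlam. apply Rabs_le_between in Mlam.
  assert (Adm : admissible g) by (repeat split; try assumption; lra).
  split; [exact Adm|]. split; [rewrite H3; exact Emu|].
  set (mu := mu_of g) in *. set (lam := lam_of g) in *. set (A := val amp) in *.
  set (p := manifold_curve g A X Y U V) in *. set (dp := manifold_tangent g A X Y U V) in *.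
  assert (d0 : 0 <= val d).
  { pose proof (Def 1 ltac:(lra)) as D1. pose proof (wnorm_ge0 (minus (field mu (p 1))
     (scal (lam * 1) (dp 1)))). lra. }
  assert (Xb : forall s, 0 <= s <= 1 -> Rabs (peval X s / IZR fone) <= val (psize X)).
  { intros s Hs. unfold val, Rdiv. rewrite Rabs_mult, (Rabs_pos_eq (/ _))
      by (left; apply Rinv_0_lt_compat, fone_pos).
    apply Rmult_le_compat_r; [left; apply Rinv_0_lt_compat, fone_pos|now apply peval_bound]. }
  assert (Tube : forall s z, 0 <= s <= 1 -> wnorm (minus z (p s)) <= val r * s ^ 2 ->
     away (17 / 20) (1 / 10) mu z).
  { intros s z Hs Hz. destruct (wnorm_coords (minus z (p s))) as [W _].
    pose proof (Rle_trans _ _ _ W Hz) as W'. clear W Hz.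
    destruct z as [[[x y] u] v]. unfold p, manifold_curve in W'. rewrite minus_state in W'.
    unfold cx in W'; cbn [fst snd] in W'.
    specialize (Xb s Hs). apply Rabs_le_between in Xb.
    set (f := peval X s / IZR fone) in *.
    pose proof (Rabs_pos (x - (x_of g + s * (A + s * f)))) as W0.
    assert (W2 : Rabs (x - (x_of g + s * (A + s * f))) <= val r * s ^ 2) by lra.
    clear W' W0. rename W2 into W'.
    apply Rabs_le_between in W'.
    assert (s2 : 0 <= s ^ 2 <= s) by nra.
    assert (xm : x - mu = - (1 - g) + (x - x_of g)) by (unfold x_of; fold mu; ring).
    assert (F1 : x - x_of g <= A + val (psize X) + val r) by nra.
    assert (F2 : 0 <= x - x_of g).
    { assert (0 <= s * (A - val (psize X) - val r)) by nra. nra. }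
    assert (Q : forall a b, Rabs a <= sqrt (a ^ 2 + b ^ 2)).
    { intros a b. rewrite <- (sqrt_pow2 (Rabs a)) by apply Rabs_pos.
      rewrite pow2_abs. apply sqrt_le_1_alt. nra. }
    split; unfold r1, r2.
    - eapply Rle_trans; [|apply Q]. rewrite Rabs_left1; lra.
    - eapply Rle_trans; [|apply Q]. rewrite Rabs_pos_eq; lra. }
  destruct (local_exists (17 / 20) (1 / 10) mu 12 5 lam (val r) (val d) p dp) as [z Hz];
    try lra.
  { nra. }
  { intros t. apply is_derive_manifold. }
  { intros t. apply continuous_manifold_tangent. }
  { exact Tube. }
  { exact Def. }
  assert (L0 : 0 < lam) by lra.
  assert (Es : forall t, t <= 0 -> 0 < exp (lam * t) <= 1).
  { intros t Ht. split; [apply exp_pos|]. rewrite <- exp_0. apply exp_le_mono. nra. }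
  exists (fun t => z (exp (lam * t))). split; [split; [|split]|].
  - intros t Ht. specialize (Es t Ht).
    destruct (Hz (exp (lam * t)) ltac:(lra)) as [Aw [_ D]]. specialize (D (proj1 Es)).
    split; [apply (away_weaken (17 / 20) (1 / 10)); try lra; exact Aw|].
    assert (De : is_derive (fun t : R => exp (lam * t)) t (lam * exp (lam * t)))
      by (auto_derive; [trivial|ring]).
    pose proof (is_derive_comp z (fun t => exp (lam * t)) t _ _ D De) as Dc.
    fold mu in Dc |- *.
    match type of Dc with is_derive _ _ ?l => replace (field mu (z (exp (lam * t)))) with l;
      [exact Dc|] end.
    generalize (field mu (z (exp (lam * t)))). intros [[[f1 f2] f3] f4].
    rewrite !scal_state. apply state_ext; field; split; apply Rgt_not_eq; lra.
  - intros t Ht. specialize (Es t Ht). apply (Hz (exp (lam * t))). lra.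
  - intros t Ht. specialize (Es t Ht). fold lam. set (s := exp (lam * t)) in *.
    destruct (Hz s ltac:(lra)) as [_ [B _]].
    eapply Rle_trans; [apply (wnorm_minus_triangle _ (p s))|].
    assert (Pb : forall Q, Rabs (s * (s * (peval Q s / IZR fone))) <= s ^ 2 * val (psize Q)).
    { intros Q. replace (s * (s * (peval Q s / IZR fone))) with (s ^ 2 * (peval Q s / IZR fone))
        by ring.
      rewrite Rabs_mult, (Rabs_pos_eq (s ^ 2)) by nra. apply Rmult_le_compat_l; [nra|].
      unfold val, Rdiv. rewrite Rabs_mult, (Rabs_pos_eq (/ _))
        by (left; apply Rinv_0_lt_compat, fone_pos).
      apply Rmult_le_compat_r; [left; apply Rinv_0_lt_compat, fone_pos|].
      apply peval_bound. lra. }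
    assert (Lp : wnorm (minus (p s) (linear_part A g s)) <=
      s ^ 2 * (3 * (val (psize X) + val (psize Y)) + val (psize U) + val (psize V))).
    { unfold p, manifold_curve, linear_part. rewrite minus_state.
      eapply Rle_trans; [apply wnorm_le_coords|].
      pose proof (Pb X). pose proof (Pb Y). pose proof (Pb U). pose proof (Pb V).
      match goal with |- 3 * (Rabs ?a + Rabs ?b) + Rabs ?e + Rabs ?f <= _ =>
        replace a with (s * (s * (peval X s / IZR fone))) by ring;
        replace b with (s * (s * (peval Y s / IZR fone))) by ring;
        replace e with (s * (s * (peval U s / IZR fone))) by ring;
        replace f with (s * (s * (peval V s / IZR fone))) by ring end.
      lra. }
    assert (0 <= s ^ 2) by nra. nra.
  - fold lam. rewrite Rmult_0_r, exp_0.
    destruct (Hz 1 ltac:(lra)) as [_ [B _]].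
    eapply Rle_trans; [apply (wnorm_minus_triangle _ (p 1))|].
    pose proof (encl_exact (amp :: nil)) as EA.
    apply (encl_ext _ (fun _ => A)) in EA.
    2: { intros t _. unfold A, val. cbn [peval]. now rewrite Rmult_0_r, Rplus_0_r. }
    assert (Kx : Rabs (x_of g + A - val (mid (start_x P amp))) <= val (snd (start_x P amp)))
      by exact (encl_mid _ _ _ (encl_add _ _ _ _ (encl_sub _ _ _ _ Emu Ea) EA) eq_refl).
    assert (Ky : Rabs (A * eta_of g - val (mid (start_y P amp))) <= val (snd (start_y P amp)))
      by exact (encl_mid _ _ _ (encl_mul 1 _ _ _ _ EA Eeta) eq_refl).
    assert (Ku : Rabs (A * (lam - eta_of g) - val (mid (start_u P amp))) <= val (snd (start_u P amp)))
      by exact (encl_mid _ _ _ (encl_mul 1 _ _ _ _ EA (encl_sub _ _ _ _ Elam Eeta)) eq_refl).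
    assert (Kv : Rabs (x_of g + A * (lam * eta_of g + 1) - val (mid (start_v P amp))) <= val (snd (start_v P amp)))
      by exact (encl_mid _ _ _ (encl_add _ _ _ _ (encl_sub _ _ _ _ Emu Ea) (encl_mul 1 _ _ _ _ EA
        (encl_add _ _ _ _ (encl_mul 1 _ _ _ _ Elam Eeta) encl_one))) eq_refl).
    assert (Kp : wnorm (minus (p 1) (real st)) <= val e0 - val r).
    { rewrite H1, H2. unfold p, manifold_curve, real. rewrite minus_state.
      eapply Rle_trans; [apply wnorm_le_coords|].
      rewrite !peval_1, !val_add, val_scale, !val_add. fold lam.
      change (IZR (psum X) / IZR fone) with (val (psum X)).
      change (IZR (psum Y) / IZR fone) with (val (psum Y)).
      change (IZR (psum U) / IZR fone) with (val (psum U)).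
      change (IZR (psum V) / IZR fone) with (val (psum V)).
      match goal with |- 3 * (Rabs ?a + Rabs ?b) + Rabs ?e + Rabs ?f <= _ =>
      match type of Kx with Rabs ?k <= _ => replace a with k by ring end;
      match type of Ky with Rabs ?k <= _ => replace b with k by ring end;
      match type of Ku with Rabs ?k <= _ => replace e with k by ring end;
      match type of Kv with Rabs ?k <= _ => replace f with k by ring end end.
      lra. }
    lra.
Qed.

(** * Certified integrations *)

Definition sharp_check (N n : nat) (g amp : Z) (X Y U V : list Z) (r rad : Z) (hs : list Z)
  : option (zstate * Z) :=
  match local_check N (g :: nil, 0%Z) amp X Y U V r with
  | Some (st, e0, mm) => run n (mid mm) (snd mm) rad hs st e0
  | None => None
  end.

(** After the run a single last step is made, whose whole course is enclosed. *)
Definition wide_check (N n : nat) (mg : tm) (amp : Z) (X Y U V : list Z) (r rad : Z)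
  (hs : list Z) (h : Z) : option (tm * (zstate * Z * Z) * (zstate * Z)) :=
  match local_check N mg amp X Y U V r with
  | Some (st, e0, mm) =>
    match run n (mid mm) (snd mm) rad hs st e0 with
    | Some (st1, e1) =>
      match step n (mid mm) (snd mm) rad h st1 e1 with
      | Some (st2, e2, var) => Some (mm, (st1, e1, var), (st2, e2))
      | None => None
      end
    | None => None
    end
  | None => None
  end.

Lemma encl_mid_Z f c m : encl f m -> f 1 = c -> Rabs (IZR fone * c - IZR (mid m)) <= IZR (snd m).
Proof.
  intros E <-. specialize (E 1 ltac:(lra)). rewrite peval_1 in E. exact E.
Qed.

Lemma branch_extend amp g y y' T : 0 <= T -> branch amp g 0 y ->
  (forall t, t <= T -> sol (mu_of g) y' t) -> (forall t, t <= 0 -> y' t = y t) ->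
  branch amp g T y'.
Proof.
  intros HT [_ [B C]] S E. split; [exact S|]. split; intros t Ht; rewrite E by exact Ht; auto.
Qed.

Lemma sharp_sound N n g amp X Y U V r rad hs st e :
  sharp_check N n g amp X Y U V r rad hs = Some (st, e) ->
  0 <= val (total hs) /\
  exists y, branch (val amp) (val g) (val (total hs)) y /\
    wnorm (minus (y (val (total hs))) (real st)) <= val e.
Proof.
  unfold sharp_check. intros H.
  destruct (local_check N (g :: nil, 0%Z) amp X Y U V r) as [[[st0 e0] mm]|] eqn:L;
    [|discriminate].
  assert (Eg : encl (fun _ => val g) (g :: nil, 0%Z)).
  { apply encl_const. pose proof fone_pos. unfold val.
    replace (IZR fone * (IZR g / IZR fone) - IZR g) with 0 by (field; lra).
    rewrite Rabs_R0. lra. }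
  destruct (local_sound _ _ _ _ _ _ _ _ _ _ _ (fun _ => val g) 0 (val g) L Eg ltac:(lra) eq_refl)
    as [_ [Em [y [By Hy]]]].
  pose proof (encl_mid_Z _ _ _ Em eq_refl) as Hm.
  destruct (run_sound _ _ _ _ _ _ _ _ _ _ y 0 H Hm (proj1 By) Hy) as [T0 [y' [S' [A' B']]]].
  split; [exact T0|]. rewrite Rplus_0_l in S', B'. exists y'. split; [|exact B'].
  exact (branch_extend _ _ _ _ _ T0 By S' A').
Qed.

Lemma wide_sound N n mg amp X Y U V r rad hs h mm st1 e1 var st2 e gf t0 g :
  wide_check N n mg amp X Y U V r rad hs h = Some (mm, (st1, e1, var), (st2, e)) ->
  encl gf mg -> 0 <= t0 <= 1 -> gf t0 = g ->
  0 <= val (total hs) < val (total hs) + val h /\ admissible g /\ encl (fun _ => mu_of g) mm /\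
  exists y, branch (val amp) g (val (total hs) + val h) y /\
    wnorm (minus (y (val (total hs))) (real st1)) <= val e1 /\
    (forall t, val (total hs) <= t <= val (total hs) + val h ->
       wnorm (minus (y t) (real st1)) <= val var) /\
    wnorm (minus (y (val (total hs) + val h)) (real st2)) <= val e.
Proof.
  unfold wide_check. intros H Egf Ht0 Eg0.
  destruct (local_check N mg amp X Y U V r) as [[[st0 e0] mm']|] eqn:L; [|discriminate].
  destruct (run n (mid mm') (snd mm') rad hs st0 e0) as [[st1' e1']|] eqn:Rn; [|discriminate].
  destruct (step n (mid mm') (snd mm') rad h st1' e1') as [[[st2' e2] var']|] eqn:Sp; [|discriminate].
  destruct (some_triple_inj _ _ _ _ _ _ H) as [E1 [E2 E3]]. clear H. subst mm'.
  assert (E2a : st1' = st1) by exact (f_equal (fun p => fst (fst p)) E2).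
  assert (E2c : e1' = e1) by exact (f_equal (fun p => snd (fst p)) E2).
  assert (E2b : var' = var) by exact (f_equal snd E2).
  assert (E3a : st2' = st2) by exact (f_equal fst E3).
  assert (E3b : e2 = e) by exact (f_equal snd E3).
  subst st1' var' st2' e2 e1'. clear E2 E3.
  destruct (local_sound _ _ _ _ _ _ _ _ _ _ _ gf t0 g L Egf Ht0 Eg0) as [Adm [Em [y [By Hy]]]].
  pose proof (encl_mid_Z _ _ _ Em eq_refl) as Hm.
  destruct (run_sound _ _ _ _ _ _ _ _ _ _ y 0 Rn Hm (proj1 By) Hy) as [T0 [y' [S' [A' B']]]].
  rewrite Rplus_0_l in S', B'.
  destruct (step_sound _ _ _ _ _ _ _ _ _ _ _ _ Sp Hm B') as [h0 [w [W0 [Hw W1]]]].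
  destruct (sol_extend _ y' w (val (total hs)) (val h) h0 S' W0) as [y2 [S2 [A2 B2]]].
  { intros t Ht. apply Hw, Ht. }
  split; [lra|]. split; [exact Adm|]. split; [exact Em|].
  exists y2. split; [|split; [|split]].
  - apply (branch_extend _ _ y); [lra|exact By|exact S2|].
    intros t Ht. rewrite A2 by lra. now apply A'.
  - rewrite A2 by lra. exact B'.
  - intros t Ht. rewrite B2 by lra. apply Hw. lra.
  - rewrite B2 by lra.
    replace (val (total hs) + val h - val (total hs)) with (val h) by ring. exact W1.
Qed.

(** * Dependence of the branch on the parameter *)

Lemma kepler_norm rho x y : 0 < rho -> rho <= sqrt (x ^ 2 + y ^ 2) ->
  fst (kepler x y) ^ 2 + snd (kepler x y) ^ 2 <= ((/ rho) ^ 2) ^ 2.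
Proof.
  intros Hr H. cbn [kepler fst snd].
  assert (N : sqrt (x ^ 2 + y ^ 2) ^ 2 = x ^ 2 + y ^ 2) by (apply pow2_sqrt; nra).
  set (r := sqrt (x ^ 2 + y ^ 2)) in *.
  replace ((x * / r ^ 3) ^ 2 + (y * / r ^ 3) ^ 2) with (((/ r) ^ 2) ^ 2).
  - assert (0 < / r) by (apply Rinv_0_lt_compat; lra).
    apply pow_incr. split; [apply pow2_ge_0|].
    apply pow_incr. split; [lra|]. apply Rinv_le_contravar; lra.
  - transitivity ((x ^ 2 + y ^ 2) * (/ r ^ 3) ^ 2); [rewrite <- N; field; lra|ring].
Qed.

Lemma radius_shift a b y : sqrt (b ^ 2 + y ^ 2) - Rabs (a - b) <= sqrt (a ^ 2 + y ^ 2).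
Proof.
  pose proof (planar_triangle b y a y) as T.
  assert (E : sqrt ((b - a) ^ 2 + (y - y) ^ 2) = Rabs (a - b)).
  { rewrite Rabs_minus_sym, <- sqrt_Rsqr_abs. f_equal. unfold Rsqr. ring. }
  rewrite E in T. lra.
Qed.

Lemma away_shift rho1 rho2 mu mu' z d : Rabs (mu - mu') <= d ->
  away rho1 rho2 mu' z -> away (rho1 - d) (rho2 - d) mu z.
Proof.
  intros Hd. destruct z as [[[x y] u] v]. intros [A B]. unfold r1, r2 in *. 
  pose proof (radius_shift (x - mu) (x - mu') y) as S1.
  pose proof (radius_shift (x - mu + 1) (x - mu' + 1) y) as S2.
  replace (x - mu - (x - mu')) with (- (mu - mu')) in S1 by ring.
  replace (x - mu + 1 - (x - mu' + 1)) with (- (mu - mu')) in S2 by ring.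
  rewrite Rabs_Ropp in S1, S2. split; unfold r1, r2; lra.
Qed.

(** Changing mu shifts both primaries and redistributes the mass between them; the first effect
    is bounded by the tidal force, the second by the attraction itself. *)
Lemma field_parameter_lipschitz mu mu' z :
  0 <= mu <= 1 -> 0 <= mu' <= 1 ->
  away (9 / 100) (9 / 100) mu z -> away (9 / 100) (9 / 100) mu' z ->
  wnorm (minus (field mu z) (field mu' z)) <= 4000 * Rabs (mu - mu').
Proof.
  intros H H' A B. destruct z as [[[x y] u] v]. destruct A as [A1 A2], B as [B1 B2].
  unfold r1, r2 in *.
  assert (P : 0 < 9 / 100) by lra.
  pose proof (kepler_lipschitz _ _ _ _ _ P A1 B1) as L1.
  pose proof (kepler_lipschitz _ _ _ _ _ P A2 B2) as L2.
  pose proof (kepler_norm _ _ _ P B1) as N1. pose proof (kepler_norm _ _ _ P B2) as N2.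
  replace (x - mu - (x - mu')) with (- (mu - mu')) in L1 by ring.
  replace (x - mu + 1 - (x - mu' + 1)) with (- (mu - mu')) in L2 by ring.
  rewrite Rminus_diag in L1, L2.
  cbn [field force fst snd]. rewrite minus_state.
  set (a1 := fst (kepler (x - mu) y)) in *. set (b1 := snd (kepler (x - mu) y)) in *.
  set (a2 := fst (kepler (x - mu + 1) y)) in *. set (b2 := snd (kepler (x - mu + 1) y)) in *.
  set (c1 := fst (kepler (x - mu') y)) in *. set (d1 := snd (kepler (x - mu') y)) in *.
  set (c2 := fst (kepler (x - mu' + 1) y)) in *. set (d2 := snd (kepler (x - mu' + 1) y)) in *.
  clearbody a1 b1 a2 b2 c1 d1 c2 d2.
  set (D := Rabs (mu - mu')). assert (D0 : 0 <= D) by apply Rabs_pos.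
  assert (D2 : D ^ 2 = (mu - mu') ^ 2) by apply pow2_abs.
  replace ((- (mu - mu')) ^ 2 + 0 ^ 2) with (D ^ 2) in L1, L2 by (rewrite D2; ring).
  match goal with |- wnorm ?w <= _ => replace w with
    (plus (plus (scal (1 - mu) ((0, 0, - (a1 - c1), - (b1 - d1)) : state))
                (scal mu ((0, 0, - (a2 - c2), - (b2 - d2)) : state)))
      (plus (scal (mu - mu') ((0, 0, c1, d1) : state))
            (scal (mu' - mu) ((0, 0, c2, d2) : state))))
    by (rewrite !scal_state, !plus_state; apply state_ext; ring) end.
  assert (Q : forall a b k, 0 <= k -> a ^ 2 + b ^ 2 <= k ^ 2 -> wnorm (0, 0, a, b) <= k).
  { intros a b k Hk Hab. rewrite wnorm_eq. rewrite <- (sqrt_pow2 k Hk).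
    apply sqrt_le_1_alt. lra. }
  (* 2 / 0.09^3 < 3000 and 1 / 0.09^2 < 200 *)
  assert (M1 : wnorm (0, 0, - (a1 - c1), - (b1 - d1)) <= 3000 * D).
  { apply Q; [lra|]. nra. }
  assert (M2 : wnorm (0, 0, - (a2 - c2), - (b2 - d2)) <= 3000 * D).
  { apply Q; [lra|]. nra. }
  assert (M3 : wnorm (0, 0, c1, d1) <= 200).
  { apply Q; [lra|]. eapply Rle_trans; [exact N1|]. apply pow_incr. lra. }
  assert (M4 : wnorm (0, 0, c2, d2) <= 200).
  { apply Q; [lra|]. eapply Rle_trans; [exact N2|]. apply pow_incr. lra. }
  eapply Rle_trans; [apply wnorm_plus|].
  eapply Rle_trans; [apply Rplus_le_compat; apply wnorm_plus|].
  rewrite !wnorm_scal. rewrite (Rabs_pos_eq mu), (Rabs_pos_eq (1 - mu)) by lra.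
  rewrite (Rabs_minus_sym mu' mu). fold D.
  repeat match goal with |- context [wnorm ?w] => generalize (wnorm_ge0 w);
    generalize dependent (wnorm w); intros end.
  nra.
Qed.

Lemma scal_one_state (z : state) : scal 1 z = z.
Proof. destruct z as [[[x y] u] v]. rewrite scal_state. apply state_ext; ring. Qed.

(** A solution for mu' is an approximate solution for mu. The distances 1/100 absorb the shift of
    the primaries. *)
Lemma compare rho1 rho2 mu mu' G (y y' : R -> state) a b :
  1 / 10 <= rho1 -> 1 / 10 <= rho2 -> a <= b ->
  0 <= mu <= 43 / 10000 -> 0 <= mu' <= 43 / 10000 ->
  2 * ((1 - mu) / (rho1 - 1 / 100) ^ 3 + mu / (rho2 - 1 / 100) ^ 3) <= G ->
  (forall t, a <= t <= b -> away rho1 rho2 mu (y t) /\ is_derive y t (field mu (y t))) ->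
  (forall t, a <= t <= b -> away rho1 rho2 mu' (y' t) /\ is_derive y' t (field mu' (y' t))) ->
  wnorm (minus (y b) (y' b)) <= exp ((9 + G) / 6 * (b - a)) *
    (wnorm (minus (y a) (y' a)) + 4000 * Rabs (mu - mu') * (b - a)).
Proof.
  intros P1 P2 Hab Hm Hm' HG Hy Hy'.
  assert (Dm : Rabs (mu - mu') <= 1 / 100) by (apply Rabs_le; lra).
  replace ((9 + G) / 6 * (b - a)) with (1 * ((9 + G) / 6) * (b - a)) by ring.
  apply (shadow (rho1 - 1 / 100) (rho2 - 1 / 100) mu G 1 (4000 * Rabs (mu - mu'))
    y y' (fun t => field mu' (y' t))); try lra.
  - pose proof (Rabs_pos (mu - mu')). lra.
  - intros t Ht. rewrite scal_one_state. apply Hy, Ht.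
  - intros t Ht. apply Hy', Ht.
  - intros t Ht. split.
    + apply (away_weaken rho1 rho2); try lra. apply Hy, Ht.
    + apply (away_shift _ _ mu mu'); [exact Dm|]. apply Hy', Ht.
  - intros t Ht. rewrite scal_one_state.
    destruct (Hy' t Ht) as [A _].
    apply field_parameter_lipschitz; try lra.
    + apply (away_weaken (rho1 - 1 / 100) (rho2 - 1 / 100)); try lra.
      apply (away_shift _ _ mu mu'); [exact Dm|exact A].
    + apply (away_weaken rho1 rho2); try lra. exact A.
Qed.

Lemma state_delta (w : R -> state) g eps : continuous w g -> 0 < eps ->
  exists delta : R, 0 < delta /\ forall g', Rabs (g' - g) < delta ->
    wnorm (minus (w g') (w g)) < eps.
Proof.
  intros C He. assert (P : 0 < eps / 3) by lra.
  destruct (proj1 (filterlim_locally_ball_norm w (w g)) C (mkposreal _ P)) as [d Hd].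
  exists d. split; [apply cond_pos|]. intros g' Hg'.
  specialize (Hd g' Hg'). unfold ball_norm in Hd. cbn [pos] in Hd.
  pose proof (wnorm_le_norm (minus (w g') (w g))) as B.
  assert (Hd' : norm (minus (w g') (w g)) < eps / 3) by exact Hd. lra.
Qed.

Lemma ex_derive_params g : admissible g ->
  ex_derive mu_of g /\ ex_derive lam_of g /\ ex_derive eta_of g /\ ex_derive x_of g.
Proof.
  intros [Hg [Hd [Hl [Hm HL]]]].
  assert (M : ex_derive mu_of g).
  { assert (1 < / (1 - g)) by (rewrite <- Rinv_1; apply Rinv_lt_contravar; lra).
    assert (1 < / g) by (rewrite <- Rinv_1; apply Rinv_lt_contravar; lra).
    unfold mu_of. auto_derive. repeat split; try lra.
    change (1 + - g) with (1 - g).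
    apply Rgt_not_eq.
    assert (0 < / (1 - g) * / (1 - g) + / g * / g - 1) by nra. lra. }
  assert (C : ex_derive c_of g).
  { unfold c_of. auto_derive. repeat split; try assumption; lra. }
  assert (D : ex_derive disc_of g) by (unfold disc_of; auto_derive; repeat split; assumption).
  assert (L2 : ex_derive lam2_of g).
  { unfold lam2_of. auto_derive. repeat split; try assumption. }
  assert (L : ex_derive lam_of g).
  { unfold lam_of. auto_derive. repeat split; assumption. }
  split; [exact M|]. split; [exact L|]. split.
  - unfold eta_of. auto_derive. repeat split; try assumption. lra.
  - unfold x_of. auto_derive. repeat split; assumption.
Qed.

Lemma continuous_linear_part amp t g : admissible g ->
  continuous (fun g => linear_part amp g (exp (lam_of g * t))) g.
Proof.
  intros A. destruct (ex_derive_params g A) as [M [L [E X]]].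
  unfold linear_part.
  assert (D : forall f : R -> R, ex_derive f g -> is_derive f g (Derive f g))
    by (intros; now apply Derive_correct).
  refine (continuous_of_derive _ _ _ (is_derive_state _ _ _ _ g _ _ _ _ (D _ _) (D _ _) (D _ _) (D _ _)));
    auto_derive; repeat split; assumption.
Qed.

(** At time -tau, far in the past, both branches are within exp (- 11/2 tau) of their linear parts,
    and the linear parts depend continuously on g. From there to 0 errors grow at most
    at the rate (9 + 16) / 6 < 11/2, and on the compact interval [0, T] by a fixed factor. *)
Lemma branch_close amp g T eps : admissible g -> 0 <= T -> 0 < eps ->
  exists delta, 0 < delta /\ forall g' y y', Rabs (g' - g) < delta -> admissible g' ->
    branch amp g T y -> branch amp g' T y' ->
    forall t, 0 <= t <= T -> wnorm (minus (y t) (y' t)) < eps.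
Proof.
  intros Ag HT He.
  set (A := exp ((9 + 2800) / 6 * T)). assert (A0 : 0 < A) by apply exp_pos.
  (* tau is so large that the distance exp (- 11/2 tau) from the linear parts, amplified by B up to
     time 0 and by A up to T, stays below eps. The tidal force is at most 2800 at distances
     9/100 from the primaries, and at most 16 at distances 84/100 and 9/100. *)
  set (tau := 4 * A / eps).
  assert (tau0 : 0 < tau) by (unfold tau; apply Rdiv_lt_0_compat; lra).
  set (B := exp ((9 + 16) / 6 * tau)). assert (B0 : 0 < B) by apply exp_pos.
  assert (Small : 2 * A * (B * exp (- (11 / 2) * tau)) < eps / 2).
  { unfold B. rewrite <- exp_plus.
    replace ((9 + 16) / 6 * tau + - (11 / 2) * tau) with (- (4 / 3 * tau)) by field.
    rewrite exp_Ropp. pose proof (exp_ineq1 (4 / 3 * tau) ltac:(lra)) as I.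
    assert (tau < exp (4 / 3 * tau)) by lra.
    assert (/ exp (4 / 3 * tau) < / tau) by (apply Rinv_lt_contravar; [nra|assumption]).
    replace (eps / 2) with (2 * A * / tau) by (unfold tau; field; lra).
    apply Rmult_lt_compat_l; lra. }
  destruct (ex_derive_params g Ag) as [Mg _].
  set (k := A * (B * (4000 * tau)) + A * (4000 * T) + 1).
  assert (k0 : 0 < k).
  { pose proof (Rmult_lt_0_compat _ _ A0 (Rmult_lt_0_compat _ _ B0 tau0)).
    pose proof (Rmult_le_pos _ _ (Rlt_le _ _ A0) HT). unfold k. lra. }
  destruct (state_delta _ g (eps / (8 * (A * B))) (continuous_linear_part amp (- tau) g Ag))
    as [d1 [d10 H1]].
  { apply Rdiv_lt_0_compat; [lra|]. pose proof (Rmult_lt_0_compat _ _ A0 B0). lra. }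
  assert (Cmu : continuous mu_of g) by (apply (ex_derive_continuous mu_of), Mg).
  assert (Pk : 0 < eps / (8 * k)) by (apply Rdiv_lt_0_compat; lra).
  destruct (proj1 (filterlim_locally mu_of (mu_of g)) Cmu (mkposreal _ Pk)) as [d2 H2].
  exists (Rmin d1 d2). split; [apply Rmin_glb_lt; [exact d10|apply cond_pos]|].
  intros g' y y' Hg' Ag' [S [Aw Ly]] [S' [Aw' Ly']] t Ht.
  specialize (H1 g' (Rlt_le_trans _ _ _ Hg' (Rmin_l _ _))).
  assert (H3 : Rabs (mu_of g' - mu_of g) < eps / (8 * k))
    by exact (H2 g' (Rlt_le_trans _ _ _ Hg' (Rmin_r _ _))). clear H2.
  rewrite Rabs_minus_sym in H3. set (dm := Rabs (mu_of g - mu_of g')) in *.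
  assert (dm0 : 0 <= dm) by apply Rabs_pos.
  destruct Ag as [G1 [_ [_ [G2 G3]]]], Ag' as [G1' [_ [_ [G2' G3']]]].
  assert (C1 : wnorm (minus (y 0) (y' 0)) <= B *
    (wnorm (minus (y (- tau)) (y' (- tau))) + 4000 * dm * tau)).
  { pose proof (compare (17 / 20) (1 / 10) (mu_of g) (mu_of g') 16 y y' (- tau) 0) as C.
    replace (0 - - tau) with tau in C by ring.
    apply C; try lra.
    - intros s Hs. split; [apply Aw; lra|apply S; lra].
    - intros s Hs. split; [apply Aw'; lra|apply S'; lra]. }
  assert (C2 : wnorm (minus (y t) (y' t)) <= A *
    (wnorm (minus (y 0) (y' 0)) + 4000 * dm * T)).
  { eapply Rle_trans.
    - apply (compare (1 / 10) (1 / 10) (mu_of g) (mu_of g') 2800 y y' 0 t); try lra.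
      + intros s Hs. apply S; lra.
      + intros s Hs. apply S'; lra.
    - rewrite Rminus_0_r. fold dm.
      pose proof (wnorm_ge0 (minus (y 0) (y' 0))).
      assert (dm * t <= dm * T) by (apply Rmult_le_compat_l; lra).
      assert (0 <= dm * t) by (apply Rmult_le_pos; lra).
      apply Rmult_le_compat; [left; apply exp_pos|lra| |lra].
      apply exp_le_mono. nra. }
  assert (C3 : wnorm (minus (y (- tau)) (y' (- tau)))
    <= 2 * exp (- (11 / 2) * tau) + eps / (8 * (A * B))).
  { specialize (Ly (- tau) ltac:(lra)). specialize (Ly' (- tau) ltac:(lra)).
    assert (Q : forall l, 11 / 4 <= l -> exp (l * - tau) ^ 2 <= exp (- (11 / 2) * tau)).
    { intros l Hl. simpl. rewrite Rmult_1_r, <- exp_plus. apply exp_le_mono. nra. }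
    pose proof (Q _ G3). pose proof (Q _ G3').
    set (p := linear_part amp g (exp (lam_of g * - tau))) in *.
    set (p' := linear_part amp g' (exp (lam_of g' * - tau))) in *.
    pose proof (wnorm_minus_triangle (y (- tau)) p (y' (- tau))) as W1.
    pose proof (wnorm_minus_triangle p p' (y' (- tau))) as W2.
    rewrite (wnorm_minus_sym p p') in W2. rewrite (wnorm_minus_sym p' (y' _)) in W2. lra. }
  eapply Rle_lt_trans; [exact C2|].
  set (W := wnorm (minus (y 0) (y' 0))) in *.
  set (V := wnorm (minus (y (- tau)) (y' (- tau)))) in *.
  set (E := exp (- (11 / 2) * tau)) in *.
  apply Rle_lt_trans with (2 * A * (B * E) + eps / 8 + k * dm).
  - apply Rle_trans with (A * (B * (2 * E + eps / (8 * (A * B)) + 4000 * dm * tau) + 4000 * dm * T)).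
    + apply Rmult_le_compat_l; [lra|]. apply Rplus_le_compat_r.
      eapply Rle_trans; [exact C1|]. apply Rmult_le_compat_l; lra.
    + unfold k. replace (eps / 8) with (A * B * (eps / (8 * (A * B)))) by (field; lra).
      nra.
  - assert (k * dm < eps / 8).
    { replace (eps / 8) with (k * (eps / (8 * k))) by (field; lra).
      apply Rmult_lt_compat_l; assumption. }
    lra.
Qed.

Lemma branch_unique amp g T y y' : admissible g -> 0 <= T ->
  branch amp g T y -> branch amp g T y' -> forall t, 0 <= t <= T -> y t = y' t.
Proof.
  intros Ag HT B B' t Ht.
  assert (Z : norm (minus (y t) (y' t)) <= 0).
  { apply le_epsilon. intros eps He. rewrite Rplus_0_l.
    destruct (branch_close amp g T eps Ag HT He) as [d [d0 H]].
    eapply Rle_trans; [apply norm_le_wnorm|]. left.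
    apply (H g); try assumption. rewrite Rminus_diag, Rabs_R0. exact d0. }
  pose proof (norm_ge_0 (minus (y t) (y' t))) as N.
  assert (N0 : norm (minus (y t) (y' t)) = 0) by (apply Rle_antisym; [exact Z|exact N]).
  apply norm_eq_zero in N0.
  destruct (y t) as [[[a b] c] d], (y' t) as [[[a' b'] c'] d'].
  rewrite minus_state in N0. 
  pose proof (f_equal cx N0) as E1. pose proof (f_equal cy N0) as E2.
  pose proof (f_equal cu N0) as E3. pose proof (f_equal cv N0) as E4.
  unfold cx, cy, cu, cv in *; cbn [fst snd] in *.
  change (a - a' = 0) in E1. change (b - b' = 0) in E2. change (c - c' = 0) in E3.
  change (d - d' = 0) in E4.
  apply state_ext; lra.
Qed.

(** * Shooting *)

(** A transversal crossing of Y = 0. That P_X does not increase transfers its sign from nearby times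
    to the crossing. *)
Record window (amp g m T1 T2 : R) (y : R -> state) : Prop := {
  window_branch : branch amp g T2 y;
  window_start : cy (y T1) < 0;
  window_end : 0 < cy (y T2);
  window_rise : forall t, T1 <= t <= T2 -> m <= cy (field (mu_of g) (y t));
  window_fall : forall t, T1 <= t <= T2 -> cu (field (mu_of g) (y t)) <= 0 }.

Lemma branch_restrict amp g T T' y : T' <= T -> branch amp g T y -> branch amp g T' y.
Proof. intros H [A [B C]]. split; [|split; assumption]. intros t Ht. apply A. lra. Qed.

Lemma is_derive_linear_minus (k l t : R) (f : R -> R) : is_derive f t l ->
  is_derive (fun r => k * r - f r) t (k - l).
Proof.
  intros D. auto_derive; [eexists; exact D|]. rewrite (Derive_value _ _ _ D). ring.
Qed.

Section Window.
Variables (amp g m T1 T2 : R) (y : R -> state).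
Hypothesis W : window amp g m T1 T2 y.

Lemma window_derive t : t <= T2 ->
  is_derive (fun s => cy (y s)) t (cy (field (mu_of g) (y t))) /\
  is_derive (fun s => cu (y s)) t (cu (field (mu_of g) (y t))).
Proof.
  intros Ht. destruct (window_branch _ _ _ _ _ _ W) as [S _]. destruct (S t Ht) as [_ D].
  destruct (is_derive_coords y t _ D) as [_ [Dy [Du _]]]. split; assumption.
Qed.

Lemma window_height s t : T1 <= s -> s <= t -> t <= T2 -> m * (t - s) <= cy (y t) - cy (y s).
Proof.
  intros H1 H2 H3.
  pose proof (decreasing_of_derive (fun r => m * r - cy (y r))
    (fun r => m - cy (field (mu_of g) (y r))) s t H2) as D.
  assert (Q : m * t - cy (y t) <= m * s - cy (y s)).
  { apply D.
    - intros r Hr. destruct (window_derive r ltac:(lra)) as [D' _].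
      exact (is_derive_linear_minus m _ r _ D').
    - intros r Hr. pose proof (window_rise _ _ _ _ _ _ W r ltac:(lra)). lra. }
  lra.
Qed.

Lemma window_momentum s t : T1 <= s -> s <= t -> t <= T2 -> cu (y t) <= cu (y s).
Proof.
  intros H1 H2 H3.
  apply (decreasing_of_derive (fun r => cu (y r)) (fun r => cu (field (mu_of g) (y r)))); [exact H2| |].
  - intros r Hr. destruct (window_derive r ltac:(lra)) as [_ D]. exact D.
  - intros r Hr. apply (window_fall _ _ _ _ _ _ W). lra.
Qed.

Lemma window_crossing : T1 < T2 -> exists tau, T1 <= tau <= T2 /\ cy (y tau) = 0.
Proof.
  intros H.
  destruct (IVT_interv (fun t => cy (y t)) T1 T2) as [tau [Ht E]].
  - intros t Ht. apply continuity_pt_filterlim, (ex_derive_continuous (fun t => cy (y t))).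
    destruct (window_derive t ltac:(lra)) as [D _]. exact (ex_intro _ _ D).
  - exact H.
  - apply (window_start _ _ _ _ _ _ W).
  - apply (window_end _ _ _ _ _ _ W).
  - exists tau. split; assumption.
Qed.
End Window.

Lemma minus_coords (a b : state) :
  cy (minus a b) = cy a - cy b /\ cu (minus a b) = cu a - cu b.
Proof. destruct a as [[[? ?] ?] ?], b as [[[? ?] ?] ?]. split; reflexivity. Qed.

(** Since Y rises at rate m or more, crossing times of neighbouring branches are close. *)
Lemma crossing_close amp g m T1 T2 y tau eps :
  admissible g -> 0 < m -> 0 <= T1 -> window amp g m T1 T2 y -> T1 <= tau <= T2 ->
  cy (y tau) = 0 -> 0 < eps ->
  exists delta, 0 < delta /\ forall g' y' tau', Rabs (g' - g) < delta -> admissible g' ->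
    branch amp g' T2 y' -> T1 <= tau' <= T2 -> cy (y' tau') = 0 ->
    Rabs (cu (y' tau') - cu (y tau)) < eps.
Proof.
  intros Ag m0 T0 W Ht E He.
  assert (C : continuous (fun t => cu (y t)) tau).
  { apply (ex_derive_continuous (fun t => cu (y t))).
    destruct (window_derive _ _ _ _ _ _ W tau ltac:(lra)) as [_ D]. exact (ex_intro _ _ D). }
  assert (He2 : 0 < eps / 2) by lra.
  destruct (proj1 (filterlim_locally (fun t => cu (y t)) (cu (y tau))) C (mkposreal _ He2))
    as [eta Heta].
  set (e := Rmin (eps / 2) (3 * (m * eta))).
  pose proof (cond_pos eta) as eta0.
  assert (e0 : 0 < e) by (apply Rmin_glb_lt; nra).
  destruct (branch_close amp g T2 e Ag ltac:(lra) e0) as [d [d0 H]].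
  exists d. split; [exact d0|]. intros g' y' tau' Hg Ag' B' Ht' E'.
  specialize (H g' y y' Hg Ag' (window_branch _ _ _ _ _ _ W) B' tau' ltac:(lra)).
  destruct (wnorm_coords (minus (y tau') (y' tau'))) as [_ [Q1 [Q2 _]]].
  destruct (minus_coords (y tau') (y' tau')) as [M1 M2]. rewrite M1 in Q1. rewrite M2 in Q2.
  rewrite E', Rminus_0_r in Q1.
  pose proof (Rmin_l (eps / 2) (3 * (m * eta))) as R1.
  pose proof (Rmin_r (eps / 2) (3 * (m * eta))) as R2. fold e in R1, R2.
  assert (N : Rabs (cy (y tau')) < m * eta) by lra.
  apply Rabs_def2 in N.
  assert (F : Rabs (tau' - tau) < eta).
  { apply Rabs_def1; apply Rmult_lt_reg_l with m; try exact m0.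
    - destruct (Rle_lt_dec tau tau') as [L|L]; [|nra].
      pose proof (window_height _ _ _ _ _ _ W tau tau' ltac:(lra) L ltac:(lra)). lra.
    - destruct (Rle_lt_dec tau' tau) as [L|L]; [|nra].
      pose proof (window_height _ _ _ _ _ _ W tau' tau ltac:(lra) L ltac:(lra)). lra. }
  assert (G : Rabs (cu (y tau') - cu (y tau)) < eps / 2) by exact (Heta tau' F).
  replace (cu (y' tau') - cu (y tau))
    with (- (cu (y tau') - cu (y' tau')) + (cu (y tau') - cu (y tau))) by ring.
  eapply Rle_lt_trans; [apply Rabs_triang|]. rewrite Rabs_Ropp. lra.
Qed.

(** P_X at the crossing, as a function of g, is continuous by [crossing_close]. Its signs at the ends
    are read off at times slightly before and after the crossing, respectively: Y < 0 and P_X < 0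
    imply P_X < 0 later at the crossing, as P_X does not increase; Y > 0 and P_X > 0 imply
    P_X > 0 earlier. *)
Theorem shooting amp gm gp m T1 T2 : gm < gp -> 0 < m -> 0 <= T1 -> T1 < T2 ->
  (forall g, gm <= g <= gp -> admissible g /\ exists y, window amp g m T1 T2 y) ->
  (exists y t, T1 <= t <= T2 /\ branch amp gm t y /\ cy (y t) < 0 /\ cu (y t) < 0) ->
  (exists y t, T1 <= t <= T2 /\ branch amp gp t y /\ 0 < cy (y t) /\ 0 < cu (y t)) ->
  exists g y tau, gm <= g <= gp /\ admissible g /\ window amp g m T1 T2 y /\
    T1 <= tau <= T2 /\ cy (y tau) = 0 /\ cu (y tau) = 0.
Proof.
  intros Hg m0 T0 HT Win [ym [tm [Htm [Bm [Ym Um]]]]] [yp [tp [Htp [Bp [Yp Up]]]]].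
  (* Projection onto the interval of g, as [IVT] asks for continuity on the whole line. *)
  set (pr := fun g => Rmax gm (Rmin g gp)).
  assert (Pr : forall g, gm <= pr g <= gp).
  { intros g. unfold pr. split; [apply Rmax_l|]. apply Rmax_lub; [lra|apply Rmin_r]. }
  assert (Pi : forall g, gm <= g <= gp -> pr g = g).
  { intros g H. unfold pr. rewrite Rmin_left, Rmax_right by lra. reflexivity. }
  assert (Pl : forall g g', Rabs (pr g' - pr g) <= Rabs (g' - g)).
  { intros g g'. unfold pr, Rmax, Rmin.
    repeat destruct (Rle_dec _ _); unfold Rabs; repeat destruct (Rcase_abs _); lra. }
  destruct (functional_choice
    (fun g (c : (R -> state) * R) => window amp (pr g) m T1 T2 (fst c) /\
       T1 <= snd c <= T2 /\ cy (fst c (snd c)) = 0)) as [c Hc].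
  { intros g. destruct (Win (pr g) (Pr g)) as [_ [y W]].
    destruct (window_crossing _ _ _ _ _ _ W HT) as [tau Ht]. exists (y, tau). auto. }
  set (h := fun g => cu (fst (c g) (snd (c g)))).
  assert (Hh : continuity h).
  { intros g. apply continuity_pt_filterlim.
    refine (proj2 (filterlim_locally h (h g)) _). intros eps.
    destruct (Hc g) as [W [Ht E]].
    destruct (crossing_close _ _ _ _ _ _ _ eps (proj1 (Win _ (Pr g))) m0 T0 W Ht E
      (cond_pos eps)) as [d [d0 H]].
    exists (mkposreal d d0). intros g' Hg'.
    destruct (Hc g') as [W' [Ht' E']].
    apply (H (pr g')); try assumption.
    - exact (Rle_lt_trans _ _ _ (Pl g g') Hg').
    - exact (proj1 (Win _ (Pr g'))).
    - apply (window_branch _ _ _ _ _ _ W'). }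
  assert (hm : h gm < 0).
  { destruct (Hc gm) as [W [Ht E]]. rewrite (Pi gm) in W by lra. unfold h.
    set (y := fst (c gm)) in *. set (t := snd (c gm)) in *.
    assert (U : y tm = ym tm).
    { apply (branch_unique amp gm tm); try lra; [apply Win; lra| |exact Bm].
      apply (branch_restrict _ _ T2); [lra|apply (window_branch _ _ _ _ _ _ W)]. }
    rewrite <- U in Ym, Um.
    destruct (Rle_lt_dec tm t) as [L|L].
    - pose proof (window_momentum _ _ _ _ _ _ W tm t ltac:(lra) L ltac:(lra)). lra.
    - pose proof (window_height _ _ _ _ _ _ W t tm ltac:(lra) ltac:(lra) ltac:(lra)). nra. }
  assert (hp : 0 < h gp).
  { destruct (Hc gp) as [W [Ht E]]. rewrite (Pi gp) in W by lra. unfold h.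
    set (y := fst (c gp)) in *. set (t := snd (c gp)) in *.
    assert (U : y tp = yp tp).
    { apply (branch_unique amp gp tp); try lra; [apply Win; lra| |exact Bp].
      apply (branch_restrict _ _ T2); [lra|apply (window_branch _ _ _ _ _ _ W)]. }
    rewrite <- U in Yp, Up.
    destruct (Rle_lt_dec t tp) as [L|L].
    - pose proof (window_momentum _ _ _ _ _ _ W t tp ltac:(lra) L ltac:(lra)). lra.
    - pose proof (window_height _ _ _ _ _ _ W tp t ltac:(lra) ltac:(lra) ltac:(lra)). nra. }
  destruct (IVT h gm gp Hh Hg hm hp) as [g [Hg' Z]].
  destruct (Hc g) as [W [Ht E]]. rewrite (Pi g Hg') in W.
  exists g, (fst (c g)), (snd (c g)).
  split; [exact Hg'|]. split; [apply Win, Hg'|]. split; [exact W|].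
  split; [exact Ht|]. split; assumption.
Qed.

(** * Certificates of crossings *)

(** The error e bounds 3 |Y - y| and |P_X - u|, whence the factor 3. *)
Definition crossing_check (sg : Z) (N n : nat) (g amp : Z) (X Y U V : list Z) (r rad : Z)
  (hs : list Z) (T1 T2 : Z) : bool :=
  match sharp_check N n g amp X Y U V r rad hs with
  | Some ((_, y, u, _), e) =>
    (e <? 3 * (sg * y))%Z && (e <? sg * u)%Z
    && (T1 <=? total hs)%Z && (total hs <=? T2)%Z
  | None => false
  end.

(** The inequalities say that the mass lies within 10^(-10) of the prescribed one, Y changes sign over the
    last step, and during this step Y' = P_Y - X >= 1/25, X is between 0.81 and 0.85,
    |Y| <= 1/50 and P_Y <= 0.97. The last three imply P_X' <= 0 by [attraction_bound]. *)
Definition window_check (N n : nat) (mg : tm) (amp : Z) (X Y U V : list Z) (r rad : Z)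
  (hs : list Z) (h : Z) : bool :=
  match wide_check N n mg amp X Y U V r rad hs h with
  | Some (mm, ((x, y, _, v), e1, var), ((_, y2, _, _), e2)) =>
    (Z.abs (10 ^ 12 * mid mm - 4253863522 * fone) + 10 ^ 12 * snd mm <=? 100 * fone)%Z
    && (3 * y + e1 <? 0)%Z && (e2 <? 3 * y2)%Z
    && (3 * fone <=? 25 * (3 * (v - x) - 4 * var))%Z
    && (243 * fone <=? 100 * (3 * x - var))%Z
    && (100 * (3 * x + var) <=? 255 * fone)%Z
    && (50 * (3 * Z.abs y + var) <=? 3 * fone)%Z
    && (100 * (v + var) <=? 97 * fone)%Z
  | None => false
  end.

Lemma wnorm_coord_bounds (z : state) x y u v e : wnorm (minus z (real (x, y, u, v))) <= val e ->
  3 * Rabs (cx z - val x) <= val e /\ 3 * Rabs (cy z - val y) <= val e /\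
  Rabs (cu z - val u) <= val e /\ Rabs (cv z - val v) <= val e.
Proof.
  intros H. destruct (wnorm_coords (minus z (real (x, y, u, v)))) as [A [B [C D]]].
  destruct z as [[[a b] c] d].
  change (minus ((a, b, c, d) : state) (real (x, y, u, v)))
    with ((a - val x, b - val y, c - val u, d - val v) : state) in *.
  unfold cx, cy, cu, cv in *; cbn [fst snd] in *.
  repeat split; lra.
Qed.

Lemma crossing_sound sg N n g amp X Y U V r rad hs T1 T2 :
  crossing_check sg N n g amp X Y U V r rad hs T1 T2 = true -> (sg = 1 \/ sg = -1)%Z ->
  exists y t, val T1 <= t <= val T2 /\ branch (val amp) (val g) t y /\
    0 < IZR sg * cy (y t) /\ 0 < IZR sg * cu (y t).
Proof.
  unfold crossing_check. intros H Hsg.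
  destruct (sharp_check N n g amp X Y U V r rad hs) as [[[[[x0 y0] u0] v0] e]|] eqn:E;
    [|discriminate].
  apply andb_prop in H. destruct H as [H B4]. apply andb_prop in H. destruct H as [H B3].
  apply andb_prop in H. destruct H as [B1 B2].
  apply Z.ltb_lt in B1, B2. apply Z.leb_le in B3, B4.
  apply val_lt in B1, B2. apply val_le in B3, B4.
  rewrite !val_scale in B1. rewrite val_scale in B2.
  destruct (sharp_sound _ _ _ _ _ _ _ _ _ _ _ _ _ E) as [_ [y [By Hy]]].
  destruct (wnorm_coord_bounds _ _ _ _ _ _ Hy) as [_ [Cy [Cu _]]].
  exists y, (val (total hs)). split; [split; assumption|]. split; [exact By|].
  assert (P : forall a, IZR sg * a <= Rabs a).
  { intros a. destruct Hsg as [-> | ->].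
    - rewrite Rmult_1_l. apply Rle_abs.
    - pose proof (Rle_abs (- a)) as Q. rewrite Rabs_Ropp in Q. lra. }
  pose proof (P (val y0 - cy (y (val (total hs))))) as P1.
  pose proof (P (val u0 - cu (y (val (total hs))))) as P2.
  rewrite Rabs_minus_sym in P1, P2. rewrite Rmult_minus_distr_l in P1, P2.
  split; lra.
Qed.

Lemma attraction_bound mu x y : 0 <= mu <= 43 / 10000 -> 81 / 100 <= x <= 85 / 100 ->
  Rabs y <= 1 / 50 -> 1 <= fst (force mu x y).
Proof.
  intros Hm Hx Hy. cbn [force kepler fst snd].
  assert (Y2 : y ^ 2 <= (1 / 50) ^ 2) by (rewrite <- pow2_abs; apply pow_incr; split;
    [apply Rabs_pos|exact Hy]).
  pose proof (pow2_ge_0 y) as Y0.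
  assert (R1 : 0 < sqrt ((x - mu) ^ 2 + y ^ 2) <= 86 / 100).
  { split; [apply sqrt_lt_R0; nra|].
    rewrite <- (sqrt_pow2 (86 / 100)) by lra. apply sqrt_le_1_alt. nra. }
  assert (R2 : 0 < sqrt ((x - mu + 1) ^ 2 + y ^ 2)) by (apply sqrt_lt_R0; nra).
  set (s1 := sqrt ((x - mu) ^ 2 + y ^ 2)) in *.
  set (s2 := sqrt ((x - mu + 1) ^ 2 + y ^ 2)) in *. clearbody s1 s2.
  assert (I1 : 3 / 2 <= / s1 ^ 3).
  { replace (3 / 2) with (/ (2 / 3)) by field. apply Rinv_le_contravar.
    - apply pow_lt. lra.
    - apply Rle_trans with ((86 / 100) ^ 3); [apply pow_incr; lra|lra]. }
  assert (I2 : 0 < / s2 ^ 3) by (apply Rinv_0_lt_compat, pow_lt, R2).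
  set (i1 := / s1 ^ 3) in *. set (i2 := / s2 ^ 3) in *. clearbody i1 i2.
  assert (J1 : 6 / 5 <= (x - mu) * i1) by nra.
  assert (J2 : 0 <= mu * ((x - mu + 1) * i2)).
  { apply Rmult_le_pos; [lra|]. apply Rmult_le_pos; lra. }
  nra.
Qed.

Lemma window_sound N n mg amp X Y U V r rad hs h gf t0 g :
  window_check N n mg amp X Y U V r rad hs h = true -> encl gf mg -> 0 <= t0 <= 1 ->
  gf t0 = g ->
  0 <= val (total hs) < val (total hs) + val h /\ admissible g /\
  Rabs (mu_of g - 4253863522 / 10 ^ 12) <= / 10 ^ 10 /\
  exists y, window (val amp) g (1 / 25) (val (total hs)) (val (total hs) + val h) y.
Proof.
  unfold window_check. intros H Egf Ht0 Eg0.
  destruct (wide_check N n mg amp X Y U V r rad hs h)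
    as [[[mm [[[[[x0 y0] u0] v0] e1] var]] [[[[x2 y2] u2] v2] e2]]|] eqn:E; [|discriminate].
  apply andb_prop in H. destruct H as [H B8]. apply andb_prop in H. destruct H as [H B7].
  apply andb_prop in H. destruct H as [H B6]. apply andb_prop in H. destruct H as [H B5].
  apply andb_prop in H. destruct H as [H B4]. apply andb_prop in H. destruct H as [H B3].
  apply andb_prop in H. destruct H as [B1 B2].
  apply Z.ltb_lt in B2, B3. apply Z.leb_le in B1, B4, B5, B6, B7, B8.
  destruct (wide_sound _ _ _ _ _ _ _ _ _ _ _ _ _ _ _ _ _ _ _ _ _ E Egf Ht0 Eg0)
    as [HT [Adm [Em [y [By [H1 [Hw H2]]]]]]].
  split; [exact HT|]. split; [exact Adm|].
  pose proof (encl_mid _ (mu_of g) _ Em eq_refl) as Mmu.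
  assert (Y0 : Rabs (val y0) <= val (Z.abs y0)).
  { unfold val, Rdiv. rewrite Rabs_mult, abs_IZR, (Rabs_pos_eq (/ _))
      by (left; apply Rinv_0_lt_compat, fone_pos). lra. }
  split.
  { apply val_le in B1. rewrite val_add, !val_scale, val_fone in B1.
    assert (Q : Rabs (val (10 ^ 12 * mid mm - 4253863522 * fone)) 
      <= val (Z.abs (10 ^ 12 * mid mm - 4253863522 * fone))).
    { unfold val, Rdiv. rewrite Rabs_mult, abs_IZR, (Rabs_pos_eq (/ _))
        by (left; apply Rinv_0_lt_compat, fone_pos). lra. }
    rewrite val_sub, !val_scale, val_fone in Q.
    change (10 ^ 12)%Z with 1000000000000%Z in *.
    apply Rabs_le_between in Q. apply Rabs_le_between in Mmu.
    apply Rabs_le. lra. }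
  apply val_lt in B2, B3. apply val_le in B4, B5, B6, B7, B8.
  val_simpl B2. val_simpl B3. val_simpl B4. val_simpl B5. val_simpl B6. val_simpl B7. val_simpl B8.
  exists y. constructor.
  - exact By.
  - destruct (wnorm_coord_bounds _ _ _ _ _ _ H1) as [_ [C _]].
    pose proof (Rle_abs (cy (y (val (total hs))) - val y0)). lra.
  - destruct (wnorm_coord_bounds _ _ _ _ _ _ H2) as [_ [C _]].
    rewrite Rabs_minus_sym in C.
    pose proof (Rle_abs (val y2 - cy (y (val (total hs) + val h)))). lra.
  - intros t Ht. destruct (wnorm_coord_bounds _ _ _ _ _ _ (Hw t Ht)) as [Cx [_ [_ Cv]]].
    destruct (y t) as [[[a b] c] d]. unfold cx, cy, cu, cv in *. cbn [field fst snd] in *.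
    apply Rabs_le_between in Cv. 
    pose proof (Rle_abs (a - val x0)). lra.
  - intros t Ht. destruct (wnorm_coord_bounds _ _ _ _ _ _ (Hw t Ht)) as [Cx [Cy [_ Cv]]].
    destruct (y t) as [[[a b] c] d]. unfold cx, cy, cu, cv in *. cbn [field fst snd] in *.
    apply Rabs_le_between in Cv.
    pose proof (Rle_abs (a - val x0)) as A1. pose proof (Rle_abs (- (a - val x0))) as A2.
    rewrite Rabs_Ropp in A2.
    destruct Adm as [_ [_ [_ [Hm _]]]].
    assert (1 <= fst (force (mu_of g) a b)).
    { apply attraction_bound; [exact Hm|lra|].
      pose proof (Rabs_triang (b - val y0) (val y0)) as T.
      replace (b - val y0 + val y0) with b in T by ring. lra. }
    lra.
Qed.

(** * Numerical data and the symmetric branch *)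

Local Open Scope Z_scope.

(** Step lengths in units of 1/1024. *)
Definition grid_steps (ks : list Z) : list Z := map (fun k => k * (fone / 1024)) ks.

(** Coefficients of the unstable manifold from its recurrence in powers of s, and step lengths from a
    non-rigorous integration. The lists X, Y, U, V start at order s^2. *)
Definition amplitude : Z := 11805916207174113034.
Definition g_minus : Z := 127613631175200586041.
Definition g_plus : Z := 127613631246036083283.
Definition X_plus : list Z := ((-445608130379414928) :: 30348639919873025 :: (-2491514618367393)
   :: 226480743531480 :: (-21902719903233) :: 2204501024953 :: (-227800664656) :: 23943031105 ::
   (-2541633377) :: 270872518 :: (-28818066) :: 3041754 :: (-316075) :: 31980 :: (-3094) :: 276
   :: (-21) :: 1 :: nil).
Definition Y_plus : list Z := ((-1762543452997679) :: 8236778418630841 :: (-1157487974553906) ::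
   143815284502852 :: (-17518002412665) :: 2135462033522 :: (-261788267646) :: 32299407954 ::
   (-4009018135) :: 500211689 :: (-62690318) :: 7886089 :: (-995076) :: 125875 :: (-15955) ::
   2025 :: (-257) :: 33 :: (-4) :: 1 :: nil).
Definition U_plus : list Z := ((-2493986699324594454) :: 246726910310056241 ::
   (-26751319330488815) :: 3027351855620483 :: (-350498374892121) :: 41078709477782 ::
   (-4841649462148) :: 571148082224 :: (-67166518663) :: 7843811000 :: (-905730069) :: 102849009
   :: (-11396774) :: 1217456 :: (-122663) :: 11122 :: (-790) :: 13 :: 10 :: (-3) :: 1 :: nil).
Definition V_plus : list Z := ((-455479733225700801) :: 99547108595887017 ::
   (-15457165552776507) :: 2240172050578702 :: (-316245697122880) :: 44065321921826 ::
   (-6092665564587) :: 838000222883 :: (-114809602606) :: 15679514607 :: (-2135502892) ::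
   290134915 :: (-39328445) :: 5319450 :: (-717971) :: 96703 :: (-12998) :: 1743 :: (-233) :: 31
   :: (-4) :: 1 :: nil).
Definition steps_plus : list Z := grid_steps (125 :: 121 :: 117 :: 115 :: 113 :: 111 :: 111 ::
   113 :: 113 :: 115 :: 115 :: 109 :: 101 :: 91 :: 83 :: 77 :: 69 :: 65 :: 61 :: 57 :: 55 :: 53
   :: 51 :: 51 :: 51 :: 51 :: 51 :: 53 :: 55 :: 57 :: 61 :: 65 :: 69 :: 75 :: 81 :: 87 :: 95 ::
   103 :: 111 :: 119 :: 127 :: 135 :: 143 :: nil) ++ 42299815233951747211 :: nil.
Definition X_minus : list Z := ((-445608130671594316) :: 30348639956543866 ::
   (-2491514622783697) :: 226480744060805 :: (-21902719966774) :: 2204501032589 ::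
   (-227800665573) :: 23943031215 :: (-2541633390) :: 270872520 :: (-28818066) :: 3041754 ::
   (-316075) :: 31980 :: (-3094) :: 276 :: (-21) :: 1 :: nil).
Definition Y_minus : list Z := ((-1762543454462988) :: 8236778428716203 :: (-1157487976644246)
   :: 143815284844990 :: (-17518002464347) :: 2135462041040 :: (-261788268717) :: 32299408105 ::
   (-4009018156) :: 500211692 :: (-62690319) :: 7886089 :: (-995076) :: 125875 :: (-15955) ::
   2025 :: (-257) :: 33 :: (-4) :: 1 :: nil).
Definition U_minus : list Z := ((-2493986700800172857) :: 246726910591765608 ::
   (-26751319376085550) :: 3027351862487389 :: (-350498375884573) :: 41078709617189 ::
   (-4841649481293) :: 571148084802 :: (-67166519003) :: 7843811044 :: (-905730074) :: 102849010
   :: (-11396774) :: 1217456 :: (-122663) :: 11122 :: (-790) :: 13 :: 10 :: (-3) :: 1 :: nil).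
Definition V_minus : list Z := ((-455479733525456619) :: 99547108712867334 ::
   (-15457165579779820) :: 2240172055770019 :: (-316245698035993) :: 44065322074160 ::
   (-6092665589118) :: 838000226734 :: (-114809603199) :: 15679514697 :: (-2135502905) ::
   290134917 :: (-39328445) :: 5319450 :: (-717971) :: 96703 :: (-12998) :: 1743 :: (-233) :: 31
   :: (-4) :: 1 :: nil).
Definition steps_minus : list Z := grid_steps (125 :: 121 :: 117 :: 115 :: 113 :: 111 :: 111 ::
   113 :: 113 :: 115 :: 115 :: 109 :: 101 :: 91 :: 83 :: 77 :: 69 :: 65 :: 61 :: 57 :: 55 :: 53
   :: 51 :: 51 :: 51 :: 51 :: 51 :: 53 :: 55 :: 57 :: 61 :: 65 :: 69 :: 75 :: 81 :: 87 :: 95 ::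
   103 :: 111 :: 119 :: 127 :: 135 :: 143 :: nil) ++ 42299821393164416977 :: nil.
Definition X_mid : list Z := ((-445608130525504622) :: 30348639938208445 :: (-2491514620575545)
   :: 226480743796143 :: (-21902719935004) :: 2204501028771 :: (-227800665115) :: 23943031160 ::
   (-2541633384) :: 270872519 :: (-28818066) :: 3041754 :: nil).
Definition Y_mid : list Z := ((-1762543453730333) :: 8236778423673522 :: (-1157487975599076) ::
   143815284673921 :: (-17518002438506) :: 2135462037281 :: (-261788268182) :: 32299408030 ::
   (-4009018145) :: 500211691 :: (-62690318) :: 7886089 :: nil).
Definition U_mid : list Z := ((-2493986700062383656) :: 246726910450910925 ::
   (-26751319353287183) :: 3027351859053936 :: (-350498375388347) :: 41078709547486 ::
   (-4841649471721) :: 571148083513 :: (-67166518833) :: 7843811022 :: (-905730071) :: 102849010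
   :: nil).
Definition V_mid : list Z := ((-455479733375578710) :: 99547108654377176 :: (-15457165566278163)
   :: 2240172053174360 :: (-316245697579436) :: 44065321997993 :: (-6092665576853) ::
   838000224808 :: (-114809602903) :: 15679514652 :: (-2135502899) :: 290134916 :: nil).
Definition wide_steps : list Z := grid_steps (95 :: 101 :: 109 :: 117 :: 125 :: 125 :: 127 ::
   131 :: 133 :: 135 :: 135 :: 127 :: 115 :: 101 :: 91 :: 83 :: 75 :: 71 :: 67 :: 63 :: 63 :: 63
   :: 65 :: 63 :: 67 :: 71 :: 75 :: 81 :: 89 :: 97 :: 105 :: 113 :: 121 :: 129 :: 137 :: 145 ::
   153 :: nil) ++ 39440572982133099844 :: nil.
Definition window_length : Z := 47223664828696452136.

Definition t_start : Z := total wide_steps.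

(** All g in the interval at once: the model of g is g_minus + (g_plus - g_minus) t for t in
    [0, 1]. *)
Lemma window_certificate :
  window_check 14 10 (g_minus :: g_plus - g_minus :: nil, 0) amplitude X_mid Y_mid U_mid V_mid
    300000000000 (6 * (fone / 1000)) wide_steps window_length = true.
Proof. vm_cast_no_check (eq_refl true). Qed.

(** At the two ends of the interval a more precise integration decides the signs. The time of
    observation differs from the crossing time by 2.2e-9, after it for g_plus and before it for
    g_minus. *)
Lemma crossing_plus_certificate :
  crossing_check 1 24 16 g_plus amplitude X_plus Y_plus U_plus V_plus
    150000 (fone / 10000) steps_plus t_start (t_start + window_length) = true.
Proof. vm_cast_no_check (eq_refl true). Qed.

Lemma crossing_minus_certificate :
  crossing_check (-1) 24 16 g_minus amplitude X_minus Y_minus U_minus V_minus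
    150000 (fone / 10000) steps_minus t_start (t_start + window_length) = true.
Proof. vm_cast_no_check (eq_refl true). Qed.

Close Scope Z_scope.
Theorem symmetric_branch : exists g y tau,
  admissible g /\ Rabs (mu_of g - 4253863522 / 10 ^ 12) <= / 10 ^ 10 /\
  branch (val amplitude) g tau y /\ 0 <= tau /\ cy (y tau) = 0 /\ cu (y tau) = 0 /\
  exists t, 0 <= t <= tau /\ cy (y t) < 0.
Proof.
  assert (R0 : val g_minus < val g_plus) by (apply val_lt; reflexivity).
  assert (Win : forall g, val g_minus <= g <= val g_plus ->
    0 <= val t_start < val t_start + val window_length /\ admissible g /\
    Rabs (mu_of g - 4253863522 / 10 ^ 12) <= / 10 ^ 10 /\
    exists y, window (val amplitude) g (1 / 25) (val t_start) (val t_start + val window_length) y).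
  { intros g Hg.
    apply (window_sound _ _ _ _ _ _ _ _ _ _ _ _ _
      ((g - val g_minus) / (val g_plus - val g_minus)) g window_certificate (encl_exact _)).
    - split; [apply Rmult_le_pos; [lra|left; apply Rinv_0_lt_compat; lra]|].
      apply Rmult_le_reg_r with (val g_plus - val g_minus); [lra|].
      unfold Rdiv. rewrite Rmult_assoc, Rinv_l by lra. lra.
    - pose proof fone_pos. cbn [peval]. rewrite minus_IZR.
      assert (N : IZR g_minus < IZR g_plus) by (apply IZR_lt; reflexivity).
      unfold val. field. lra. }
  destruct (Win (val g_minus) ltac:(lra)) as [HT _].
  destruct (shooting (val amplitude) (val g_minus) (val g_plus) (1 / 25)
    (val t_start) (val t_start + val window_length)) as [g [y [tau [Hg [Ag [W [Ht [Yt Ut]]]]]]]];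
    try lra.
  - intros g Hg. destruct (Win g Hg) as [_ [A [_ B]]]. split; assumption.
  - destruct (crossing_sound _ _ _ _ _ _ _ _ _ _ _ _ _ _ crossing_minus_certificate
      (or_intror eq_refl)) as [y [t [Ht [B [P Q]]]]].
    rewrite val_add in Ht. exists y, t. split; [exact Ht|]. split; [exact B|]. lra.
  - destruct (crossing_sound _ _ _ _ _ _ _ _ _ _ _ _ _ _ crossing_plus_certificate
      (or_introl eq_refl)) as [y [t [Ht [B [P Q]]]]].
    rewrite val_add in Ht. exists y, t. split; [exact Ht|]. split; [exact B|]. lra.
  - exists g, y, tau. split; [exact Ag|]. split; [apply Win, Hg|].
    split; [apply (branch_restrict _ _ (val t_start + val window_length)); [lra|];
      apply (window_branch _ _ _ _ _ _ W)|].
    split; [lra|]. split; [exact Yt|]. split; [exact Ut|].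
    exists (val t_start). split; [lra|]. apply (window_start _ _ _ _ _ _ W).
Qed.

(** * The linearisation at the libration point *)

Definition dstate (u : state -> R) (p : state) (du : state -> R) : Prop :=
  filterdiff (V := R_NormedModule) u (locally p) du.

Lemma dstate_ext u p d d' : dstate u p d -> (forall v, d v = d' v) -> dstate u p d'.
Proof. intros H E. exact (filterdiff_ext_lin u d d' H E). Qed.

Lemma dstate_plus u u' p d d' : dstate u p d -> dstate u' p d' ->
  dstate (fun z => u z + u' z) p (fun v => d v + d' v).
Proof. exact (filterdiff_plus_fct (V := R_NormedModule) u u' d d'). Qed.

Lemma dstate_minus u u' p d d' : dstate u p d -> dstate u' p d' ->
  dstate (fun z => u z - u' z) p (fun v => d v - d' v).
Proof. exact (filterdiff_minus_fct (V := R_NormedModule) u u' d d'). Qed.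

Lemma dstate_const k p : dstate (fun _ => k) p (fun _ => 0).
Proof. exact (filterdiff_const (V := R_NormedModule) k). Qed.

Lemma dstate_mult u u' p d d' : dstate u p d -> dstate u' p d' ->
  dstate (fun z => u z * u' z) p (fun v => d v * u' p + u p * d' v).
Proof. exact (filterdiff_mult_fct (K := R_AbsRing) u u' p d d' Rmult_comm). Qed.

Lemma dstate_comp u p d (f : R -> R) l : dstate u p d -> is_derive f (u p) l ->
  dstate (fun z => f (u z)) p (fun v => d v * l).
Proof. exact (filterdiff_comp' (V := R_NormedModule) (W := R_NormedModule) u f p d _). Qed.

Lemma dstate_coords p : dstate cx p cx /\ dstate cy p cy /\ dstate cu p cu /\ dstate cv p cv.
Proof.
  split; [|split; [|split]]; refine (filterdiff_linear _ _).
  - exact (is_linear_comp _ _ (is_linear_comp _ _ is_linear_fst is_linear_fst) is_linear_fst).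
  - exact (is_linear_comp _ _ (is_linear_comp _ _ is_linear_fst is_linear_fst) is_linear_snd).
  - exact (is_linear_comp _ _ is_linear_fst is_linear_snd).
  - exact is_linear_snd.
Qed.

Lemma inverse_cube_derive w : 0 < w ->
  is_derive (fun w => / sqrt w ^ 3) w (- (3 / 2) * / sqrt w ^ 5).
Proof.
  intros H. pose proof (sqrt_lt_R0 w H) as S.
  auto_derive.
  - split; [exact H|]. split; [|trivial]. apply Rgt_not_eq.
    repeat apply Rmult_lt_0_compat; lra.
  - field. lra.
Qed.

Lemma kepler_derive (a : R) p (u v : state -> R) du dv : a <> 0 ->
  dstate u p du -> dstate v p dv -> u p = a -> v p = 0 ->
  dstate (fun z => fst (kepler (u z) (v z))) p (fun w => -2 * / Rabs a ^ 3 * du w) /\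
  dstate (fun z => snd (kepler (u z) (v z))) p (fun w => / Rabs a ^ 3 * dv w).
Proof.
  intros Ha Hu Hv Eu Ev.
  assert (A : 0 < Rabs a) by now apply Rabs_pos_lt.
  pose proof (dstate_plus _ _ _ _ _ (dstate_mult _ _ _ _ _ Hu Hu) (dstate_mult _ _ _ _ _ Hv Hv)) as HW.
  cbv beta in HW. rewrite Eu, Ev in HW.
  assert (S : sqrt (u p * u p + v p * v p) = Rabs a).
  { rewrite Eu, Ev, <- sqrt_Rsqr_abs. f_equal. unfold Rsqr. ring. }
  assert (P : 0 < u p * u p + v p * v p) by (rewrite Eu, Ev; nra).
  pose proof (dstate_comp _ _ _ _ _ HW (inverse_cube_derive _ P)) as HC. rewrite S in HC.
  assert (E : forall z, sqrt (u z * u z + v z * v z) = sqrt (u z ^ 2 + v z ^ 2))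
    by (intros z; f_equal; ring).
  assert (A2 : a * a = Rabs a * Rabs a).
  { pose proof (pow2_abs a). nra. }
  split.
  - pose proof (dstate_mult _ _ _ _ _ Hu HC) as H. cbv beta in H. rewrite S, Eu in H.
    unfold dstate. cbn [kepler fst].
    apply (filterdiff_ext (V := R_NormedModule)
      (fun z => u z * / sqrt (u z * u z + v z * v z) ^ 3)); [intros z; now rewrite E|].
    apply (dstate_ext _ _ _ _ H). intros w.
    transitivity (du w * / Rabs a ^ 3 - 3 * du w * (a * a) * / Rabs a ^ 5); [field; lra|].
    rewrite A2. field. lra.
  - pose proof (dstate_mult _ _ _ _ _ Hv HC) as H. cbv beta in H. rewrite S, Ev in H.
    unfold dstate. cbn [kepler snd].
    apply (filterdiff_ext (V := R_NormedModule)
      (fun z => v z * / sqrt (u z * u z + v z * v z) ^ 3)); [intros z; now rewrite E|].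
    apply (dstate_ext _ _ _ _ H). intros w. ring.
Qed.

Definition libration (g : R) : state := (x_of g, 0, 0, x_of g).

Definition jacobian (c : R) (v : state) : state :=
  (cu v + cy v, cv v - cx v, cv v + 2 * c * cx v, - cu v - c * cy v).

Lemma libration_radii g : 0 < g < 1 ->
  r1 (mu_of g) (libration g) = 1 - g /\ r2 (mu_of g) (libration g) = g.
Proof.
  intros Hg. unfold r1, r2, libration. split.
  - replace ((x_of g - mu_of g) ^ 2 + 0 ^ 2) with ((1 - g) ^ 2) by (unfold x_of; ring).
    apply sqrt_pow2. lra.
  - replace ((x_of g - mu_of g + 1) ^ 2 + 0 ^ 2) with (g ^ 2) by (unfold x_of; ring).
    apply sqrt_pow2. lra.
Qed.

Lemma jacobian_field g : 0 < g < 1 ->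
  filterdiff (field (mu_of g)) (locally (libration g)) (jacobian (c_of g)).
Proof.
  intros Hg. destruct (dstate_coords (libration g)) as [X [Y [U V]]].
  set (p := libration g) in *. set (mu := mu_of g) in *.
  pose proof (dstate_minus _ _ _ _ _ X (dstate_const mu p)) as X1.
  pose proof (dstate_plus _ _ _ _ _ X1 (dstate_const 1 p)) as X2.
  cbv beta in X1, X2.
  destruct (kepler_derive (- (1 - g)) p _ _ _ _ ltac:(lra) X1 Y) as [K1 L1].
  { unfold p, libration, cx, x_of. cbn [fst]. fold mu. ring. }
  { reflexivity. }
  destruct (kepler_derive g p _ _ _ _ ltac:(lra) X2 Y) as [K2 L2].
  { unfold p, libration, cx, x_of. cbn [fst]. fold mu. ring. }
  { reflexivity. }
  rewrite Rabs_Ropp, Rabs_pos_eq in K1, L1 by lra. rewrite Rabs_pos_eq in K2, L2 by lra.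
  pose proof (dstate_plus _ _ _ _ _ (dstate_mult _ _ _ _ _ (dstate_const (1 - mu) p) K1)
    (dstate_mult _ _ _ _ _ (dstate_const mu p) K2)) as F1.
  pose proof (dstate_plus _ _ _ _ _ (dstate_mult _ _ _ _ _ (dstate_const (1 - mu) p) L1)
    (dstate_mult _ _ _ _ _ (dstate_const mu p) L2)) as F2.
  pose proof (filterdiff_pair _ _ _ _ _ (filterdiff_pair _ _ _ _ _ (filterdiff_pair _ _ _ _ _
    (dstate_plus _ _ _ _ _ U Y) (dstate_minus _ _ _ _ _ V X))
    (dstate_minus _ _ _ _ _ V F1))
    (dstate_minus _ _ _ _ _ (dstate_minus _ _ _ _ _ (dstate_const 0 p) U) F2)) as D.
  assert (CE : c_of g = (1 - mu) * / (1 - g) ^ 3 + mu * / g ^ 3).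
  { unfold c_of. fold mu. field. lra. }
  refine (filterdiff_ext_lin _ _ _ (filterdiff_ext _ _ _ _ D) _).
  - intros [[[x y] u] v]. unfold field, force, cx, cy, cu, cv. cbn [fst snd].
    apply state_ext; ring.
  - intros v. unfold jacobian. rewrite CE. apply state_ext; ring.
Qed.

(** * The homoclinic orbit *)

Lemma away_collision_free mu z : away (1 / 10) (1 / 10) mu z -> collision_free mu z.
Proof. intros [A B]. split; lra. Qed.

Lemma sol_solves mu y t : sol mu y t -> solves_at mu y t.
Proof.
  intros [A D]. pose proof (away_collision_free _ _ A) as C. split; [exact C|].
  rewrite vector_field_eq by exact C. exact D.
Qed.

Lemma libration_collision_free g : 0 < g < 1 -> collision_free (mu_of g) (libration g).
Proof. intros Hg. destruct (libration_radii g Hg) as [E1 E2]. split; rewrite ?E1, ?E2; lra. Qed.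

Lemma field_libration g : 0 < g < 1 -> field (mu_of g) (libration g) = zero.
Proof.
  intros Hg. rewrite zero_state. unfold libration. cbn [field].
  destruct (libration_radii g Hg) as [E1 E2]. unfold r1, r2, libration in E1, E2.
  pose proof (x_of_eq g Hg) as XE.
  unfold force, kepler. cbn [fst snd]. rewrite E1, E2.
  apply state_ext; try ring.
  rewrite XE at 1.
  replace (x_of g - mu_of g) with (- (1 - g)) by (unfold x_of; ring).
  field. lra.
Qed.

Lemma libration_is_L1 g : 0 < g < 1 -> is_L1 (mu_of g) (libration g).
Proof.
  intros Hg. exists (x_of g). split; [reflexivity|]. split; [unfold x_of; lra|].
  rewrite vector_field_eq by now apply libration_collision_free. now apply field_libration.
Qed.

Lemma collision_free_near mu p : collision_free mu p ->
  locally p (fun z => collision_free mu z).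
Proof.
  intros [H1 H2].
  assert (P1 : 0 < r1 mu p).
  { destruct p as [[[x y] u] v]. unfold r1 in *. pose proof (sqrt_pos ((x - mu) ^ 2 + y ^ 2)). lra. }
  assert (P2 : 0 < r2 mu p).
  { destruct p as [[[x y] u] v]. unfold r2 in *. pose proof (sqrt_pos ((x - mu + 1) ^ 2 + y ^ 2)). lra. }
  assert (Pm : 0 < Rmin (r1 mu p) (r2 mu p)) by now apply Rmin_glb_lt.
  assert (K : forall z : state, norm (minus z p) < Rmin (r1 mu p) (r2 mu p) ->
    collision_free mu z).
  { intros z N. pose proof (wnorm_le_norm (minus z p)).
    pose proof (Rmin_l (r1 mu p) (r2 mu p)). pose proof (Rmin_r (r1 mu p) (r2 mu p)).
    pose proof (r1_lipschitz mu z p). pose proof (r2_lipschitz mu z p).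
    split; apply Rgt_not_eq; lra. }
  apply (locally_le_locally_norm p). exists (mkposreal _ Pm). exact K.
Qed.

Lemma eigenvalue_intro g l (v : state) : 0 < g < 1 -> v <> zero ->
  jacobian (c_of g) v = scal l v ->
  jacobian_eigenvalue (vector_field (mu_of g)) (libration g) l.
Proof.
  intros Hg Hv E. exists (jacobian (c_of g)). split; [|exists v; split; assumption].
  apply (filterdiff_ext_locally (field (mu_of g))); [|now apply jacobian_field].
  eapply filter_imp; [|apply collision_free_near, libration_collision_free, Hg].
  intros z Hz. symmetry. now apply vector_field_eq.
Qed.

Lemma libration_eigenvalues g : 0 < g < 1 -> 0 < disc_of g -> 0 < lam2_of g ->
  jacobian_eigenvalue (vector_field (mu_of g)) (libration g) (lam_of g) /\
  jacobian_eigenvalue (vector_field (mu_of g)) (libration g) (- lam_of g).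
Proof.
  intros Hg Hd Hl. destruct (eigen_relations g Hg Hd Hl) as [R1 R2].
  set (l := lam_of g) in *. set (e := eta_of g) in *. set (c := c_of g) in *.
  assert (NZ : forall a b d, ((1, a, b, d) : state) <> zero).
  { intros a b d H. rewrite zero_state in H. pose proof (f_equal cx H) as H'.
    unfold cx in H'. cbn [fst] in H'. lra. }
  split.
  - apply (eigenvalue_intro g l (1, e, l - e, l * e + 1) Hg (NZ _ _ _)).
    fold c. unfold jacobian, cx, cy, cu, cv. cbn [fst snd]. rewrite scal_state.
    apply state_ext; lra.
  - apply (eigenvalue_intro g (- l) (1, - e, - (l - e), l * e + 1) Hg (NZ _ _ _)).
    fold c. unfold jacobian, cx, cy, cu, cv. cbn [fst snd]. rewrite scal_state.
    apply state_ext; lra.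
Qed.

(** The reversing symmetry. *)
Definition flip (z : state) : state := (cx z, - cy z, - cu z, cv z).

Lemma flip_flip z : flip (flip z) = z.
Proof.
  destruct z as [[[x y] u] v]. unfold flip, cx, cy, cu, cv. cbn [fst snd].
  now rewrite !Ropp_involutive.
Qed.

Lemma field_flip mu z : field mu (flip z) = opp (flip (field mu z)).
Proof.
  destruct z as [[[x y] u] v]. unfold flip, cx, cy, cu, cv. cbn [field fst snd].
  rewrite opp_state. unfold force, kepler. cbn [fst snd].
  replace ((- y) ^ 2) with (y ^ 2) by ring. apply state_ext; ring.
Qed.

Lemma away_flip rho1 rho2 mu z : away rho1 rho2 mu z -> away rho1 rho2 mu (flip z).
Proof.
  destruct z as [[[x y] u] v]. unfold away, r1, r2, flip, cx, cy, cu, cv. cbn [fst snd].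
  now replace ((- y) ^ 2) with (y ^ 2) by ring.
Qed.

Lemma norm_flip (z p : state) : norm (minus (flip z) (flip p)) = norm (minus z p).
Proof.
  destruct z as [[[a b] c] d], p as [[[a' b'] c'] d']. unfold flip, cx, cy, cu, cv.
  cbn [fst snd]. rewrite !minus_state, !norm_state. f_equal. ring.
Qed.

Lemma sol_reflect mu y tau t : sol mu y (2 * tau - t) ->
  sol mu (fun s => flip (y (2 * tau - s))) t.
Proof.
  intros [A D]. split; [now apply away_flip|]. rewrite field_flip.
  assert (E : is_derive (fun s : R => 2 * tau - s) t (-1)) by (auto_derive; [trivial|ring]).
  pose proof (is_derive_comp y (fun s => 2 * tau - s) t _ _ D E) as C.
  destruct (is_derive_coords _ _ _ C) as [X [Y [U V]]].
  pose proof (is_derive_state _ _ _ _ t _ _ _ _ X (is_derive_opp (V := R_NormedModule) _ _ _ Y)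
    (is_derive_opp (V := R_NormedModule) _ _ _ U) V) as S.
  replace (opp (flip (field mu (y (2 * tau - t))))) with
    (cx (scal (-1) (field mu (y (2 * tau - t)))), 
     - cy (scal (-1) (field mu (y (2 * tau - t)))),
     - cu (scal (-1) (field mu (y (2 * tau - t)))),
     cv (scal (-1) (field mu (y (2 * tau - t)))));
    [exact S|].
  destruct (field mu (y (2 * tau - t))) as [[[a b] c] d]. 
  unfold flip. rewrite scal_state, opp_state. unfold cx, cy, cu, cv. cbn [fst snd].
  apply state_ext; ring.
Qed.

(** Before time 0 by the definition of a branch, afterwards by compactness. *)
Lemma branch_decay amp g T y : admissible g -> 0 <= T -> branch amp g T y ->
  exists C, 0 <= C /\ forall t, t <= T -> norm (minus (y t) (libration g)) <= C * exp (lam_of g * t).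
Proof.
  intros [_ [_ [_ [_ Hl]]]] HT [S [_ L]]. set (p := libration g). set (l := lam_of g) in *.
  set (w := (amp, amp * eta_of g, amp * (l - eta_of g), amp * (l * eta_of g + 1)) : state).
  destruct (continuity_ab_maj (fun t => norm (minus (y t) p)) 0 T HT) as [tm [Hm _]].
  { intros t Ht. apply continuity_pt_filterlim.
    assert (Cy : continuous y t) by (destruct (S t ltac:(lra)) as [_ D]; exact (continuous_of_derive y t _ D)).
    refine (continuous_of_lipschitz (V := R_NormedModule) y (fun t => norm (minus (y t) p))
      t 1 _ Cy).
    intros s. rewrite Rmult_1_l.
    eapply Rle_trans; [exact (norm_triangle_inv (minus (y s) p) (minus (y t) p))|].
    right. f_equal. destruct (y s) as [[[? ?] ?] ?], (y t) as [[[? ?] ?] ?], p as [[[? ?] ?] ?].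
    rewrite !minus_state. apply state_ext; ring. }
  set (M := norm (minus (y tm) p)) in *.
  assert (M0 : 0 <= M) by apply norm_ge_0.
  pose proof (wnorm_ge0 w) as W0.
  exists (M + wnorm w + 1). split; [lra|].
  intros t Ht. pose proof (exp_pos (l * t)) as Ep.
  destruct (Rle_lt_dec t 0) as [Neg|Pos].
  - assert (E1 : exp (l * t) <= 1) by (rewrite <- exp_0; apply exp_le_mono; nra).
    set (s := exp (l * t)) in *.
    eapply Rle_trans; [apply norm_le_wnorm|].
    eapply Rle_trans; [apply (wnorm_minus_triangle _ (linear_part amp g s))|].
    replace (minus (linear_part amp g s) p) with (scal s w).
    + rewrite wnorm_scal, Rabs_pos_eq by lra. specialize (L t Neg). fold l in L. fold s in L. nra.
    + unfold w, p, linear_part, libration. rewrite scal_state, minus_state. fold l.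
      apply state_ext; ring.
  - assert (E1 : 1 <= exp (l * t)) by (rewrite <- exp_0; apply exp_le_mono; nra).
    specialize (Hm t ltac:(lra)). cbv beta in Hm. fold M in Hm. nra.
Qed.

Lemma decay_limit (x : R -> state) (p : state) C l : 0 <= C -> 0 < l ->
  (forall t, t <= 0 -> norm (minus (x t) p) <= C * exp (l * t)) ->
  filterlim x (Rbar_locally m_infty) (locally p).
Proof.
  intros C0 Hl H. refine (proj2 (filterlim_locally_ball_norm x p) _). intros eps.
  pose proof (cond_pos eps) as e0.
  assert (P : 0 < eps / (C + 1)) by (apply Rdiv_lt_0_compat; lra).
  exists (Rmin 0 (ln (eps / (C + 1)) / l)). intros t Ht.
  pose proof (Rmin_l 0 (ln (eps / (C + 1)) / l)). pose proof (Rmin_r 0 (ln (eps / (C + 1)) / l)).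
  assert (E : exp (l * t) < eps / (C + 1)).
  { rewrite <- (exp_ln (eps / (C + 1))) by exact P. apply exp_increasing.
    replace (ln (eps / (C + 1))) with (l * (ln (eps / (C + 1)) / l)) by (field; lra).
    apply Rmult_lt_compat_l; lra. }
  specialize (H t ltac:(lra)). pose proof (exp_pos (l * t)).
  change (norm (minus (x t) p) < eps).
  apply Rle_lt_trans with (C * exp (l * t)); [exact H|].
  apply Rle_lt_trans with ((C + 1) * exp (l * t)); [nra|].
  apply Rlt_le_trans with ((C + 1) * (eps / (C + 1))); [|right; field; lra].
  apply Rmult_lt_compat_l; lra.
Qed.

Lemma filterlim_reflect (x : R -> state) (p : state) tau : (forall t, x (2 * tau - t) = flip (x t)) ->
  flip p = p -> filterlim x (Rbar_locally m_infty) (locally p) ->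
  filterlim x (Rbar_locally p_infty) (locally p).
Proof.
  intros Sy Sp H. refine (proj2 (filterlim_locally_ball_norm x p) _). intros eps.
  destruct (proj1 (filterlim_locally_ball_norm x p) H eps) as [M HM].
  exists (2 * tau - M). intros t Ht.
  assert (N : norm (minus (x (2 * tau - t)) p) < eps) by (apply HM; lra).
  rewrite Sy, <- Sp, norm_flip in N. exact N.
Qed.

Theorem mainTheorem5 :
  exists mu : R,
    Rabs (mu - 0.004253863522) <= / 10 ^ 10 /\
    exists (p : state) (lam : R) (x : R -> state),
      is_L1 mu p /\
      0 < lam /\
      jacobian_eigenvalue (vector_field mu) p lam /\
      jacobian_eigenvalue (vector_field mu) p (- lam) /\
      homoclinic_orbit mu p x /\
      forall t : R,
        unstable_manifold mu p lam (x t) /\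
        stable_manifold mu p (- lam) (x t).
Proof.
  destruct symmetric_branch as [g [y [tau [Ag [Hmu [B [T0 [Y0 [U0 [t1 [Ht1 Y1]]]]]]]]]]].
  pose proof Ag as [Hg [Hd [Hl [_ HL]]]]. assert (g01 : 0 < g < 1) by lra.
  set (p := libration g). set (lam := lam_of g) in *. set (mu := mu_of g) in *.
  assert (Fix : flip (y tau) = y tau).
  { destruct (y tau) as [[[a b] c] d]. unfold flip, cx, cy, cu, cv in *. cbn [fst snd] in *.
    rewrite Y0, U0, Ropp_0. reflexivity. }
  assert (Fp : flip p = p).
  { unfold flip, p, libration, cx, cy, cu, cv. cbn [fst snd]. rewrite Ropp_0. reflexivity. }
  assert (Sy : forall t, t <= tau -> sol mu y t) by apply B.
  (* At the crossing y is a fixed point of flip, so its mirror image continues it. *)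
  destruct (sol_glue mu y (fun s => flip (y (2 * tau - s))) tau) as [x [Xs1 [Xs2 [Xl Xr]]]].
  { exact Sy. }
  { apply sol_reflect, Sy. lra. }
  { replace (2 * tau - tau) with tau by ring. exact Fix. }
  assert (Xs : forall t, sol mu x t).
  { intros t. destruct (Rle_lt_dec t tau); [now apply Xs1|].
    apply Xs2; [lra|]. apply sol_reflect, Sy. lra. }
  assert (Sym : forall t, x (2 * tau - t) = flip (x t)).
  { intros t. destruct (Rle_lt_dec t tau) as [L|L].
    - rewrite Xr, Xl by lra. do 2 f_equal. ring.
    - rewrite Xl, Xr by lra. now rewrite flip_flip. }
  assert (Sx : forall t, solves_at mu x t) by (intros t; apply sol_solves, Xs).
  assert (Bx : forall T, 0 <= T -> branch (val amplitude) g T x).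
  { intros T HT. split; [intros t _; apply Xs|].
    destruct B as [_ [B1 B2]]. split; intros t Ht; rewrite Xl by lra; auto. }
  assert (Dec : forall T, exists C, 0 <= C /\
    forall t, t <= T -> norm (minus (x t) p) <= C * exp (lam * t)).
  { intros T. destruct (branch_decay _ _ _ _ Ag (Rmax_l 0 T) (Bx _ (Rmax_l 0 T))) as [C [C0 HC]].
    exists C. split; [exact C0|]. intros t Ht. apply HC.
    eapply Rle_trans; [exact Ht|apply Rmax_r]. }
  assert (Lim : filterlim x (Rbar_locally m_infty) (locally p)).
  { destruct (Dec 0) as [C [C0 HC]]. apply (decay_limit x p C lam C0); [lra|exact HC]. }
  exists mu. split.
  { replace 0.004253863522 with (4253863522 / 10 ^ 12) by lra. exact Hmu. }
  exists p, lam, x. destruct (libration_eigenvalues g g01 Hd Hl) as [Ev1 Ev2].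
  split; [now apply libration_is_L1|]. split; [lra|]. split; [exact Ev1|]. split; [exact Ev2|].
  assert (Shift : forall t s, solves_at mu (fun s => x (t + s)) s).
  { intros t s. destruct (Sx (t + s)) as [Cf D]. split; [exact Cf|].
    assert (E : is_derive (fun s : R => t + s) s 1) by (auto_derive; [trivial|ring]).
    pose proof (is_derive_comp x (fun s => t + s) s _ _ D E) as Dc.
    rewrite <- (scal_one_state (vector_field mu (x (t + s)))). exact Dc. }
  split.
  - split; [exact Sx|]. split; [|split; [|exact Lim]].
    + exists t1, tau. intros E. rewrite !Xl in E by lra.
      rewrite E, Y0 in Y1. lra.
    + exact (filterlim_reflect x p tau Sym Fp Lim).
  - intros t. split.
    + exists (fun s => x (t + s)). split; [now rewrite Rplus_0_r|].
      split; [intros s _; apply Shift|].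
      destruct (Dec t) as [C [C0 HC]]. exists (C * exp (lam * t)). intros s Hs.
      rewrite Rmult_assoc, <- exp_plus, <- Rmult_plus_distr_l. apply HC. lra.
    + exists (fun s => x (t + s)). split; [now rewrite Rplus_0_r|].
      split; [intros s _; apply Shift|].
      (* the mirror image of the estimate in the past *)
      destruct (Dec (2 * tau - t)) as [C [C0 HC]].
      exists (C * exp (lam * (2 * tau - t))). intros s Hs.
      specialize (HC (2 * tau - (t + s)) ltac:(lra)).
      rewrite Sym, <- Fp, norm_flip in HC.
      rewrite Rmult_assoc, <- exp_plus.
      replace (lam * (2 * tau - t) + - lam * s) with (lam * (2 * tau - (t + s))) by ring.
      exact HC.
Qed.
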